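(* Let $k$ be a field, $\Lambda$ a finite-dimensional selfinjective $k$-algebra, $Q$ a finite acyclic quiver, and $v$ a sink of $Q$. Then the reflection functor $$F(v):\ \underline{\mathrm{G\text{-}proj}}\,\Lambda Q\longrightarrow \underline{\mathrm{G\text{-}proj}}\,\Lambda Q(v),\qquad X\mapsto X(v),\quad f\mapsto f(v),$$ is an equivalence of categories.
   Context: Setting. $k$ is a field, $\Lambda$ a finite-dimensional selfinjective $k$-algebra, all modules are finitely generated, $Q$ is a finite quiver without oriented cycles (multiple arrows allowed); $s(\alpha),t(\alpha)$ denote source and target of an arrow $\alpha$. $\Lambda Q=\Lambda\otimes_k kQ$; a $\Lambda Q$-module is a representation $X=(X_i,X_\alpha)$ of $Q$ by $\Lambda$-modules $X_i$ ($i\in Q_0$) and $\Lambda$-homomorphisms $X_\alpha:X_{s(\alpha)}\to X_{t(\alpha)}$. For a path $p$, $X_p$ is the corresponding composition of structure maps (identity for a trivial path). $X$ is separated monic if for every vertex $i$ the map $u_{X,i}=(X_\alpha)_{t(\alpha)=i}:X_{i^-}:=\bigoplus_{t(\alpha)=i}X_{s(\alpha)}\to X_i$ is a monomorphism. $\mathrm{G\text{-}proj}\,\Lambda Q$ is the category of Gorenstein-projective $\Lambda Q$-modules; since $\Lambda$ is selfinjective these are exactly the separated monic representations. It is a Frobenius category, and $\underline{\mathrm{G\text{-}proj}}\,\Lambda Q$ is its stable category (morphisms modulo those factoring through projective $\Lambda Q$-modules). For a vertex $w$ and a $\Lambda$-module $J$, $P_w(J)=J\otimes_k P(w)$, where $P(w)$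 is the indecomposable projective $k$-linear representation at $w$; so $P_w(J)_i=\bigoplus_{p:w\to i}J$ (sum over all paths $p$ from $w$ to $i$), and the map along an arrow $\beta$ sends the summand of $p$ identically to the summand of $\beta p$. Reflection of the quiver. For a sink $v$ of $Q$, $Q(v)$ has the same vertices and is obtained by reversing every arrow of $Q$ ending in $v$. Arrows $\beta$ of $Q(v)$ with $s(\beta)=v$ correspond to arrows of $Q$ ending in $v$. Reflection on objects. For $X\in\mathrm{G\text{-}proj}\,\Lambda Q$ let $u_X=u_{X,v}:X_{v^-}\to X_v$ with cokernel $\pi_X:X_v\to X_{\bar v}$. Choose a projective cover $\delta_X:C_X\to X_{\bar v}$ with kernel $\sigma_X:\Omega_X\to C_X$, and maps $t_X:C_X\to X_v$, $k_X:\Omega_X\to X_{v^-}$ with $\pi_Xt_X=\delta_X$, $u_Xk_X=t_X\sigma_X$. Write $k_X=(k_{X,\beta})_{s(\beta)=v}$ with $k_{X,\beta}:\Omega_X\to X_{t(\beta)}$, $\beta$ running over the arrows of $Q(v)$ starting at $v$. Let $P=\bigoplus_{s(\beta)=v}P_{t(\beta)}(C_X)$, a projective $\Lambda Q(v)$-module; for $i\neq v$, $P_i=\bigoplus_{p}C_{X,p}$ where $p$ runs over the non-trivial paths $v\to i$ in $Q(v)$ and $C_{X,p}=C_X$. The $\Lambda Q(v)$-module $X(v)$ is defined by $X(v)_v=\Omega_X$, $X(v)_i=X_i\oplus P_i$ for $i\ne v$; for arrows $\beta$ with $s(\beta)\neq v$, $X(v)_\beta=X_\beta\oplus P_\beta$;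 for $s(\beta)=v$, $X(v)_\beta:\Omega_X\to X_{t(\beta)}\oplus C_{X,\beta}\oplus\bigoplus_{p:v\to t(\beta),\,p\neq\beta}C_{X,p}$ has components $k_{X,\beta},\ \sigma_X,\ 0$. Then $X(v)\in \mathrm{G\text{-}proj}\,\Lambda Q(v)$. Reflection on morphisms. For $f:X\to Y$ in $\mathrm{G\text{-}proj}\,\Lambda Q$ let $f_{v^-}:X_{v^-}\to Y_{v^-}$ be the componentwise map and $f_{\bar v}:X_{\bar v}\to Y_{\bar v}$ the map induced by $f_v$. Choose $C_f:C_X\to C_Y$ with $\delta_YC_f=f_{\bar v}\delta_X$, and let $\Omega_f:\Omega_X\to\Omega_Y$ satisfy $\sigma_Y\Omega_f=C_f\sigma_X$. There is a unique $\omega_f:C_X\to Y_{v^-}$ with $u_Y\omega_f=t_YC_f-f_vt_X$; write $\omega_f=(\omega_{f,\beta})_{s(\beta)=v}$. Define $f(v)_v=\Omega_f$ and, for $i\neq v$, $$f(v)_i=\begin{pmatrix} f_i & (Y_{p'}\,\omega_{f,\beta})_{p}\\ 0& C_f E\end{pmatrix}:X_i\oplus\bigoplus_{p}C_{X,p}\to Y_i\oplus\bigoplus_pC_{Y,p},$$ where $p=p'\beta$ runs over the non-trivial paths $v\to i$ in $Q(v)$ with first arrow $\beta$, and $C_fE$ is the diagonal map with entries $C_f$. The class of $f(v)$ in the stable category is independent of the choices and depends only on the class of $f$; $F(v)$ is the resulting functor. *)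

(* Defs.v *)
From HB Require Import structures.
From mathcomp Require Import all_boot all_order all_algebra all_field.
Set Implicit Arguments.
Unset Strict Implicit.
Unset Printing Implicit Defensive.
Import GRing.Theory.
Local Open Scope ring_scope.

(* Categories whose hom-sets carry an equivalence relation [heq] playing the
   role of equality of morphisms (so a quotient category has the same morphisms
   as the original one and a coarser [heq]). *)
Record category := Category {
  obj :> Type;
  Mor : obj -> obj -> Type;
  heq : forall X Y, Mor X Y -> Mor X Y -> Prop;
  idm : forall X, Mor X X;
  hcomp : forall X Y Z, Mor Y Z -> Mor X Y -> Mor X Z;
  heq_refl : forall X Y (f : Mor X Y), heq f f;
  heq_sym : forall X Y (f g : Mor X Y), heq f g -> heq g f;
  heq_trans : forall X Y (f g h : Mor X Y), heq f g -> heq g h -> heq f h;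
  comp_heq : forall X Y Z (g g' : Mor Y Z) (f f' : Mor X Y),
    heq g g' -> heq f f' -> heq (hcomp g f) (hcomp g' f');
  comp_idl : forall X Y (f : Mor X Y), heq (hcomp (idm Y) f) f;
  comp_idr : forall X Y (f : Mor X Y), heq (hcomp f (idm X)) f;
  compA : forall W X Y Z (h : Mor Y Z) (g : Mor X Y) (f : Mor W X),
    heq (hcomp h (hcomp g f)) (hcomp (hcomp h g) f)
}.
Arguments Mor {c} X Y.
Arguments heq {c X Y} f g.
Arguments idm {c} X.
Arguments hcomp {c X Y Z} g f.

Record functor_laws (C D : category) (F : C -> D)
    (Fm : forall X Y : C, Mor X Y -> Mor (F X) (F Y)) : Prop := FunctorLaws {
  functor_heq : forall (X Y : C) (f g : Mor X Y), heq f g -> heq (Fm _ _ f) (Fm _ _ g);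
  functor_id : forall X : C, heq (Fm _ _ (idm X)) (idm (F X));
  functor_comp : forall (X Y Z : C) (g : Mor Y Z) (f : Mor X Y),
    heq (Fm _ _ (hcomp g f)) (hcomp (Fm _ _ g) (Fm _ _ f))
}.

Record functor (C D : category) := Functor {
  fobj :> C -> D;
  fhom : forall X Y : C, Mor X Y -> Mor (fobj X) (fobj Y);
  fhomP : functor_laws fhom
}.
Arguments fhom {C D} f {X Y}.

Definition id_functor (C : category) : functor C C.
Proof.
exists (fun X : C => X) (fun X Y (f : Mor X Y) => f).
by split=> // *; exact: heq_refl.
Defined.

Definition comp_functor (C D E : category) (G : functor D E) (F : functor C D) :
  functor C E.
Proof.
exists (fun X => G (F X)) (fun X Y f => fhom G (fhom F f)).
have [G1 G2 G3] := fhomP G; have [F1 F2 F3] := fhomP F; split=> [X Y f g fg|X|X Y Z g f].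
- exact/G1/F1.
- exact: heq_trans (G1 _ _ _ _ (F2 X)) (G2 _).
- exact: heq_trans (G1 _ _ _ _ (F3 _ _ _ g f)) (G3 _ _ _ _ _).
Defined.

Definition naturally_isomorphic (C D : category) (F G : functor C D) : Prop :=
  exists (eta : forall X, Mor (F X) (G X)) (eta' : forall X, Mor (G X) (F X)),
  [/\ forall X, heq (hcomp (eta' X) (eta X)) (idm (F X)),
      forall X, heq (hcomp (eta X) (eta' X)) (idm (G X)) &
      forall X Y (f : Mor X Y), heq (hcomp (eta Y) (fhom F f)) (hcomp (fhom G f) (eta X))].

Definition is_equivalence (C D : category) (F : functor C D) : Prop :=
  exists G : functor D C,
    naturally_isomorphic (comp_functor G F) (id_functor C) /\
    naturally_isomorphic (comp_functor F G) (id_functor D).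

Section LinearMaps.
Variable R : pzRingType.

Definition Lin (U V : lmodType R) (f : U -> V) (fL : linear f) : {linear U -> V} :=
  HB.pack f (GRing.isLinear.Build R U V *:%R f fL).

Definition lin_comp (U V W : lmodType R) (g : {linear V -> W}) (f : {linear U -> V}) :
  {linear U -> W} := GRing.Linear.clone R U W *:%R (g \o f) _.
Definition lin_id (U : lmodType R) : {linear U -> U} :=
  GRing.Linear.clone R U U *:%R idfun _.
Definition lin_zero (U V : lmodType R) : {linear U -> V} :=
  GRing.Linear.clone R U V *:%R \0 _.

Definition lprod (U V : lmodType R) : lmodType R := GRing.Lmodule.clone R (U * V)%type _.

Definition prod_map_fun (U V U' V' : lmodType R) (f : {linear U -> U'})
  (g : {linear V -> V'}) (x : lprod U V) : lprod U' V' := (f x.1, g x.2).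
Fact prod_map_linear U V U' V' f g : linear (@prod_map_fun U V U' V' f g).
Proof. by move=> a x y; rewrite /prod_map_fun /= !linearP. Qed.
Definition prod_map U V U' V' f g := Lin (@prod_map_linear U V U' V' f g).

End LinearMaps.

(* Finite direct sums of modules. *)
Definition dsum_type (R : pzRingType) (I : finType) (M : I -> lmodType R) : Type :=
  {dffun forall i, M i}.

Section DirectSum.
Variables (R : pzRingType) (I : finType) (M : I -> lmodType R).
Implicit Types x y z : dsum_type M.

HB.instance Definition _ := Choice.on (dsum_type M).

Definition dsum_of (f : forall i, M i) : dsum_type M := finfun f.
Lemma dsumE f i : dsum_of f i = f i. Proof. exact: ffunE. Qed.
Lemma dsumP x y : (forall i, x i = y i) <-> x = y.
Proof. exact: ffunP. Qed.

Let add x y := dsum_of (fun i => x i + y i).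
Let opp x := dsum_of (fun i => - x i).
Let zero := dsum_of (fun=> 0).
Let scale a x := dsum_of (fun i => a *: x i).

Fact dsum_addA : associative add.
Proof. by move=> x y z; apply/dsumP=> i; rewrite !dsumE addrA. Qed.
Fact dsum_addC : commutative add.
Proof. by move=> x y; apply/dsumP=> i; rewrite !dsumE addrC. Qed.
Fact dsum_add0 : left_id zero add.
Proof. by move=> x; apply/dsumP=> i; rewrite !dsumE add0r. Qed.
Fact dsum_addN : left_inverse zero opp add.
Proof. by move=> x; apply/dsumP=> i; rewrite !dsumE addNr. Qed.
HB.instance Definition _ :=
  GRing.isZmodule.Build (dsum_type M) dsum_addA dsum_addC dsum_add0 dsum_addN.

Lemma dsum_addE x y i : (x + y) i = x i + y i. Proof. exact: dsumE. Qed.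
Lemma dsum_zeroE i : (0 : dsum_type M) i = 0. Proof. exact: dsumE. Qed.

Fact dsum_scaleA a b x : scale a (scale b x) = scale (a * b) x.
Proof. by apply/dsumP=> i; rewrite !dsumE scalerA. Qed.
Fact dsum_scale1 : left_id 1 scale.
Proof. by move=> x; apply/dsumP=> i; rewrite !dsumE scale1r. Qed.
Fact dsum_scaleDr : right_distributive scale +%R.
Proof. by move=> a x y; apply/dsumP=> i; rewrite !(dsumE, dsum_addE) scalerDr. Qed.
Fact dsum_scaleDl x : {morph scale^~ x : a b / a + b}.
Proof. by move=> a b; apply/dsumP=> i; rewrite !(dsumE, dsum_addE) scalerDl. Qed.
HB.instance Definition _ := GRing.Zmodule_isLmodule.Build R (dsum_type M)
  dsum_scaleA dsum_scale1 dsum_scaleDr dsum_scaleDl.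

Definition dsum : lmodType R := GRing.Lmodule.clone R (dsum_type M) _.

Lemma dsum_scaleE a x i : (a *: x) i = a *: x i. Proof. exact: dsumE. Qed.
Lemma dsum_sumE (J : Type) (r : seq J) (P : pred J) (F : J -> dsum_type M) i :
  (\sum_(j <- r | P j) F j) i = \sum_(j <- r | P j) F j i.
Proof. by elim/big_rec2: _ => [|j y x _ <-]; rewrite ?dsum_zeroE ?dsum_addE. Qed.

End DirectSum.
Arguments dsum_of {R I M} f.

Definition dsum_map_fun (R : pzRingType) (I : finType) (M N : I -> lmodType R)
  (f : forall i, {linear M i -> N i}) (x : dsum M) : dsum N := dsum_of (fun i => f i (x i)).
Fact dsum_map_linear R I M N f : linear (@dsum_map_fun R I M N f).
Proof.
move=> a x y; apply/dsumP=> i.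
by rewrite !(dsumE, dsum_addE, dsum_scaleE) linearP.
Qed.
Definition dsum_map R I M N f := Lin (@dsum_map_linear R I M N f).

Definition finitely_generated (R : pzRingType) (M : lmodType R) : Prop :=
  exists (I : finType) (g : I -> M), forall x, exists c : I -> R, x = \sum_i c i *: g i.

Record fgmod (R : pzRingType) := FGMod {
  fg_mod :> lmodType R;
  fg_modP : finitely_generated fg_mod
}.

Fact fg_prod_subproof (R : pzRingType) (M N : fgmod R) :
  finitely_generated (lprod M N).
Proof.
have [I [g gP]] := fg_modP M; have [J [h hP]] := fg_modP N.
exists (I + J)%type.
exists (fun s => match s with inl i => (g i, 0) | inr j => (0, h j) end) => -[x y].
have [c ->] := gP x; have [d ->] := hP y.
exists (fun s => match s with inl i => c i | inr j => d j end).
rewrite big_sumType /= [RHS]surjective_pairing /= !raddf_sum /=.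
congr (_, _).
  by rewrite [X in _ + X]big1 ?addr0 // => j _; rewrite scaler0.
by rewrite [X in X + _]big1 ?add0r // => i _; rewrite scaler0.
Qed.
Definition fg_prod R (M N : fgmod R) := FGMod (fg_prod_subproof M N).

Fact fg_dsum_subproof (R : pzRingType) (I : finType) (M : I -> fgmod R) :
  finitely_generated (dsum M).
Proof.
have [J /fin_all_exists[g gP]] := fin_all_exists (fun i => fg_modP (M i)).
have ex_s i (j : J i) : exists s : dsum M, s i = g i j /\ forall i', i' != i -> s i' = 0.
  exists (dsum_of (fun i' => match i =P i' with
    | ReflectT e => ecast w (M w) e (g i j) | ReflectF _ => 0 end)).
  split=> [|i' ne]; rewrite dsumE; last by case: eqP => // e; case/eqP: ne.
  by case: eqP => // e; rewrite eq_axiomK.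
have [s sP] := fin_all_exists (fun u : {i : I & J i} => ex_s (tag u) (tagged u)).
exists {i : I & J i}, s => x.
have [c cP] := fin_all_exists (fun i => gP i (x i)).
exists (fun u => c (tag u) (tagged u)); apply/dsumP=> i.
rewrite dsum_sumE.
transitivity (\sum_i' \sum_j (c i' j *: s (Tagged J j)) i); last first.
  rewrite (sig_big_dep (fun=> true) (fun _ _ => true)
    (fun i' j => (c i' j *: s (Tagged J j)) i)) /=.
  by apply: eq_bigr => -[].
rewrite (bigD1 i) //= [X in _ + X]big1 ?addr0 => [|i' ne].
  by rewrite [LHS]cP; apply: eq_bigr => j _; rewrite dsum_scaleE (sP (Tagged J j)).1.
by rewrite big1 // => j _; rewrite dsum_scaleE (sP (Tagged J j)).2 ?scaler0 // eq_sym.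
Qed.
Definition fg_dsum R (I : finType) (M : I -> fgmod R) := FGMod (fg_dsum_subproof M).

Section ModuleNotions.
Variable R : pzRingType.

Definition surjective_map (U V : Type) (f : U -> V) := forall y, exists x, f x = y.

Definition is_kernel (K U V : lmodType R) (s : {linear K -> U}) (f : {linear U -> V}) :=
  injective s /\ forall x, f x = 0 <-> exists y, s y = x.

Definition is_cokernel (U V C : lmodType R) (f : {linear U -> V}) (q : {linear V -> C}) :=
  surjective_map q /\ forall x, q x = 0 <-> exists y, f y = x.

Definition projective_module (P : fgmod R) : Prop :=
  forall (M N : fgmod R) (g : {linear M -> N}) (f : {linear P -> N}),
  surjective_map g -> exists h : {linear P -> M}, forall x, g (h x) = f x.

(* An epimorphism q is essential if h is onto as soon as q \o h is. *)
Definition projective_cover (P M : fgmod R) (q : {linear P -> M}) : Prop :=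
  [/\ projective_module P, surjective_map q &
      forall (N : fgmod R) (h : {linear N -> P}),
        surjective_map (q \o h) -> surjective_map h].

Definition selfinjective : Prop :=
  forall (M N : fgmod R) (i : {linear M -> N}) (f : {linear M -> R^o}),
  injective i -> exists g : {linear N -> R^o}, forall x, g (i x) = f x.

End ModuleNotions.

Record quiver := Quiver { Q0 : finType; Q1 : Q0 -> Q0 -> finType }.
Arguments Q1 {q} i j.

(* Paths of length n from i to j, decomposed along their last arrow. *)
Fixpoint pathn (Q : quiver) (n : nat) (i j : Q0 Q) : finType :=
  if n is m.+1 then {l : Q0 Q & (pathn m i l * Q1 l j)%type} : finType
  else {u : unit | i == j}.

Definition acyclic (Q : quiver) : Prop :=
  forall (i : Q0 Q) n, pathn n.+1 i i -> False.

Definition sink (Q : quiver) (v : Q0 Q) : Prop := forall j, Q1 v j -> False.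

Definition path_nil (Q : quiver) (i : Q0 Q) : pathn 0 i i := exist _ tt (eqxx i).
Definition path_cons (Q : quiver) n (i l j : Q0 Q) (a : Q1 l j) (p : pathn n i l) :
  pathn n.+1 i j := Tagged (fun l => (pathn n i l * Q1 l j)%type) (p, a).

Lemma pathn_lt_card (Q : quiver) n (i j : Q0 Q) : acyclic Q -> pathn n i j -> (n < #|Q0 Q|)%N.
Proof.
move=> acQ p.
suff [f _ fP] : exists2 f : nat -> Q0 Q, f n = j &
    forall a b, (a <= b <= n)%N -> inhabited (pathn (b - a) (f a) (f b)).
  have f_inj : injective (fun a : 'I_n.+1 => f a).
    suff H (a b : 'I_n.+1) : (a < b)%N -> f a <> f b.
      by move=> a b e; apply/val_inj; case: (ltngtP a b) => // /H; rewrite e.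
    move=> lt_ab e; have /fP[] : (a <= b <= n)%N by rewrite ltnW //= -ltnS.
    by rewrite -e -(subnSK lt_ab); apply: acQ.
  by have := leq_card _ f_inj; rewrite card_ord.
elim: n j p => [|n IH] j.
  move=> _; exists (fun=> j) => // a b /andP[le_ab le_b0].
  by move: (leq_trans le_ab le_b0) (le_b0); rewrite !leqn0 => /eqP-> /eqP->; split; exact: path_nil.
case=> l [/IH[f fn fP] x]; exists (fun b => if (b <= n)%N then f b else j).
  by rewrite ltnn.
move=> a b /andP[le_ab]; rewrite leq_eqVlt ltnS => /predU1P[->|le_bn]; last first.
  by rewrite le_bn (leq_trans le_ab) //; apply: fP; rewrite le_ab.
rewrite ltnn; case: leqP => [le_an|lt_na].
  have /fP[] : (a <= n <= n)%N by rewrite le_an /=.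
  by rewrite fn subSn // => q; split; apply: path_cons q.
by move: lt_na; rewrite -subn_eq0 => /eqP->; split; exact: path_nil.
Qed.

(* All paths from i to j, and those of length less than the number of vertices;
   in an acyclic quiver the latter are all the paths, by [pathn_lt_card]. *)
Definition anypath (Q : quiver) (i j : Q0 Q) := {n : nat & pathn n i j}.
Definition bpath (Q : quiver) (i j : Q0 Q) : finType := {n : 'I_#|Q0 Q| & pathn n i j}.
Definition anypath_of (Q : quiver) (i j : Q0 Q) (p : bpath i j) : anypath i j :=
  existT (fun n => pathn n i j : Type) (nat_of_ord (tag p)) (tagged p).
Definition anypath_cons (Q : quiver) (i l j : Q0 Q) (a : Q1 l j) (p : anypath i l) :
  anypath i j := existT (fun n => pathn n i j : Type) (tag p).+1 (path_cons a (tagged p)).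

(* A Lambda Q-module is a representation of Q by f.g. Lambda-modules. *)
Record rep (R : pzRingType) (Q : quiver) := Rep {
  rep_mod :> Q0 Q -> fgmod R;
  rep_map : forall i j, Q1 i j -> {linear rep_mod i -> rep_mod j}
}.
Arguments rep_map {R Q} r {i j} a.

Definition is_rhom (R : pzRingType) (Q : quiver) (X Y : rep R Q)
    (f : forall i, {linear X i -> Y i}) : Prop :=
  forall i j (a : Q1 i j) x, f j (rep_map X a x) = rep_map Y a (f i x).

Arguments is_rhom {R Q} X Y f.

Record rhom (R : pzRingType) (Q : quiver) (X Y : rep R Q) := RHom {
  rmor :> forall i, {linear X i -> Y i};
  rmorP : is_rhom X Y rmor
}.

Section Representations.
Variables (R : pzRingType) (Q : quiver).
Implicit Types X Y Z : rep R Q.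

Definition rhom_id X : rhom X X.
Proof. by exists (fun i => lin_id (X i)). Defined.

Definition rhom_comp X Y Z (g : rhom Y Z) (f : rhom X Y) : rhom X Z.
Proof.
exists (fun i => lin_comp (g i) (f i)).
by move=> i j a x; rewrite /= !rmorP.
Defined.

Definition projective_rep (P : rep R Q) : Prop :=
  forall (X Y : rep R Q) (g : rhom X Y) (f : rhom P Y),
  (forall i, surjective_map (g i)) -> exists h : rhom P X, forall i x, g i (h i x) = f i x.

(* f and g agree in the stable category: f - g factors through a projective. *)
Definition stably_equal X Y (f g : rhom X Y) : Prop :=
  exists (P : rep R Q) (a : rhom X P) (b : rhom P Y),
    projective_rep P /\ forall i x, f i x - g i x = b i (a i x).

(* X is the kernel of d^0 in a complete projective resolution (P, d). *)
Definition gorenstein_projective X : Prop :=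
  exists (P : int -> rep R Q) (d : forall n, rhom (P n) (P (n + 1))),
  [/\ forall n, projective_rep (P n),
      forall n i x, d (n + 1) i x = 0 <-> exists y, d n i y = x,
      forall (T : rep R Q) n (f : rhom (P (n + 1)) T), projective_rep T ->
        (forall i x, f i (d n i x) = 0) ->
        exists g : rhom (P (n + 1 + 1)) T, forall i x, f i x = g i (d (n + 1) i x) &
      exists e : rhom X (P 0), forall i, is_kernel (e i) (d 0 i)].

Record gproj := GProj {
  gp_rep :> rep R Q;
  gp_repP : gorenstein_projective gp_rep
}.

Definition rep_zero : rep R Q :=
  Rep (fun i j (_ : Q1 i j) =>
    lin_id (fg_dsum (fun u : void => match u return fgmod R with end))).

Definition rep_sum X Y : rep R Q :=
  Rep (fun i j (a : Q1 i j) =>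
    prod_map (rep_map X a) (rep_map Y a)
      : {linear fg_prod (X i) (Y i) -> fg_prod (X j) (Y j)}).

Definition rhom_zero X Y : rhom X Y.
Proof.
by exists (fun i => lin_zero (X i) (Y i)) => i j a x; rewrite /= raddf0.
Defined.

Lemma projective_zero : projective_rep rep_zero.
Proof.
move=> X Y g f _; exists (rhom_zero _ _) => i x /=.
have -> : x = 0 by apply/dsumP => -[].
by rewrite !raddf0.
Qed.

Lemma projective_sum X Y : projective_rep X -> projective_rep Y -> projective_rep (rep_sum X Y).
Proof.
move=> pX pY U V g f gS.
have inlP a : linear (fun x : X a => f a (x, 0)).
  move=> c x y; rewrite -linearP /=; congr (f a _).
  by rewrite [RHS]surjective_pairing /= scaler0 addr0.
have inrP a : linear (fun x : Y a => f a (0, x)).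
  move=> c x y; rewrite -linearP /=; congr (f a _).
  by rewrite [RHS]surjective_pairing /= scaler0 addr0.
have fl_hom : is_rhom _ _ (fun a => Lin (inlP a)).
  by move=> i j a x; rewrite /= -(rmorP f) /= /prod_map_fun /= raddf0.
have fr_hom : is_rhom _ _ (fun a => Lin (inrP a)).
  by move=> i j a x; rewrite /= -(rmorP f) /= /prod_map_fun /= raddf0.
have [hl hlP] := pX _ _ g (RHom fl_hom) gS; have [hr hrP] := pY _ _ g (RHom fr_hom) gS.
have hL i : linear (fun x : rep_sum X Y i => hl i x.1 + hr i x.2).
  by move=> c x y; rewrite /= !linearP scalerDr addrACA.
have h_hom : is_rhom _ _ (fun i => Lin (hL i)).
  by move=> i j a x; rewrite /= linearD !rmorP.
exists (RHom h_hom) => i [x y] /=.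
rewrite linearD hlP hrP /= -linearD; congr (f i _).
by rewrite [LHS]surjective_pairing /= addr0 add0r.
Qed.

Lemma stably_equal_ext X Y (f g : rhom X Y) : (forall i x, f i x = g i x) -> stably_equal f g.
Proof.
move=> fg; exists rep_zero, (rhom_zero _ _), (rhom_zero _ _).
by split=> [|i x]; [exact: projective_zero | rewrite fg subrr].
Qed.

Lemma stably_equal_sym X Y (f g : rhom X Y) : stably_equal f g -> stably_equal g f.
Proof.
case=> P [a [b [pP e]]].
have NL i : linear (fun x => - b i x).
  by move=> c x y; rewrite linearP opprD scalerN.
have Nhom : is_rhom _ _ (fun i => Lin (NL i)).
  by move=> i j c x; rewrite /= raddfN rmorP.
by exists P, a, (RHom Nhom); split=> // i x; rewrite /= -e opprB.
Qed.

Lemma stably_equal_trans X Y (f g h : rhom X Y) :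
  stably_equal f g -> stably_equal g h -> stably_equal f h.
Proof.
case=> P [a [b [pP e]]] [P' [a' [b' [pP' e']]]].
have aL i : linear (fun x => (a i x, a' i x) : rep_sum P P' i).
  by move=> c x y; rewrite /= !linearP.
have bL i : linear (fun x : rep_sum P P' i => b i x.1 + b' i x.2).
  by move=> c x y; rewrite /= !linearP scalerDr addrACA.
have ahom : is_rhom _ _ (fun i => Lin (aL i)).
  by move=> i j c x; rewrite /= !rmorP.
have bhom : is_rhom _ _ (fun i => Lin (bL i)).
  by move=> i j c x; rewrite /= linearD !rmorP.
exists (rep_sum P P'), (RHom ahom), (RHom bhom); split; first exact: projective_sum.
by move=> i x; rewrite /= -e -e' addrA subrK.
Qed.

Lemma stably_equal_comp X Y Z (g g' : rhom Y Z) (f f' : rhom X Y) :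
  stably_equal g g' -> stably_equal f f' ->
  stably_equal (rhom_comp g f) (rhom_comp g' f').
Proof.
case=> P [a [b [pP e]]] [P' [a' [b' [pP' e']]]].
apply: (@stably_equal_trans _ _ _ (rhom_comp g' f)).
  by exists P, (rhom_comp a f), b; split=> // i x; rewrite /= e.
by exists P', a', (rhom_comp g' b'); split=> // i x; rewrite /= -e' raddfB.
Qed.

Definition stable_gproj : category.
Proof.
refine (@Category gproj (fun X Y : gproj => rhom X Y)
  (fun X Y : gproj => @stably_equal X Y) (fun X : gproj => rhom_id X)
  (fun X Y Z : gproj => @rhom_comp X Y Z) _ _ _ _ _ _ _) => *.
- exact: stably_equal_ext.
- exact: stably_equal_sym.
- by apply: stably_equal_trans; eassumption.
- exact: stably_equal_comp.
- exact: stably_equal_ext.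
- exact: stably_equal_ext.
- exact: stably_equal_ext.
Defined.

(* The map X_p attached to a path p. *)
Fixpoint rep_pathn X n (i j : Q0 Q) : pathn n i j -> {linear X i -> X j} :=
  match n with
  | 0 => fun u => match eqP (valP u) in _ = w return {linear X i -> X w} with
                  | erefl => lin_id (X i) end
  | m.+1 => fun p => lin_comp (rep_map X (tagged p).2) (rep_pathn X (tagged p).1)
  end.
Definition rep_path X (i j : Q0 Q) (p : bpath i j) := rep_pathn X (tagged p).

(* u_{X,i} : X_{i^-} -> X_i; arrows ending in i are pairs (source, arrow). *)
Definition in_arrow (i : Q0 Q) : finType := {j : Q0 Q & Q1 j i}.
Definition in_sum X (i : Q0 Q) := dsum (fun b : in_arrow i => X (tag b)).
Definition in_map_fun X i (x : in_sum X i) : X i :=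
  \sum_(b : in_arrow i) rep_map X (tagged b) (x b).
Fact in_map_linear X i : linear (@in_map_fun X i).
Proof.
move=> c x y; rewrite /in_map_fun scaler_sumr -big_split /=.
by apply: eq_bigr => b _; rewrite dsum_addE dsum_scaleE linearP.
Qed.
Definition in_map X i := Lin (@in_map_linear X i).

Definition in_sum_mor X Y (f : rhom X Y) i : {linear in_sum X i -> in_sum Y i} :=
  dsum_map (fun b : in_arrow i => f (tag b)).

(* P_w(J): an arrow a sends the summand of a path p identically onto that of
   the path (a after p). *)
Definition Prep_mod (w : Q0 Q) (J : fgmod R) (i : Q0 Q) : fgmod R :=
  fg_dsum (fun _ : bpath w i => J).
Definition Prep_map_fun w J i j (a : Q1 i j) (x : Prep_mod w J i) : Prep_mod w J j :=
  dsum_of (fun q => \sum_(p | anypath_cons a (anypath_of p) == anypath_of q) x p).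
Fact Prep_map_linear w J i j a : linear (@Prep_map_fun w J i j a).
Proof.
move=> c x y; apply/dsumP=> q; rewrite !(dsumE, dsum_addE, dsum_scaleE).
rewrite scaler_sumr -big_split /=.
by apply: eq_bigr => b _; rewrite dsum_addE dsum_scaleE.
Qed.
Definition Prep w J : rep R Q := Rep (fun i j a => Lin (@Prep_map_linear w J i j a)).

Definition rep_dsum (I : finType) (X : I -> rep R Q) : rep R Q :=
  Rep (fun i j (a : Q1 i j) =>
    dsum_map (fun b => rep_map (X b) a)
      : {linear fg_dsum (fun b => X b i) -> fg_dsum (fun b => X b j)}).

End Representations.
Arguments rep_path {R Q} X {i j} p.
Arguments in_map {R Q} X i.
Arguments Prep {R Q} w J.

Section Reflection.
Variables (R : pzRingType) (Q : quiver) (v : Q0 Q).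

(* Q(v) for a sink v; the two booleans tell whether the source, resp. the target,
   is v. The arrows v -> j of Q(v) are the arrows j -> v of Q. *)
Definition reflect_Q1_at (bi bj : bool) (i j : Q0 Q) : finType :=
  match bi, bj with
  | true, false => Q1 j v
  | false, false => Q1 i j
  | _, true => void
  end.
Definition reflect_quiver : quiver :=
  @Quiver (Q0 Q) (fun i j => reflect_Q1_at (i == v) (j == v) i j).

Lemma reflect_quiver_acyclic : acyclic Q -> acyclic reflect_quiver.
Proof.
move=> acQ.
have no_in (l : Q0 Q) : @Q1 reflect_quiver l v -> False.
  by rewrite /= eqxx; case: (l == v).
have lift_path n (i j : Q0 Q) : i != v -> @pathn reflect_quiver n i j ->
    inhabited (pathn n i j).
  move=> iv; elim: n j => [|n IH] j; first by move=> p; split.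
  case=> l [p x]; have [q] := IH l p; case: (eqVneq l v) x => [lv|lv] /=.
    case: n {IH} p q => [[? /eqP il]|n [l' [_ y]]] _; first by rewrite il lv eqxx in iv.
    by rewrite lv in y; case: (no_in _ y).
  rewrite /reflect_Q1_at (negPf lv); case: (j == v) => // x.
  by split; apply: path_cons q.
move=> i n p; case: (eqVneq i v) => [iv|iv].
  by case: p => l [_ y]; rewrite iv in y; exact: no_in y.
by have [q] := lift_path _ _ _ iv p; exact: acQ q.
Qed.

(* The maps X_b for the arrows b of Q(v) not starting at v. The arrows starting
   at v get the junk value 0, which is never used: no path of Q(v) starting at
   another vertex passes through v. *)
Definition away_map (X : rep R Q) (i j : Q0 Q) :
    @Q1 reflect_quiver i j -> {linear X i -> X j} :=
  match i == v as bi, j == v as bj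
    return reflect_Q1_at bi bj i j -> {linear X i -> X j} with
  | true, false => fun _ => lin_zero (X i) (X j)
  | false, false => fun a => rep_map X a
  | _, true => fun a => match a with end
  end.
Definition away (X : rep R Q) : rep R reflect_quiver :=
  @Rep R reflect_quiver (rep_mod X) (away_map X).

Record object_choice (X : rep R Q) := ObjectChoice {
  oc_bar : fgmod R;
  oc_pi : {linear X v -> oc_bar};
  oc_C : fgmod R;
  oc_delta : {linear oc_C -> oc_bar};
  oc_Omega : fgmod R;
  oc_sigma : {linear oc_Omega -> oc_C};
  oc_t : {linear oc_C -> X v};
  oc_k : {linear oc_Omega -> in_sum X v};
  oc_piP : is_cokernel (in_map X v) oc_pi;
  oc_deltaP : projective_cover oc_delta;
  oc_sigmaP : is_kernel oc_sigma oc_delta;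
  oc_tP : forall c, oc_pi (oc_t c) = oc_delta c;
  oc_kP : forall x, in_map X v (oc_k x) = oc_t (oc_sigma x)
}.

Section Objects.
Variables (X : rep R Q) (c : object_choice X).

(* The sum of the P_{t(b)}(C_X) over the arrows b of Q(v) starting at v. At a
   vertex i it is the sum over the nontrivial paths p'b : v -> i, encoded as
   pairs (b, p'). *)
Definition reflect_P : rep R reflect_quiver :=
  rep_dsum (fun b : in_arrow v => @Prep R reflect_quiver (tag b) (oc_C c)).

Definition reflect_mod_at (b : bool) (i : Q0 Q) : fgmod R :=
  if b then oc_Omega c else fg_prod (X i) (reflect_P i).

Definition trivial_path (Q' : quiver) (i j : Q0 Q') (p : bpath i j) : bool :=
  tag p == 0%N :> nat.

(* The components k_{X,b}, sigma_X, 0 of X(v)_b for b starting at v. *)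
Definition reflect_start_fun (b : in_arrow v) (x : oc_Omega c) :
    fg_prod (X (tag b)) (reflect_P (tag b)) :=
  (oc_k c x b,
   dsum_of (fun b' => dsum_of (fun p' =>
     if (b' == b) && trivial_path p' then oc_sigma c x else 0))).
Fact reflect_start_linear b : linear (@reflect_start_fun b).
Proof.
move=> a x y; rewrite /reflect_start_fun linearP dsum_addE dsum_scaleE.
congr (_, _); apply/dsumP=> b'; rewrite !(dsumE, dsum_addE, dsum_scaleE).
apply/dsumP=> p; rewrite !(dsumE, dsum_addE, dsum_scaleE).
by case: ifP => _; rewrite ?linearP // scaler0 addr0.
Qed.

Definition reflect_map (i j : Q0 Q) (a : @Q1 reflect_quiver i j) :
    {linear reflect_mod_at (i == v) i -> reflect_mod_at (j == v) j} :=
  match i == v as bi, j == v as bj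
    return reflect_Q1_at bi bj i j ->
           {linear fg_prod (X i) (reflect_P i) -> fg_prod (X j) (reflect_P j)} ->
           {linear reflect_mod_at bi i -> reflect_mod_at bj j} with
  | true, false => fun b _ => Lin (reflect_start_linear (existT _ j b))
  | false, false => fun _ m => m
  | _, true => fun b => match b with end
  end a (prod_map (away_map X a) (rep_map reflect_P a)).

Definition reflect_rep : rep R reflect_quiver :=
  @Rep R reflect_quiver (fun i => reflect_mod_at (i == v) i) reflect_map.

End Objects.

Section Morphisms.
Variables (X Y : rep R Q) (cX : object_choice X) (cY : object_choice Y).

Record morphism_choice (f : rhom X Y) := MorphismChoice {
  mc_bar : {linear oc_bar cX -> oc_bar cY};
  mc_C : {linear oc_C cX -> oc_C cY};
  mc_Omega : {linear oc_Omega cX -> oc_Omega cY};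
  mc_omega : {linear oc_C cX -> in_sum Y v};
  mc_barP : forall x, mc_bar (oc_pi cX x) = oc_pi cY (f v x);
  mc_CP : forall x, oc_delta cY (mc_C x) = mc_bar (oc_delta cX x);
  mc_OmegaP : forall x, oc_sigma cY (mc_Omega x) = mc_C (oc_sigma cX x);
  mc_omegaP : forall x, in_map Y v (mc_omega x) = oc_t cY (mc_C x) - f v (oc_t cX x)
}.

Variables (f : rhom X Y) (m : morphism_choice f).

(* f(v)_i for i <> v; the path p'b is the pair (b, p'). *)
Definition reflect_mor_off_fun (i : Q0 Q) (x : fg_prod (X i) (reflect_P cX i)) :
    fg_prod (Y i) (reflect_P cY i) :=
  (f i x.1 + \sum_b \sum_p' rep_path (away Y) p' (mc_omega m (x.2 b p') b),
   dsum_of (fun b => dsum_of (fun p' => mc_C m (x.2 b p')))).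
Fact reflect_mor_off_linear i : linear (@reflect_mor_off_fun i).
Proof.
move=> a x y; rewrite /reflect_mor_off_fun; congr (_, _).
  rewrite linearP /= scalerDr addrACA; congr (_ + _).
  rewrite scaler_sumr -big_split /=; apply: eq_bigr => b _.
  rewrite scaler_sumr -big_split /=; apply: eq_bigr => p _.
  rewrite -linearP; congr (rep_path (away Y) p _).
  by rewrite !(dsum_addE, dsum_scaleE) linearP dsum_addE dsum_scaleE.
apply/dsumP=> b; rewrite !(dsumE, dsum_addE, dsum_scaleE).
apply/dsumP=> p; rewrite !(dsumE, dsum_addE, dsum_scaleE).
by rewrite linearP.
Qed.

Definition reflect_mor (i : Q0 Q) : {linear reflect_rep cX i -> reflect_rep cY i} :=
  match i == v as b
    return {linear reflect_mod_at cX b i -> reflect_mod_at cY b i} with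
  | true => mc_Omega m
  | false => Lin (@reflect_mor_off_linear i)
  end.

End Morphisms.
End Reflection.
Arguments away {R Q} v X.
Arguments object_choice {R Q} v X.
Arguments reflect_rep {R Q v X} c.
Arguments reflect_mor {R Q v X Y cX cY f} m i.

(* Main.v *)
(** Write H Y for the direct sum of the Y_t(b), b an arrow of Q(v) starting at v, and PP for
    its left adjoint, so that P = PP(C_X). A representation of Q is a representation Y of
    Q \ v with a map u : H Y -> X_v, and a representation of Q(v) is such a Y with a map
    w : Y_v -> H Y. In these terms X_v is the pushout of k_X and sigma_X, and a morphism
    X(v) -> Y(v) amounts to (f, C_f, Omega_f, omega_f), up to maps through the projective
    PP(C_Y); hence F(v) is full. If f(v) factors through a projective T, then f factors
    through the projective (T, H T, id) plus a projective concentrated at v; hence F(v) is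
    faithful. For density, embed Y in a projective P with Gorenstein-projective cokernel and
    let X_v be the pushout of w and Y_v -> P_v: then X(v) is Y up to projective summands.

    Gorenstein-projectivity is handled through coresolutions by projectives only: the
    objects admitting one are closed under extensions and under the exact functors that
    preserve projectives, and X(v) is an iterated extension of images of such functors. *)

From HB Require Import structures.
Require Import Defs.
From mathcomp Require Import all_boot all_order all_algebra all_field.
From Stdlib Require Import ClassicalEpsilon.
Set Implicit Arguments.
Unset Strict Implicit.
Unset Printing Implicit Defensive.
Import GRing.Theory.
Local Open Scope ring_scope.

(** * Submodules and quotients *)

(** A complete resolution extends in both directions and stays exact under Hom into projectives, but
    only its right half carries information. A coresolved representation is separated monic;
    separated monic representations are closed under subobjects, so syzygies continue the complex to
    the left; and Hom-exactness holds because maps into a vertexwise injective representation extend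
    along monomorphisms with separated monic cokernel. Selfinjectivity enters by making projective
    modules injective, finite dimension over [k] only through finitely generated kernels and
    projective covers. In fullness and faithfulness the obstacle is the same: a map out of Omega_X
    has to be extended along sigma_X to C_X, which works because its target is injective. The types
    of modules and arrows of Q(v) are stuck on tests such as [i == v]. Hence the presentations
    [src_pres] and [snk_pres]: explicit isomorphisms with data given separately at [v] and away from
    [v]. No smaller quiver is formed; a representation of Q(v) serves, its value at [v] being
    ignored. *)

Lemma dependent_choice (A : Type) (B : A -> Type) (P : forall x, B x -> Prop) :
  (forall x, exists y, P x y) -> exists f : forall x, B x, forall x, P x (f x).
Proof.
move=> exP; exists (fun x => proj1_sig (constructive_indefinite_description _ (exP x))) => x.
exact: proj2_sig.
Qed.

Section LinearConstructions.
Variable R : pzRingType.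

(** Preimages under an injective map are unique, so the pointwise choice is automatically linear. *)
Lemma lin_factor_inj (A B C : lmodType R) (u : {linear A -> B}) (g : {linear C -> B}) :
  injective u -> (forall x, exists y, u y = g x) ->
  exists h : {linear C -> A}, forall x, u (h x) = g x.
Proof.
move=> uI ex_y.
have ex_b x : exists y, u y == g x by have [y <-] := ex_y x; exists y.
have hP x : u (xchoose (ex_b x)) = g x := eqP (xchooseP (ex_b x)).
have hL : linear (fun x => xchoose (ex_b x)).
  by move=> a x y; apply: uI; rewrite hP !linearP !hP.
by exists (Lin hL) => x; rewrite hP.
Qed.

Lemma lin_factor_surj (A B C : lmodType R) (p : {linear A -> B}) (g : {linear A -> C}) :
  surjective_map p -> (forall x, p x = 0 -> g x = 0) ->
  exists h : {linear B -> C}, forall x, h (p x) = g x.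
Proof.
move=> pS ker_pg.
have ex_b y : exists x, p x == y by have [x <-] := pS y; exists x.
have sP y : p (xchoose (ex_b y)) = y := eqP (xchooseP (ex_b y)).
have g_eq x y : p x = p y -> g x = g y.
  by move=> e; apply/subr0_eq; rewrite -linearB ker_pg // linearB e subrr.
have hL : linear (fun y => g (xchoose (ex_b y))).
  by move=> a x y; rewrite -linearP; apply: g_eq; rewrite linearP !sP.
by exists (Lin hL) => x /=; apply: g_eq; rewrite sP.
Qed.

Definition is_submodule (M : lmodType R) (W : M -> Prop) :=
  W 0 /\ forall a x y, W x -> W y -> W (a *: x + y).

Section SubQuotient.
Variables (M : lmodType R) (W : M -> Prop).
Hypothesis WP : is_submodule W.

(** Excluded middle turns an arbitrary submodule into a boolean predicate, so that the subtype
    inherits the module structure. *)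
Definition submod_pred : {pred M} :=
  fun x => if excluded_middle_informative (W x) is left _ then true else false.

Lemma submod_predP x : reflect (W x) (x \in submod_pred).
Proof.
by rewrite unfold_in /submod_pred; case: excluded_middle_informative => w; constructor.
Qed.

Fact submod_pred_closed : submod_closed submod_pred.
Proof.
have [W0 WL] := WP; split; first exact/submod_predP.
by move=> a x y /submod_predP Wx /submod_predP Wy; apply/submod_predP/WL.
Qed.
HB.instance Definition _ := GRing.isSubmodClosed.Build R M submod_pred submod_pred_closed.

Definition submod_type : Type := {x : M | x \in submod_pred}.
HB.instance Definition _ := SubType.on submod_type.
HB.instance Definition _ := [Choice of submod_type by <:].
HB.instance Definition _ := [SubChoice_isSubLmodule of submod_type by <:].

Lemma submodule_exists :
  exists (K : lmodType R) (s : {linear K -> M}),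
    injective s /\ forall x, W x <-> exists y, s y = x.
Proof.
exists (submod_type : lmodType R), (GRing.Linear.clone R submod_type M *:%R val _).
split=> [|x]; first exact: val_inj.
split=> [Wx|[y <-]]; last by apply/submod_predP; exact: valP.
have Wx' : x \in submod_pred by apply/submod_predP.
by exists (exist _ x Wx').
Qed.

(** The quotient is encoded as the subtype of canonical coset representatives, the fixed points of
    this map. *)
Definition quot_canon (x : M) : M := choose (fun y => x - y \in submod_pred) x.

Lemma quot_canonP x : x - quot_canon x \in submod_pred.
Proof. by apply: (@chooseP _ (fun y => x - y \in submod_pred)); rewrite subrr rpred0. Qed.

Lemma quot_canon_eq x y : (quot_canon x == quot_canon y) = (x - y \in submod_pred).
Proof.
apply/eqP/idP=> [e|xy].
  rewrite -(subrKA (quot_canon x)) -[_ - y]opprB rpredB ?quot_canonP //.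
  by rewrite e quot_canonP.
have yx : y - x \in submod_pred by rewrite -opprB rpredN.
(* [choose] depends on its predicate only up to extensional equality, and for a fixed predicate not
   on the witness it starts from. *)
rewrite /quot_canon; transitivity (choose (fun z => y - z \in submod_pred) x).
  apply: eq_choose => z; apply/idP/idP => h.
    by rewrite -(subrKA x) rpredD.
  by rewrite -(subrKA y) rpredD.
by apply: choose_id; rewrite ?subrr ?rpred0.
Qed.

Lemma quot_canon_idem x : quot_canon (quot_canon x) == quot_canon x.
Proof. by rewrite quot_canon_eq -opprB rpredN quot_canonP. Qed.

Definition quot_type : Type := {x : M | quot_canon x == x}.
HB.instance Definition _ := SubType.on quot_type.
HB.instance Definition _ := [Choice of quot_type by <:].

Definition quot_pi (x : M) : quot_type := exist _ (quot_canon x) (quot_canon_idem x).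

Lemma quot_piK (t : quot_type) : quot_pi (val t) = t.
Proof. by apply: val_inj => /=; apply/eqP; exact: valP t. Qed.

Lemma quot_pi_eq x y : x - y \in submod_pred -> quot_pi x = quot_pi y.
Proof. by rewrite -quot_canon_eq => /eqP e; apply: val_inj. Qed.

Lemma quot_pi_val x : val (quot_pi x) - x \in submod_pred.
Proof. by rewrite -opprB rpredN quot_canonP. Qed.

Let qadd (s t : quot_type) := quot_pi (val s + val t).
Let qopp (s : quot_type) := quot_pi (- val s).
Let qscale a (s : quot_type) := quot_pi (a *: val s).

Let qaddE x y : qadd (quot_pi x) (quot_pi y) = quot_pi (x + y).
Proof. by apply: quot_pi_eq; rewrite opprD addrACA rpredD ?quot_pi_val. Qed.
Let qoppE x : qopp (quot_pi x) = quot_pi (- x).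
Proof. by apply: quot_pi_eq; rewrite -opprD rpredN quot_pi_val. Qed.
Let qscaleE a x : qscale a (quot_pi x) = quot_pi (a *: x).
Proof. by apply: quot_pi_eq; rewrite -scalerBr rpredZ // quot_pi_val. Qed.

Fact qaddA : associative qadd.
Proof.
by move=> x y z; rewrite -(quot_piK x) -(quot_piK y) -(quot_piK z) !qaddE addrA.
Qed.
Fact qaddC : commutative qadd.
Proof. by move=> x y; rewrite -(quot_piK x) -(quot_piK y) !qaddE addrC. Qed.
Fact qadd0 : left_id (quot_pi 0) qadd.
Proof. by move=> x; rewrite -(quot_piK x) !qaddE add0r. Qed.
Fact qaddN : left_inverse (quot_pi 0) qopp qadd.
Proof. by move=> x; rewrite -(quot_piK x) qoppE qaddE addNr. Qed.
HB.instance Definition _ := GRing.isZmodule.Build quot_type qaddA qaddC qadd0 qaddN.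

Let addE x y : (quot_pi x : quot_type) + quot_pi y = quot_pi (x + y).
Proof. exact: qaddE. Qed.

Fact qscaleA a b x : qscale a (qscale b x) = qscale (a * b) x.
Proof. by rewrite -(quot_piK x) !qscaleE scalerA. Qed.
Fact qscale1 : left_id 1 qscale.
Proof. by move=> x; rewrite -(quot_piK x) qscaleE scale1r. Qed.
Fact qscaleDr : right_distributive qscale +%R.
Proof.
move=> a x y; rewrite -(quot_piK x) -(quot_piK y).
by rewrite addE !qscaleE addE scalerDr.
Qed.
Fact qscaleDl x : {morph qscale^~ x : a b / a + b}.
Proof.
by move=> a b; rewrite -(quot_piK x) !qscaleE addE scalerDl.
Qed.
HB.instance Definition _ := GRing.Zmodule_isLmodule.Build R quot_type
  qscaleA qscale1 qscaleDr qscaleDl.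

Fact quot_pi_linear : linear (quot_pi : M -> quot_type).
Proof. by move=> a x y; rewrite -addE -qscaleE. Qed.

Lemma quotient_exists :
  exists (C : lmodType R) (q : {linear M -> C}),
    surjective_map q /\ forall x, q x = 0 <-> W x.
Proof.
exists (quot_type : lmodType R), (Lin quot_pi_linear).
split=> [y|x] /=; first by exists (val y); exact: quot_piK.
split=> [|/submod_predP Wx]; last by apply: quot_pi_eq; rewrite subr0.
move=> /(congr1 val)/= /eqP.
by rewrite quot_canon_eq subr0 => /submod_predP.
Qed.

End SubQuotient.

Lemma finitely_generated_surj (M N : lmodType R) (q : {linear M -> N}) :
  surjective_map q -> finitely_generated M -> finitely_generated N.
Proof.
move=> qS [I [g gP]]; exists I, (q \o g) => y.
have [x <-] := qS y; have [c ->] := gP x; exists c.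
by rewrite linear_sum; apply: eq_bigr => i _; rewrite linearZ.
Qed.

Lemma range_submodule (M N : lmodType R) (f : {linear M -> N}) :
  is_submodule (fun y => exists x, f x = y).
Proof.
split=> [|a x y [x' <-] [y' <-]]; first by exists 0; rewrite linear0.
by exists (a *: x' + y'); rewrite linearP.
Qed.

Lemma kernel_submodule (M N : lmodType R) (f : {linear M -> N}) :
  is_submodule (fun x => f x = 0).
Proof.
by split=> [|a x y fx fy]; rewrite ?linear0 // linearP fx fy scaler0 addr0.
Qed.

Lemma quotient_fg (M : fgmod R) (W : M -> Prop) : is_submodule W ->
  exists (C : fgmod R) (q : {linear M -> C}),
    surjective_map q /\ forall x, q x = 0 <-> W x.
Proof.
move=> /quotient_exists[C [q [qS qP]]].
by exists (FGMod (finitely_generated_surj qS (fg_modP M))), q.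
Qed.

Lemma cokernel_exists (U : lmodType R) (V : fgmod R) (f : {linear U -> V}) :
  exists (C : fgmod R) (q : {linear V -> C}), is_cokernel f q.
Proof. exact: quotient_fg (range_submodule f). Qed.

(** The image is realised as the quotient by the kernel: quotients of finitely generated modules are
    finitely generated over every ring, submodules need not be. *)
Lemma image_exists (U : fgmod R) (V : lmodType R) (f : {linear U -> V}) :
  exists (I : fgmod R) (q : {linear U -> I}) (j : {linear I -> V}),
    [/\ surjective_map q, injective j & forall x, j (q x) = f x].
Proof.
have [I [q [qS qP]]] := quotient_fg (kernel_submodule f).
have [j jP] := lin_factor_surj qS (fun x => (qP x).1).
exists I, q, j; split=> // x y.
have [x' <-] := qS x; have [y' <-] := qS y; rewrite !jP => e.
by apply/subr0_eq; rewrite -linearB qP linearB e subrr.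
Qed.

End LinearConstructions.

(** * Projective and injective modules *)

Section DirectSums.
Variables (R : pzRingType) (I : finType) (M : I -> lmodType R).

Definition dsum_in_fun i (x : M i) : dsum M := dsum_of (fun i' =>
  match i =P i' with ReflectT e => ecast w (M w) e x | ReflectF _ => 0 end).

Lemma dsum_in_fun_eq i (x : M i) : dsum_in_fun x i = x.
Proof. by rewrite dsumE; case: eqP => // e; rewrite eq_axiomK. Qed.

Lemma dsum_in_fun_neq i (x : M i) j : i != j -> dsum_in_fun x j = 0.
Proof. by rewrite dsumE; case: eqP. Qed.

Fact dsum_in_linear i : linear (@dsum_in_fun i).
Proof.
move=> a x y; apply/dsumP=> j; rewrite dsum_addE dsum_scaleE.
case: (eqVneq i j) => [<-|ne]; first by rewrite !dsum_in_fun_eq.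
by rewrite !dsum_in_fun_neq // scaler0 addr0.
Qed.
Definition dsum_in i := Lin (@dsum_in_linear i).

Lemma dsum_in_eq i (x : M i) : dsum_in i x i = x. Proof. exact: dsum_in_fun_eq. Qed.
Lemma dsum_in_neq i (x : M i) j : i != j -> dsum_in i x j = 0.
Proof. exact: dsum_in_fun_neq. Qed.

Lemma dsum_decomp (x : dsum M) : x = \sum_i dsum_in i (x i).
Proof.
apply/dsumP=> j; rewrite dsum_sumE (bigD1 j) //= dsum_in_eq big1 ?addr0 // => i ne.
by rewrite dsum_in_neq.
Qed.

Lemma dsum_ext (N : lmodType R) (f g : {linear dsum M -> N}) :
  (forall i x, f (dsum_in i x) = g (dsum_in i x)) -> forall x, f x = g x.
Proof. by move=> fg x; rewrite (dsum_decomp x) !linear_sum; apply: eq_bigr => i _; exact: fg. Qed.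

Fact dsum_proj_linear i : linear (fun x : dsum M => x i).
Proof. by move=> a x y; rewrite dsum_addE dsum_scaleE. Qed.
Definition dsum_proj i := Lin (dsum_proj_linear i).

Lemma dsum_oppE (x : dsum M) i : (- x) i = - x i.
Proof. exact: (linearN (dsum_proj i)). Qed.

Lemma dsum_glue (N : lmodType R) (f : forall i, {linear N -> M i}) :
  linear (fun x => dsum_of (fun i => f i x)).
Proof.
by move=> a x y; apply/dsumP=> i; rewrite !(dsumE, dsum_addE, dsum_scaleE) linearP.
Qed.

Lemma dsum_copair (N : lmodType R) (f : forall i, {linear M i -> N}) :
  linear (fun x : dsum M => \sum_i f i (x i)).
Proof.
move=> a x y; rewrite scaler_sumr -big_split /=.
by apply: eq_bigr => i _; rewrite dsum_addE dsum_scaleE linearP.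
Qed.

End DirectSums.
Arguments dsum_in {R I M} i.
Arguments dsum_proj {R I M} i.

Section LinOps.
Variables (R : pzRingType) (U V : lmodType R).

Fact lin_add_linear (f g : {linear U -> V}) : linear (fun x => f x + g x).
Proof. by move=> a x y; rewrite !linearP /= scalerDr addrACA. Qed.
Definition lin_add f g := Lin (lin_add_linear f g).

Fact lin_opp_linear (f : {linear U -> V}) : linear (fun x => - f x).
Proof. by move=> a x y; rewrite linearP opprD scalerN. Qed.
Definition lin_opp f := Lin (lin_opp_linear f).

Fact pair_linear (W : lmodType R) (f : {linear W -> U}) (g : {linear W -> V}) :
  linear (fun x => (f x, g x) : lprod U V).
Proof. by move=> a x y; rewrite !linearP. Qed.
Definition lin_pair W f g := Lin (@pair_linear W f g).

Fact copair_linear (W : lmodType R) (f : {linear U -> W}) (g : {linear V -> W}) :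
  linear (fun x : lprod U V => f x.1 + g x.2).
Proof. by move=> a x y; rewrite /= !linearP /= scalerDr addrACA. Qed.
Definition lin_copair W f g := Lin (@copair_linear W f g).

Fact fst_linear : linear (fun x : lprod U V => x.1).
Proof. by []. Qed.
Definition lin_fst := Lin fst_linear.
Fact snd_linear : linear (fun x : lprod U V => x.2).
Proof. by []. Qed.
Definition lin_snd := Lin snd_linear.
Fact inl_linear : linear (fun x : U => (x, 0) : lprod U V).
Proof. by move=> a x y; rewrite [RHS]surjective_pairing /= scaler0 addr0. Qed.
Definition lin_inl := Lin inl_linear.
Fact inr_linear : linear (fun x : V => (0, x) : lprod U V).
Proof. by move=> a x y; rewrite [RHS]surjective_pairing /= scaler0 addr0. Qed.
Definition lin_inr := Lin inr_linear.

End LinOps.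
Arguments lin_fst {R U V}.
Arguments lin_snd {R U V}.
Arguments lin_inl {R U V}.
Arguments lin_inr {R U V}.

Section Projectives.
Variable R : pzRingType.

Fact regular_fg_subproof : finitely_generated (R^o : lmodType R).
Proof.
exists 'I_1, (fun=> 1) => x; exists (fun=> x); rewrite big_ord1.
by rewrite /GRing.scale /= mulr1.
Qed.
Definition regular_fg : fgmod R := FGMod regular_fg_subproof.
Definition free_fg (I : finType) : fgmod R := fg_dsum (fun _ : I => regular_fg).

Fact free_lift_linear (I : finType) (M : lmodType R) (m : I -> M) :
  linear (fun c : free_fg I => \sum_i (c i : R) *: m i).
Proof.
move=> a x y; rewrite scaler_sumr -big_split /=; apply: eq_bigr => i _.
by rewrite dsum_addE dsum_scaleE scalerDl scalerA.
Qed.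
Definition free_lift I M m := Lin (@free_lift_linear I M m).

Lemma free_decomp (I : finType) (M : lmodType R) (f : {linear free_fg I -> M}) c :
  f c = \sum_i (c i : R) *: f (dsum_in (M := fun=> R^o) i (1 : R)).
Proof.
rewrite {1}(dsum_decomp c) linear_sum; apply: eq_bigr => i _.
by rewrite -linearZ -linearZ /= /GRing.scale /= mulr1.
Qed.

Lemma free_projective (I : finType) : projective_module (free_fg I).
Proof.
move=> M N g f gS.
have /fin_all_exists[m mP] i : exists m, g m = f (dsum_in (M := fun=> R^o) i (1 : R)).
  exact: gS.
exists (free_lift m) => c; rewrite /= linear_sum free_decomp.
by apply: eq_bigr => i _; rewrite linearZ mP.
Qed.

Lemma free_cover (M : fgmod R) :
  exists (I : finType) (q : {linear free_fg I -> M}), surjective_map q.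
Proof.
have [I [g gP]] := fg_modP M; exists I, (free_lift g) => x.
have [c ->] := gP x; exists (dsum_of (M := fun=> R^o) c : free_fg I).
by apply: eq_bigr => i _; rewrite dsumE.
Qed.

Lemma projective_cover_free (M : fgmod R) :
  exists (F : fgmod R) (q : {linear F -> M}), projective_module F /\ surjective_map q.
Proof. by have [I [q qS]] := free_cover M; exists (free_fg I), q; split=> //; exact: free_projective. Qed.

Lemma projective_retract (P P' : fgmod R) (s : {linear P -> P'}) (r : {linear P' -> P}) :
  (forall x, r (s x) = x) -> projective_module P' -> projective_module P.
Proof.
move=> rs pP' M N g f gS; have [h hP] := pP' M N g (lin_comp f r) gS.
by exists (lin_comp h s) => x; rewrite /= hP /= rs.
Qed.

Lemma projective_split (M P : fgmod R) (q : {linear M -> P}) :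
  projective_module P -> surjective_map q -> exists s : {linear P -> M}, forall x, q (s x) = x.
Proof. by move=> pP qS; have [s sP] := pP M P q (lin_id P) qS; exists s. Qed.

Lemma projective_dsum (I : finType) (P : I -> fgmod R) :
  (forall i, projective_module (P i)) -> projective_module (fg_dsum P).
Proof.
move=> pP M N g f gS.
have /fin_all_exists[h hP] i : exists h : {linear P i -> M}, forall x, g (h x) = f (dsum_in i x).
  exact: pP i M N g (lin_comp f (dsum_in i)) gS.
exists (Lin (dsum_copair h)) => x; rewrite /= linear_sum [in RHS](dsum_decomp x) linear_sum.
by apply: eq_bigr => i _; rewrite hP.
Qed.

Definition injective_module (T : fgmod R) : Prop :=
  forall (M N : fgmod R) (i : {linear M -> N}) (f : {linear M -> T}),
  injective i -> exists g : {linear N -> T}, forall x, g (i x) = f x.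

(** [P] is a retract of a free module, and a map into a free module extends coordinate by coordinate
    since the regular module is injective. *)
Lemma projective_injective (P : fgmod R) :
  selfinjective R -> projective_module P -> injective_module P.
Proof.
move=> inj_R pP M N i f iI.
have [I [q qS]] := free_cover P; have [s qs] := projective_split pP qS.
have /fin_all_exists[g gP] j : exists g : {linear N -> R^o},
    forall x, g (i x) = s (f x) j.
  exact: inj_R M N i (lin_comp (dsum_proj j) (lin_comp s f)) iI.
exists (lin_comp q (Lin (dsum_glue g))) => x /=; rewrite -[RHS]qs; congr (q _).
by apply/dsumP => j; rewrite dsumE gP.
Qed.

(** [p] need not be injective: [f] descends to the image of [p], and injectivity of [T] is applied
    to the inclusion of that image. *)
Lemma injective_extend (T U V : fgmod R) (p : {linear U -> V}) (f : {linear U -> T}) :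
  injective_module T -> (forall x, p x = 0 -> f x = 0) ->
  exists h : {linear V -> T}, forall x, h (p x) = f x.
Proof.
move=> injT kerp; have [I [q [j [qS jI jq]]]] := image_exists p.
have [f' f'P] : exists f' : {linear I -> T}, forall x, f' (q x) = f x.
  by apply: lin_factor_surj => // x qx; apply: kerp; rewrite -jq qx linear0.
have [h hP] := injT I V j f' jI; exists h => x.
by rewrite -jq hP f'P.
Qed.

End Projectives.

(** * Modules over finite-dimensional algebras *)

Definition decide (P : Prop) : bool :=
  if excluded_middle_informative P is left _ then true else false.
Lemma decideP P : reflect P (decide P).
Proof. by rewrite /decide; case: excluded_middle_informative => p; constructor. Qed.

Lemma maximal_value (T : Type) (P : T -> Prop) (f : T -> nat) (b : nat) (x0 : T) :
  P x0 -> (forall x, P x -> f x <= b)%N ->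
  exists x, P x /\ forall y, P y -> (f y <= f x)%N.
Proof.
move=> P0 le_b.
pose p n := decide (exists x, P x /\ f x = n).
have ex_p : exists n, p n by exists (f x0); apply/decideP; exists x0.
have le_p n : p n -> (n <= b)%N by move=> /decideP[x [Px <-]]; exact: le_b.
case: (ex_maxnP ex_p le_p) => _ /decideP[x [Px <-]] max_x.
by exists x; split=> // y Py; apply: max_x; apply/decideP; exists y.
Qed.

Section FiniteDimension.
Import VectorInternalTheory.
Variables (k : fieldType) (L : falgType k).

Definition subspace_of_row n (S : 'rV[k]_n -> Prop) :=
  S 0 /\ forall a x y, S x -> S y -> S (a *: x + y).

(** A matrix of maximal rank among those with row space inside [S] works: a vector of [S] outside
    its row space would raise the rank. *)
Lemma subspace_matrix n (S : 'rV[k]_n -> Prop) : subspace_of_row S ->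
  exists A : 'M[k]_n, forall r, S r <-> (r <= A)%MS.
Proof.
move=> [S0 SL].
have P0 : forall r, (r <= (0 : 'M[k]_n))%MS -> S r.
  by move=> r; rewrite submx0 => /eqP->.
have [A [AS maxA]] := maximal_value (P := fun A : 'M[k]_n => forall r, (r <= A)%MS -> S r)
  (f := fun A => \rank A) P0 (fun A _ => rank_leq_row A).
exists A => r; split=> [Sr|]; last exact: AS.
apply/negP=> /negP rA.
have /maxA : forall s, (s <= A + r)%MS -> S s.
  move=> s /sub_addsmxP[[u v] /= ->].
  have [a ->] : exists a, v = a%:M by exists (v 0 0); rewrite [v]mx11_scalar !mxE.
  by rewrite mul_scalar_mx addrC; apply: SL => //; apply: AS; exact: submxMl.
apply/negP; rewrite -ltnNge; apply: rank_ltmx; rewrite ltmxE addsmxSl /=.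
by apply: contra rA => /(submx_trans (addsmxSr _ _)).
Qed.

(** A surjection from [k^n] that is linear over [k], which acts on [M] through [a%:A]; it bounds the
    dimension of [M] without giving [M] a second module structure. *)
Definition kspan n (M : lmodType L) (phi : 'rV[k]_n -> M) :=
  (forall a x y, phi (a *: x + y) = a%:A *: phi x + phi y) /\ surjective_map phi.

Lemma kspan_sum n (M : lmodType L) (phi : 'rV[k]_n -> M) : kspan phi ->
  forall m (A : 'M_(m, n)) (u : 'rV_m),
  phi (u *m A) = \sum_j ((u 0 j)%:A : L) *: phi (row j A).
Proof.
move=> [phiL _] m A u; rewrite mulmx_sum_row.
have phi0 : phi 0 = 0.
  by have := phiL 1 0 0; rewrite !scale1r addr0 -{1}[phi 0]addr0 => /addrI.
by elim/big_rec2: _ => [|j x y _ IH] //; rewrite phiL IH.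
Qed.

Lemma kspan_exists (M : fgmod L) : exists n (phi : 'rV[k]_n -> M), kspan phi.
Proof.
have [I [g gP]] := fg_modP M.
exists (dim {ffun I -> L}), (fun r => \sum_i (r2v r : {ffun I -> L}) i *: g i); split.
  move=> a x y; rewrite linearP scaler_sumr -big_split /=; apply: eq_bigr => i _.
  by rewrite !ffunE scalerDl scalerA mulr_algl.
move=> x; have [c ->] := gP x; exists (v2r (finfun c)).
by rewrite v2rK; apply: eq_bigr => i _; rewrite ffunE.
Qed.

Lemma kspan_submodule n (M : lmodType L) (phi : 'rV[k]_n -> M) (W : M -> Prop) :
  kspan phi -> is_submodule W -> subspace_of_row (fun r => W (phi r)).
Proof.
move=> phiP [W0 WL]; split=> [|a x y Wx Wy]; last by rewrite phiP.1; exact: WL.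
by rewrite -(mul0mx _ (0 : 'M_(1, n))) (kspan_sum phiP) big1 // => j _;
  rewrite mxE scale0r scale0r.
Qed.

(** The preimage of [W] in [k^n] is the row space of a matrix, and the images of its rows generate
    [K] already over [k]. *)
Lemma fg_submodule (M : fgmod L) (W : M -> Prop) : is_submodule W ->
  exists (K : fgmod L) (s : {linear K -> M}),
    injective s /\ forall x, W x <-> exists y, s y = x.
Proof.
move=> WP; have [K [s [sI sP]]] := submodule_exists WP.
suff Kfg : finitely_generated K by exists (FGMod Kfg), s.
have [n [phi phiP]] := kspan_exists M.
have [A AP] := subspace_matrix (kspan_submodule phiP WP).
have /fin_all_exists[g gP] j : exists y, s y = phi (row j A).
  by apply/sP/AP; exact: row_sub.
exists 'I_n, g => x; have [r rP] := phiP.2 (s x).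
have /AP/submxP[u ur] : W (phi r) by rewrite rP; apply/sP; exists x.
exists (fun j => (u 0 j)%:A); apply: sI.
rewrite -rP ur (kspan_sum phiP) linear_sum; apply: eq_bigr => j _.
by rewrite linearZ gP.
Qed.

Lemma fg_kernel (M : fgmod L) (N : lmodType L) (f : {linear M -> N}) :
  exists (K : fgmod L) (s : {linear K -> M}), is_kernel s f.
Proof.
have [K [s [sI sP]]] := fg_submodule (kernel_submodule f).
by exists K, s.
Qed.

Lemma monotone_subspaces_stabilize n (S : nat -> 'rV[k]_n -> Prop) :
  (forall m, subspace_of_row (S m)) -> (forall m r, S m r -> S m.+1 r) ->
  exists m, forall m' r, (m <= m')%N -> S m' r -> S m r.
Proof.
move=> S_sub S_mono.
have /dependent_choice[A AP] := fun m => subspace_matrix (S_sub m).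
have [m [_ maxm]] := maximal_value (P := fun=> True) (x0 := 0%N) (f := fun m => \rank (A m))
  I (fun m _ => rank_leq_row (A m)).
have mono m1 m2 r : (m1 <= m2)%N -> S m1 r -> S m2 r.
  move=> /subnK<-; elim: (m2 - m1)%N => // d IH /IH.
  by rewrite addSn; exact: S_mono.
exists m => m' r le_mm' /AP rA; apply/AP; apply: submx_trans rA _.
have : (A m <= A m')%MS.
  apply/row_subP=> j; apply/AP/(mono m) => //; apply/AP; exact: row_sub.
by move=> sub; have := mxrank_leqif_sup sub; case=> _ <-; rewrite eqn_leq mxrankS ?maxm.
Qed.

Lemma antitone_subspaces_stabilize n (S : nat -> 'rV[k]_n -> Prop) :
  (forall m, subspace_of_row (S m)) -> (forall m r, S m.+1 r -> S m r) ->
  exists m, forall m' r, (m <= m')%N -> S m r -> S m' r.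
Proof.
move=> S_sub S_mono.
have /dependent_choice[A AP] := fun m => subspace_matrix (S_sub m).
(* Maximising the corank picks a smallest term of the chain. *)
have [m [_ maxm]] := maximal_value (P := fun=> True) (x0 := 0%N)
  (f := fun m => n - \rank (A m))%N I (fun m _ => leq_subr _ _).
have mono m1 m2 r : (m1 <= m2)%N -> S m2 r -> S m1 r.
  by move=> /subnK<-; elim: (m2 - m1)%N => // d IH; rewrite addSn => /S_mono/IH.
exists m => m' r le_mm' /AP rA; apply/AP; apply: submx_trans rA _.
have : (A m' <= A m)%MS.
  apply/row_subP=> j; apply/AP/(mono _ m') => //; apply/AP; exact: row_sub.
move=> sub; have := mxrank_leqif_sup sub; case=> _ <-; rewrite eqn_leq mxrankS //=.
by have := maxm m' I; rewrite leq_sub2lE // rank_leq_row.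
Qed.

Lemma iter_linear (M : lmodType L) (e : {linear M -> M}) n :
  exists f : {linear M -> M}, forall x, f x = iter n e x.
Proof.
elim: n => [|n [f fP]]; first by exists (lin_id M).
by exists (lin_comp e f) => x; rewrite /= fP.
Qed.

(* Fitting: for m large, e^m restricts to an automorphism of its image I, so
   that I is a retract of P. *)
Lemma fitting (P : fgmod L) (e : {linear P -> P}) :
  exists (I : fgmod L) (j : {linear I -> P}) (r : {linear P -> I}) (m : nat),
    (forall x, r (j x) = x) /\ (forall x, (exists y, j y = x) <-> exists y, iter m.+1 e y = x).
Proof.
have [n [phi phiP]] := kspan_exists P.
have /dependent_choice[f fP] := iter_linear e.
have iterS m x : f m.+1 x = f m (e x) by rewrite !fP iterSr.
have iterD m m' x : f (m + m')%N x = f m (f m' x) by rewrite !fP iterD.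
have [||a aP] := @monotone_subspaces_stabilize n (fun m r => f m (phi r) = 0).
- by move=> m; apply: (kspan_submodule phiP (kernel_submodule (f m))).
- by move=> m r; rewrite !fP /= -fP => ->; rewrite linear0.
have [||b bP] := @antitone_subspaces_stabilize n (fun m r => exists x, f m x = phi r).
- by move=> m; apply: (kspan_submodule phiP (range_submodule (f m))).
- by move=> m r [x <-]; exists (e x); rewrite iterS.
(* Kernels of the powers are constant from [a] on, images from [b] on. The successor makes the
   exponent positive, so that the image of this power lies in the image of [e]. *)
pose m := (a + b).+1.
have ker_m x : f m (f m x) = 0 -> f m x = 0.
  have [r <-] := phiP.2 x; rewrite -iterD => h.
  have fa : f a (phi r) = 0 by apply: aP h; exact: leq_trans (leqW (leq_addr b a)) (leq_addr _ _).
  by rewrite /m addnC -addSn iterD fa linear0.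
have im_m x : exists y, f m (f m y) = f m x.
  have [r rP] := phiP.2 (f m x).
  have : exists y, f (m + m)%N y = phi r.
    apply: bP; first exact: leq_trans (leqW (leq_addl a b)) (leq_addr _ _).
    by exists (f a.+1 x); rewrite rP /m -addSn addnC iterD.
  by case=> y; rewrite iterD rP => <-; exists y.
have [I [q [j [qS jI jq]]]] := image_exists (f m).
(* [lin_comp q j] is the power restricted to its own image. It is bijective, and its inverse after
   [q] is the retraction. *)
have qj_inj : injective (lin_comp q j).
  move=> x y /= e'; apply/subr0_eq; move/(congr1 j): e'; rewrite !jq => e'.
  have [x' x'P] := qS x; have [y' y'P] := qS y.
  apply: jI; rewrite linear0 -x'P -y'P -linearB jq; apply: ker_m.
  by rewrite linearB linearB -!jq x'P y'P !jq e' subrr.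
have [s sP] : exists s : {linear P -> I}, forall x, lin_comp q j (s x) = q x.
  apply: lin_factor_inj => // x; have [y yP] := im_m x.
  by exists (q y); apply: jI; rewrite /= !jq yP.
exists I, j, s, (a + b)%N; split=> [x|x]; first by apply: qj_inj; rewrite sP.
split=> [[y <-]|[y <-]]; last by exists (q y); rewrite jq fP.
by have [z <-] := qS y; exists z; rewrite jq fP.
Qed.

(* Take q : P -> M with P projective spanned by as few elements over k as possible. If q e = q
   then q is still onto on the image of a power of e, a retract of P by Fitting's lemma, so
   minimality forces e to be onto. *)
Lemma projective_cover_exists (M : fgmod L) :
  exists (C : fgmod L) (d : {linear C -> M}), projective_cover d.
Proof.
have [P0 [q0 [pP0 q0S]]] := projective_cover_free M.
have [n0 [phi0 phi0P]] := kspan_exists P0.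
pose good n := exists (P : fgmod L) (q : {linear P -> M}) (phi : 'rV[k]_n -> P),
  [/\ projective_module P, surjective_map q & kspan phi].
have ex_good : exists n, decide (good n) by exists n0; apply/decideP; exists P0, q0, phi0.
case: (ex_minnP ex_good) => n /decideP[P [q [phi [pP qS phiP]]]] min_n.
exists P, q; split=> // N h qhS.
have [s sP] := pP N M (lin_comp q h) q qhS.
pose e := lin_comp h s.
have [I [j [r [m [rj im_j]]]]] := fitting e.
have qe i x : q (iter i e x) = q x by elim: i => //= i <-; rewrite [q _]sP.
have pI := projective_retract rj pP.
have qjS : surjective_map (lin_comp q j).
  move=> y; have [x <-] := qS y.
  have [z zP] := (im_j (iter m.+1 e x)).2 (ex_intro _ x erefl).
  by exists z; rewrite /= zP qe.
have [A AP] := subspace_matrix (kspan_submodule phiP (range_submodule j)).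
(* The rows of [A] span the preimage of the image of [j], and [r] carries that image onto [I]; so
   [I] is spanned by [\rank A] elements. *)
pose psi (u : 'rV[k]_(\rank A)) := r (phi (u *m row_base A)).
have : good (\rank A).
  exists I, (lin_comp q j), psi; split=> //; split=> [a x y|x].
    by rewrite /psi mulmxDl -scalemxAl phiP.1 linearP.
  have [t tP] := phiP.2 (j x).
  have : (t <= row_base A)%MS by rewrite eq_row_base; apply/AP; exists x.
  by case/submxP=> u ut; exists u; rewrite /psi -ut tP rj.
move=> /decideP/min_n le_nA.
have jS x : exists y, j y = x.
  have [t <-] := phiP.2 x; apply/AP; apply: submx_full.
  by rewrite /row_full eqn_leq le_nA andbT rank_leq_col.
move=> x; have /im_j[y <-] := jS x.
by exists (s (iter m e y)).
Qed.

End FiniteDimension.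

(** * Representations of acyclic quivers *)

(** Since [N] is arbitrary, this says that [R] is left noetherian. *)
Definition kernels_fg (R : pzRingType) := forall (M : fgmod R) (N : lmodType R) (f : {linear M -> N}),
  exists (K : fgmod R) (s : {linear K -> M}), is_kernel s f.

Section Quivers.
Variable Q : quiver.

Lemma quiver_choice (B : forall i j, @Q1 Q i j -> Type) (P : forall i j a, B i j a -> Prop) :
  (forall i j a, exists y, P i j a y) ->
  exists f : forall i j a, B i j a, forall i j a, P i j a (f i j a).
Proof.
move=> exP; apply: (dependent_choice (P := fun i (f : forall j a, B i j a) =>
  forall j a, P i j a (f j a))) => i.
apply: (dependent_choice (P := fun j (f : forall a, B i j a) => forall a, P i j a (f a))) => j.
exact: dependent_choice.
Qed.

Hypothesis acQ : acyclic Q.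

(** The depth of a vertex is the length of a longest path ending there, finite because the quiver is
    acyclic. *)
Lemma depth_exists : exists d : Q0 Q -> nat, forall i j (a : Q1 i j), (d i < d j)%N.
Proof.
pose P j n := exists i (p : @pathn Q n i j), True.
have ex_d j : exists n, P j n /\ forall n', P j n' -> (n' <= n)%N.
  have P0 : P j 0%N by exists j, (path_nil j).
  apply: (maximal_value (f := id) (b := #|Q0 Q|) P0) => n [i [p _]].
  exact: ltnW (pathn_lt_card acQ p).
have [d dP] := dependent_choice ex_d; exists d => i j a.
have [[l [p _]] _] := dP i; apply: (dP j).2.
by exists l, (path_cons a p).
Qed.

Lemma anypath_of_inj (i j : Q0 Q) : injective (@anypath_of Q i j).
Proof.
move=> [[n ltn] p] [[m ltm] q]; rewrite /anypath_of /= => e.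
have nm : n = m := congr1 (@tag _ _) e.
case: m / nm ltm q e => ltm q e.
rewrite (bool_irrelevance ltn ltm); congr existT.
have -> : p = q by apply/eqP; move/eqP: e; rewrite eq_Tagged.
by [].
Qed.

Lemma anypath_of_surj (i j : Q0 Q) (p : anypath i j) : exists q : bpath i j, anypath_of q = p.
Proof.
case: p => n p; have lt_n := pathn_lt_card acQ p.
by exists (existT (fun n : 'I__ => pathn n i j : Type) (Ordinal lt_n) p).
Qed.

(** A left inverse of [anypath_cons]: it recovers the last arrow and the remainder of a path. *)
Definition anypath_uncons (i j : Q0 Q) (p : anypath i j) :
    option {b : in_arrow j & anypath i (tag b)} :=
  match p with
  | existT 0 _ => None
  | existT n.+1 q => Some (existT (fun b : in_arrow j => anypath i (tag b))
      (existT (fun l => Q1 l j : Type) (tag q) (tagged q).2)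
      (existT (fun n => pathn n i (tag q) : Type) n (tagged q).1))
  end.

Lemma anypath_consK (i l j : Q0 Q) (a : Q1 l j) (p : anypath i l) :
  anypath_uncons (anypath_cons a p) =
  Some (existT (fun b : in_arrow j => anypath i (tag b)) (existT (fun l => Q1 l j : Type) l a) p).
Proof. by case: p. Qed.

End Quivers.

Section RepBasics.
Variables (R : pzRingType) (Q : quiver).
Implicit Types A B C X Y Z T : rep R Q.

Definition exact_seq A B C (i : rhom A B) (q : rhom B C) :=
  forall x, injective (i x) /\ is_cokernel (i x) (q x).

Definition sepmono X := forall i, injective (in_map X i).

Lemma rhom_factor_inj A B C (u : rhom A B) (g : rhom C B) :
  (forall i, injective (u i)) -> (forall i x, exists y, u i y = g i x) ->
  exists h : rhom C A, forall i x, u i (h i x) = g i x.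
Proof.
move=> uI gu.
have [h hP] := dependent_choice (fun i => lin_factor_inj (uI i) (gu i)).
have h_hom : is_rhom C A h.
  by move=> i j a x; apply: (uI j); rewrite hP !rmorP hP.
by exists (RHom h_hom).
Qed.

Lemma rhom_factor_surj A B C (p : rhom A B) (g : rhom A C) :
  (forall i, surjective_map (p i)) -> (forall i x, p i x = 0 -> g i x = 0) ->
  exists h : rhom B C, forall i x, h i (p i x) = g i x.
Proof.
move=> pS kerp.
have [h hP] := dependent_choice (fun i => lin_factor_surj (pS i) (kerp i)).
have h_hom : is_rhom B C h.
  by move=> i j a y; have [x <-] := pS i y; rewrite -rmorP !hP rmorP.
by exists (RHom h_hom).
Qed.

Lemma cokernel_rep A B (f : rhom A B) :
  exists C (q : rhom B C), forall i, is_cokernel (f i) (q i).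
Proof.
have [C CP] := dependent_choice (fun i => cokernel_exists (f i)).
have [q qP] := dependent_choice CP.
have ex_m i j (a : Q1 i j) :
    exists m : {linear C i -> C j}, forall x, m (q i x) = q j (rep_map B a x).
  apply: (lin_factor_surj (g := lin_comp (q j) (rep_map B a)) (qP i).1) => x /(qP i).2[y <-] /=.
  by apply/(qP j).2; exists (rep_map A a y); rewrite rmorP.
have [m mP] := quiver_choice ex_m.
have q_hom : is_rhom B (Rep m) q by move=> i j a x; rewrite /= mP.
by exists (Rep m), (RHom q_hom).
Qed.

Lemma kernel_rep A B (f : rhom A B) : kernels_fg R ->
  exists K (s : rhom K A), forall i, is_kernel (s i) (f i).
Proof.
move=> kerR.
have [K KP] := dependent_choice (fun i => kerR _ _ (f i)).
have [s sP] := dependent_choice KP.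
have ex_m i j (a : Q1 i j) :
    exists m : {linear K i -> K j}, forall x, s j (m x) = rep_map A a (s i x).
  apply: (lin_factor_inj (g := lin_comp (rep_map A a) (s i)) (sP j).1) => x /=.
  apply/(sP j).2; rewrite rmorP; have -> : f i (s i x) = 0 by apply/(sP i).2; exists x.
  by rewrite linear0.
have [m mP] := quiver_choice ex_m.
have s_hom : is_rhom (Rep m) A s by move=> i j a x; rewrite /= mP.
by exists (Rep m), (RHom s_hom).
Qed.

Lemma in_map_mor X Y (f : rhom X Y) i x : in_map Y i (in_sum_mor f i x) = f i (in_map X i x).
Proof.
rewrite /= /in_map_fun linear_sum; apply: eq_bigr => b _.
by rewrite dsumE rmorP.
Qed.

Lemma in_map_in X i (b : in_arrow i) (x : X (tag b)) :
  in_map X i (dsum_in (M := fun b : in_arrow i => X (tag b) : lmodType R) b x)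
  = rep_map X (tagged b) x.
Proof.
rewrite /= /in_map_fun (bigD1 b) //= dsum_in_fun_eq big1 ?addr0 // => c ne.
by rewrite dsum_in_fun_neq ?linear0 // eq_sym.
Qed.

Lemma sepmono_sub A B (f : rhom A B) :
  (forall i, injective (f i)) -> sepmono B -> sepmono A.
Proof.
move=> fI smB i x y e; apply/dsumP => b; apply: fI.
have /smB/dsumP/(_ b) : in_map B i (in_sum_mor f i x) = in_map B i (in_sum_mor f i y).
  by rewrite !in_map_mor e.
by rewrite !dsumE.
Qed.

Lemma linear_injP (U V : lmodType R) (f : {linear U -> V}) :
  (forall x, f x = 0 -> x = 0) -> injective f.
Proof. by move=> f0 x y e; apply/subr0_eq/f0; rewrite linearB e subrr. Qed.

Lemma injective0 (U V : lmodType R) (f : {linear U -> V}) x : injective f -> f x = 0 -> x = 0.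
Proof. by move=> fI e; apply: fI; rewrite e linear0. Qed.

Lemma exact_comp0 A B C (i : rhom A B) (q : rhom B C) :
  exact_seq i q -> forall x a, q x (i x a) = 0.
Proof. by move=> ex x a; apply/(ex x).2.2; exists a. Qed.

(* Ext^1(C, T) = 0 for separated monic C and vertexwise injective T; the
   extension is built vertex by vertex, along the depth. *)
Lemma extend_along_sepmono A B C T (i : rhom A B) (q : rhom B C) (f : rhom A T) :
  acyclic Q -> exact_seq i q -> sepmono C -> (forall x, injective_module (T x)) ->
  exists g : rhom B T, forall x a, g x (i x a) = f x a.
Proof.
move=> acQ ex smC injT; have [d d_lt] := depth_exists acQ.
(* Both conditions bind only at vertices of depth below [n]; elsewhere [g] is provisional, and it
   starts as zero. *)
suff H n : exists g : forall x, {linear B x -> T x},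
    (forall x a, (d x < n)%N -> g x (i x a) = f x a) /\
    (forall x y (a : Q1 x y) b, (d y < n)%N -> g y (rep_map B a b) = rep_map T a (g x b)).
  have [g [gf g_hom]] := H (\max_x d x).+1.
  have d_max x : (d x < (\max_x d x).+1)%N by rewrite ltnS leq_bigmax.
  by exists (RHom (fun x y a b => g_hom x y a b (d_max y))) => x a; exact: gf.
elim: n => [|n [g [gf g_hom]]].
  by exists (fun x => lin_zero (B x) (T x)).
have step x : exists h : {linear B x -> T x},
    ((d x < n)%N -> forall b, h b = g x b) /\
    (d x = n -> (forall a, h (i x a) = f x a) /\
      forall (c : in_arrow x) b, h (rep_map B (tagged c) b) = rep_map T (tagged c) (g (tag c) b)).
  case: (eqVneq (d x) n) => [dx|/eqP dx]; last first.
    by exists (g x); split.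
  pose phi : {linear in_sum B x -> T x} :=
    Lin (dsum_copair (fun c : in_arrow x => lin_comp (rep_map T (tagged c)) (g (tag c)))).
  have d_in (c : in_arrow x) : (d (tag c) < n)%N by rewrite -dx; exact: d_lt (tagged c).
  (* [h] is prescribed on the image of [A x] and on that of the modules of [B] entering [x].
     Injectivity of [T x] provides it once the two prescriptions agree on the overlap. *)
  have [|h hP] := @injective_extend R (T x) (fg_prod (A x) (fg_dsum (fun c : in_arrow x => B (tag c))))
    (B x) (lin_copair (i x) (in_map B x)) (lin_copair (f x) phi) (injT x).
    move=> [a b] ab0; have {}ab0 : i x a + in_map B x b = 0 by exact: ab0.
    suff : f x a + phi b = 0 by [].
    (* Separated monicity of [C] shows that [b] dies in [C], hence comes from [A]. *)
    have qb c : q (tag c) (b c) = 0.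
      have : in_sum_mor q x b = 0.
        apply: injective0 (smC x) _; rewrite in_map_mor.
        have -> : in_map B x b = - i x a by apply/eqP; rewrite -addr_eq0 addrC; apply/eqP.
        by rewrite linearN exact_comp0 // oppr0.
      by move/dsumP/(_ c); rewrite dsumE dsum_zeroE.
    have [b' b'P] := dependent_choice (fun c => ((ex (tag c)).2.2 (b c)).1 (qb c)).
    pose b1 : in_sum A x := dsum_of (M := fun c : in_arrow x => A (tag c) : lmodType R) b'.
    have be : b = in_sum_mor i x b1 by apply/dsumP=> c; rewrite !dsumE b'P.
    have a0 : a = - in_map A x b1.
      apply/eqP; rewrite -addr_eq0; apply/eqP.
      by apply: injective0 (ex x).1 _; rewrite linearD -in_map_mor -be.
    rewrite a0 linearN -in_map_mor addrC; apply/eqP; rewrite subr_eq0; apply/eqP.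
    by apply: eq_bigr => c _ /=; rewrite be !dsumE gf.
  exists h; split=> [|_]; first by rewrite dx ltnn.
  split=> [a|c b].
    have : h (i x a + in_map B x 0) = f x a + phi 0 := hP (a, 0).
    by rewrite !linear0 !addr0.
  pose b' : in_sum B x := dsum_in (M := fun b : in_arrow x => B (tag b) : lmodType R) c b.
  have : h (i x 0 + in_map B x b') = f x 0 + phi b' := hP (0, b').
  rewrite !linear0 !add0r in_map_in => ->.
  rewrite /= (bigD1 c) //= dsum_in_fun_eq big1 ?addr0 // => c' ne.
  by rewrite dsum_in_fun_neq ?linear0 ?linear0 // eq_sym.
have [h hP] := dependent_choice step.
exists h; split=> [x a|x y a b]; rewrite ltnS leq_eqVlt => /predU1P[dx|lt_dx].
- by have [h1 _] := (hP x).2 dx.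
- by rewrite (hP x).1 // gf.
- have [_ h2] := (hP y).2 dx; rewrite (h2 (Tagged (fun x => Q1 x y : Type) a)) /=.
  by rewrite (hP x).1 // -dx; exact: d_lt a.
- by rewrite (hP y).1 // (hP x).1 ?g_hom //; exact: ltn_trans (d_lt _ _ a) lt_dx.
Qed.

End RepBasics.

(** * Projective representations generated at a vertex *)

Section PathProjectives.
Variables (R : pzRingType) (Q : quiver).
Implicit Types A B C X Y Z T : rep R Q.

Definition rep_anypath X (i j : Q0 Q) (p : anypath i j) : {linear X i -> X j} :=
  rep_pathn X (tagged p).

(** [S] is a set of vertices closed under arrows; it admits families that are natural only away from
    [v]. *)
Lemma rep_pathn_nat X Y (f : forall i, {linear X i -> Y i}) (S : Q0 Q -> Prop) :
  (forall i j (a : Q1 i j), S i -> S j /\ forall x, f j (rep_map X a x) = rep_map Y a (f i x)) ->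
  forall n i j (p : pathn n i j) x, S i -> S j /\ f j (rep_pathn X p x) = rep_pathn Y p (f i x).
Proof.
move=> fS; elim=> [|n IH] i j p x Si.
  by case: p => u /= /[dup] /eqP ij; case: j / ij => ii; rewrite eq_axiomK.
case: p => l [p a] /=; have [Sl e] := IH i l p x Si.
by have [Sj ->] := fS l j a Sl; rewrite e.
Qed.

Lemma trivial_bpath_exists (w : Q0 Q) : exists p : bpath w w, trivial_path p.
Proof.
have c0 : (0 < #|Q0 Q|)%N by apply/card_gt0P; exists w.
by exists (existT (fun n : 'I__ => pathn n w w : Type) (Ordinal c0) (path_nil w)).
Qed.

Lemma trivial_bpath_id X (w : Q0 Q) (p : bpath w w) x : trivial_path p -> rep_path X p x = x.
Proof.
case: p => -[[|n] ltn] p //= _; rewrite /rep_path /=.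
by move: p => [u /= ww]; rewrite eq_axiomK.
Qed.

Lemma trivial_bpath_unique (w : Q0 Q) (p q : bpath w w) :
  trivial_path p -> trivial_path q -> p = q.
Proof.
case: p => -[[|n] ltn] p //=; case: q => -[[|m] ltm] q //= _ _.
rewrite (bool_irrelevance ltm ltn); congr existT.
by case: p q => [[] p] [[] q]; congr exist; exact: bool_irrelevance.
Qed.

(** The unit of the adjunction between [Prep w] and evaluation at [w]; [Prep_lift] is the map
    adjoint to [s]. *)
Definition Prep_unit_fun (w : Q0 Q) (J : fgmod R) (c : J) : Prep w J w :=
  dsum_of (M := fun _ => J : lmodType R) (fun p => if trivial_path p then c else 0).
Fact Prep_unit_linear w J : linear (@Prep_unit_fun w J).
Proof.
move=> a x y; apply/dsumP=> p; rewrite !(dsumE, dsum_addE, dsum_scaleE).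
by case: ifP; rewrite ?scaler0 ?addr0.
Qed.
Definition Prep_unit w J := Lin (@Prep_unit_linear w J).

Definition Prep_lift_fun w (J : fgmod R) Z (s : {linear J -> Z w}) i (x : Prep w J i) : Z i :=
  \sum_p rep_path Z p (s (x p)).
Fact Prep_lift_linear w J Z s i : linear (@Prep_lift_fun w J Z s i).
Proof.
move=> a x y; rewrite /Prep_lift_fun scaler_sumr -big_split /=; apply: eq_bigr => p _.
by rewrite dsum_addE dsum_scaleE !linearP.
Qed.
Definition Prep_lift w J Z s i := Lin (@Prep_lift_linear w J Z s i).

Lemma Prep_lift_unit w (J : fgmod R) Z (s : {linear J -> Z w}) c :
  Prep_lift s w (Prep_unit w J c) = s c.
Proof.
have [p0 p0P] := trivial_bpath_exists w.
rewrite /= /Prep_lift_fun (bigD1 p0) //= dsumE p0P trivial_bpath_id // big1 ?addr0 // => p ne.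
rewrite dsumE; case: ifP => [tp|_]; last by rewrite !linear0.
by case/eqP: ne; exact: trivial_bpath_unique.
Qed.

Hypothesis acQ : acyclic Q.

Lemma Prep_lift_hom w (J : fgmod R) Z (s : {linear J -> Z w}) :
  is_rhom (Prep w J) Z (Prep_lift s).
Proof.
move=> i j a x; rewrite /= /Prep_lift_fun linear_sum.
under eq_bigr => q _ do rewrite dsumE linear_sum linear_sum big_mkcond.
rewrite exchange_big; apply: eq_bigr => p _ /=.
(* Acyclicity keeps the extended path within the length bound of [bpath], so the summand of [p] is
   not lost. *)
have [q0 q0P] := anypath_of_surj acQ (anypath_cons a (anypath_of p)).
rewrite (bigD1 q0) //= q0P eqxx big1 ?addr0 => [|q ne].
  by rewrite -[rep_path Z q0 _]/(rep_anypath Z (anypath_of q0) _) q0P.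
by case: eqP => // e; case/eqP: ne; apply: anypath_of_inj; rewrite q0P.
Qed.

Definition Prep_lift_rhom w J Z s : rhom (Prep w J) Z := RHom (@Prep_lift_hom w J Z s).

(** Transporting the unit along [p] reaches exactly the summand of [p]. Hence the unit generates
    [Prep w J], which gives the uniqueness of lifts. *)
Lemma Prep_anypath w (J : fgmod R) c i (p : anypath w i) :
  rep_anypath (Prep w J) p (Prep_unit w J c)
  = dsum_of (fun q => if anypath_of q == p then c else 0).
Proof.
case: p => n p; rewrite /rep_anypath /=; elim: n i p => [|n IH] i p.
  case: p => u /= /[dup] /eqP ij; case: i / ij => ii; rewrite eq_axiomK /=.
  apply/dsumP=> q; rewrite !dsumE; congr (if _ then _ else _).
  case: q => -[[|m] ltm] q; last by apply/esym/eqP => /(congr1 (@tag _ _)).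
  apply/esym/eqP; rewrite /anypath_of /=; congr existT.
  by case: q u => [[] q] []; congr exist; exact: bool_irrelevance.
case: p => l [p a] /=; rewrite IH.
apply/dsumP=> q; rewrite !dsumE.
have [q0 q0P] := anypath_of_surj acQ (existT (fun n => pathn n w l : Type) n p).
rewrite big_mkcond (bigD1 q0) //= dsumE q0P eqxx big1 ?addr0 => [|q' ne].
  rewrite -[anypath_cons a _]/(existT (fun n => pathn n w i : Type) n.+1
    (Tagged (fun l => (pathn n w l * Q1 l i)%type) (p, a))).
  by rewrite eq_sym.
rewrite dsumE; case: ifP => // _; case: eqP => // e; case/eqP: ne.
by apply: anypath_of_inj; rewrite q0P.
Qed.

Lemma Prep_decomp w (J : fgmod R) i (x : Prep w J i) :
  x = \sum_p rep_path (Prep w J) p (Prep_unit w J (x p)).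
Proof.
apply/dsumP=> q; rewrite dsum_sumE (bigD1 q) //= big1 ?addr0 => [|p ne].
  by rewrite [rep_path _ _ _](Prep_anypath _ (anypath_of q)) dsumE eqxx.
rewrite [rep_path _ _ _](Prep_anypath _ (anypath_of p)) dsumE; case: eqP => // e.
by case/eqP: ne; apply: anypath_of_inj.
Qed.

Lemma Prep_ext w (J : fgmod R) Z (S : Q0 Q -> Prop) (f g : forall i, {linear Prep w J i -> Z i}) :
  S w ->
  (forall i j (a : Q1 i j), S i -> S j /\ forall x, f j (rep_map (Prep w J) a x) = rep_map Z a (f i x)) ->
  (forall i j (a : Q1 i j), S i -> S j /\ forall x, g j (rep_map (Prep w J) a x) = rep_map Z a (g i x)) ->
  (forall c, f w (Prep_unit w J c) = g w (Prep_unit w J c)) ->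
  forall i x, f i x = g i x.
Proof.
move=> Sw fS gS fg i x; rewrite (Prep_decomp x) !linear_sum; apply: eq_bigr => p _.
rewrite /rep_path (rep_pathn_nat fS (tagged p) _ Sw).2 (rep_pathn_nat gS (tagged p) _ Sw).2.
by rewrite fg.
Qed.

Lemma Prep_projective (w : Q0 Q) (J : fgmod R) : projective_module J -> projective_rep (Prep w J).
Proof.
move=> pJ X Y g f gS.
have [s sP] := pJ (X w) (Y w) (g w) (lin_comp (f w) (Prep_unit w J)) (gS w).
exists (Prep_lift_rhom s); apply: (Prep_ext (S := fun=> True)
  (f := fun i => lin_comp (g i) (Prep_lift s i)) (g := rmor f)) => //.
- by move=> i j a _; split=> // x; exact: rmorP (rhom_comp g (Prep_lift_rhom s)) i j a x.
- by move=> i j a _; split=> // x; exact: rmorP f i j a x.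
- by move=> c; rewrite [LHS](_ : _ = g w (Prep_lift s w (Prep_unit w J c))) // Prep_lift_unit sP.
Qed.

(** A nontrivial path has a unique last arrow and remainder, so distinct coordinates of the source
    go to distinct coordinates of the target. *)
Lemma Prep_sepmono (w : Q0 Q) (J : fgmod R) : sepmono (Prep w J).
Proof.
move=> i; apply: linear_injP => x x0; apply/dsumP => b; apply/dsumP => p; rewrite !dsum_zeroE.
have [q qP] := anypath_of_surj acQ (anypath_cons (tagged b) (anypath_of p)).
have := dsumE (fun=> 0) q; move/dsumP/(_ q): x0.
rewrite /= /in_map_fun dsum_sumE (bigD1 b) //= dsumE (bigD1 p) //=; last by rewrite qP.
rewrite big1 ?addr0 => [|p' /andP[/eqP e ne]]; last first.
  case/eqP: ne; apply: anypath_of_inj.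
  move: e; rewrite qP => /(congr1 (@anypath_uncons _ _ _)); rewrite !anypath_consK.
  by move/Some_inj => e; apply/eqP; move/eqP: e; rewrite eq_Tagged.
rewrite big1 ?addr0 => [-> -> //|b' ne].
rewrite dsumE big1 // => p' /eqP e; case/eqP: ne.
move: e; rewrite qP => /(congr1 (@anypath_uncons _ _ _)); rewrite !anypath_consK.
move/Some_inj/(congr1 (@tag _ _)) => /=.
have eta (c : in_arrow i) : existT (fun l => Q1 l i : Type) (tag c) (tagged c) = c by case: c.
by rewrite !eta.
Qed.

Lemma rep_dsum_copair (I : finType) (X : I -> rep R Q) Z (h : forall c, rhom (X c) Z) :
  exists f : rhom (rep_dsum X) Z, forall i x, f i x = \sum_c h c i (x c).
Proof.
have hom : is_rhom (rep_dsum X) Z (fun i => Lin (dsum_copair (fun c => h c i))).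
  move=> i j a x; rewrite /= linear_sum; apply: eq_bigr => c _.
  by rewrite dsumE rmorP.
by exists (RHom hom).
Qed.

Definition rep_dsum_in_fun (I : finType) (X : I -> rep R Q) (c : I) i :
    {linear X c i -> rep_dsum X i} :=
  dsum_in (M := fun c => X c i : lmodType R) c.
Lemma rep_dsum_in_hom (I : finType) (X : I -> rep R Q) c :
  is_rhom (X c) (rep_dsum X) (@rep_dsum_in_fun I X c).
Proof.
move=> i j a x; apply/dsumP=> d; rewrite [RHS]dsumE.
by have [<-|ne] := eqVneq c d; rewrite /rep_dsum_in_fun ?dsum_in_eq // !dsum_in_neq // linear0.
Qed.
Definition rep_dsum_in (I : finType) (X : I -> rep R Q) c := RHom (@rep_dsum_in_hom I X c).

Lemma rep_dsum_projective (I : finType) (X : I -> rep R Q) :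
  (forall c, projective_rep (X c)) -> projective_rep (rep_dsum X).
Proof.
move=> pX A B g f gS.
have [h hP] := dependent_choice (fun c =>
  pX c A B g (rhom_comp f (rep_dsum_in X c)) gS).
have [k kP] := rep_dsum_copair h; exists k => i x; rewrite kP linear_sum.
rewrite [in RHS](dsum_decomp x) linear_sum; apply: eq_bigr => c _.
by rewrite hP.
Qed.

Lemma rep_dsum_sepmono (I : finType) (X : I -> rep R Q) :
  (forall c, sepmono (X c)) -> sepmono (rep_dsum X).
Proof.
move=> smX i; apply: linear_injP => x x0; apply/dsumP => b; apply/dsumP => c.
pose xc : in_sum (X c) i := dsum_of (M := fun b : in_arrow i => X c (tag b) : lmodType R)
  (fun b => x b c).
have : xc = 0.
  apply: injective0 (@smX c i) _.
  move/dsumP/(_ c): x0; rewrite dsum_zeroE /= /in_map_fun dsum_sumE => e.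
  by rewrite -[RHS]e; apply: eq_bigr => b' _; rewrite !dsumE.
by move/dsumP/(_ b); rewrite dsumE !dsum_zeroE.
Qed.

(* X is a quotient of the sum over all vertices w of P_w(F_w), with F_w a free
   cover of X_w. *)
Lemma rep_cover X :
  exists P (q : rhom P X), [/\ projective_rep P, sepmono P,
    forall i, projective_module (P i) & forall i, surjective_map (q i)].
Proof.
have [F FP] := dependent_choice (fun w => projective_cover_free (X w)).
have [s sP] := dependent_choice FP.
have [q qP] := rep_dsum_copair (fun w => Prep_lift_rhom (s w)).
exists (rep_dsum (fun w => Prep w (F w))), q; split=> [|||i x].
- by apply: rep_dsum_projective => w; apply: Prep_projective; exact: (sP w).1.
- by apply: rep_dsum_sepmono => w; exact: Prep_sepmono.
- move=> i; apply: projective_dsum => w; apply: projective_dsum => _; exact: (sP w).1.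
have [y <-] := (sP i).2 x.
exists (dsum_in (M := fun w => Prep w (F w) i : lmodType R) i (Prep_unit i (F i) y)).
rewrite qP (bigD1 i) //= dsum_in_fun_eq big1 ?addr0 => [|w ne].
  exact: Prep_lift_unit.
by rewrite dsum_in_fun_neq 1?eq_sym //; exact: (linear0 (Prep_lift (s w) i)).
Qed.

Lemma projective_rep_split A (P : rep R Q) (q : rhom A P) :
  projective_rep P -> (forall i, surjective_map (q i)) ->
  exists s : rhom P A, forall i x, q i (s i x) = x.
Proof. by move=> pP qS; have [s sP] := pP A P q (rhom_id P) qS; exists s. Qed.

Lemma projective_rep_at (P : rep R Q) i : projective_rep P -> projective_module (P i).
Proof.
move=> pP; have [P' [q [_ _ pP' qS]]] := rep_cover P.
have [s sP] := projective_rep_split pP qS.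
exact: (projective_retract (sP i) (pP' i)).
Qed.

Lemma projective_sepmono (P : rep R Q) : projective_rep P -> sepmono P.
Proof.
move=> pP; have [P' [q [_ smP' _ qS]]] := rep_cover P.
have [s sP] := projective_rep_split pP qS.
apply: (sepmono_sub (f := s)) => // i x y e.
by rewrite -[x]sP e sP.
Qed.

End PathProjectives.

(** * Gorenstein-projective representations *)

Section GorensteinProjectives.
Variables (R : pzRingType) (Q : quiver).
Hypotheses (injR : selfinjective R) (kerR : kernels_fg R) (acQ : acyclic Q).
Implicit Types A B C X Y Z T : rep R Q.

(** [B] is a cosyzygy of [A]. *)
Definition linked A B := exists (P : rep R Q) (i : rhom A P) (q : rhom P B),
  projective_rep P /\ exact_seq i q.

(* The class K witnesses that X has an infinite coresolution by projectives;
   it plays the role of a coinductive definition. *)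
Definition coresolved X := exists K : rep R Q -> Prop,
  K X /\ forall Z, K Z -> exists2 Z', linked Z Z' & K Z'.

Lemma linked_sepmono A B : linked A B -> sepmono A.
Proof.
move=> [P [i [q [pP ex]]]]; apply: sepmono_sub (projective_sepmono acQ pP).
by move=> x; exact: (ex x).1.
Qed.

Lemma coresolved_step X : coresolved X -> exists2 Y, linked X Y & coresolved Y.
Proof.
by move=> [K [KX KS]]; have [Y XY KY] := KS X KX; exists Y => //; exists K.
Qed.

Lemma coresolved_cons X Y : linked X Y -> coresolved Y -> coresolved X.
Proof.
move=> XY [K [KY KS]]; exists (fun Z => Z = X \/ K Z); split; first by left.
move=> Z [->|KZ]; first by exists Y => //; right.
by have [Z' ? ?] := KS Z KZ; exists Z' => //; right.
Qed.

Lemma coresolved_sepmono X : coresolved X -> sepmono X.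
Proof. by move=> /coresolved_step[Y /linked_sepmono]. Qed.

Lemma projective_rep_injective T : projective_rep T -> forall i, injective_module (T i).
Proof. by move=> pT i; apply: projective_injective injR _; exact: projective_rep_at. Qed.

(** The complete resolution shifted by one step resolves the cosyzygy, so the class of
    Gorenstein-projectives is its own witness. *)
Lemma gproj_coresolved X : gorenstein_projective X -> coresolved X.
Proof.
move=> gX; exists (@gorenstein_projective R Q); split=> // {gX}X [P [d [pP dP extP [e eP]]]].
have [Z [s sP]] := kernel_rep (d (0 + 1)) kerR.
have [||q qP] := @rhom_factor_inj R Q _ _ _ s (d 0).
- by move=> i; exact: (sP i).1.
- by move=> i x; apply/(sP i).2/dP; exists x.
exists Z.
  exists (P 0), e, q; split=> // i; split; first exact: (eP i).1.
  split=> [z|x].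
    have /(dP 0) [y yP] : d (0 + 1) i (s i z) = 0 by apply/(sP i).2; exists z.
    by exists y; apply: (sP i).1; rewrite qP.
  split=> [qx|[y <-]]; first by apply/(eP i).2; rewrite -qP qx linear0.
  by apply: (injective0 (sP i).1); rewrite qP; apply/(eP i).2; exists y.
exists (fun n => P (n + 1)), (fun n => d (n + 1)); split.
- by [].
- by move=> n i x; exact: dP.
- by move=> T n f; exact: extP.
- by exists s.
Qed.

(** A syzygy is a subobject of a separated monic projective, hence again separated monic, so this
    step can be iterated. *)
Lemma linked_left X : sepmono X -> exists2 K, linked K X & sepmono K.
Proof.
move=> smX; have [P [q [pP smP _ qS]]] := rep_cover acQ X.
have [K [s sP]] := kernel_rep q kerR.
exists K; last by apply: (sepmono_sub (f := s)) smP => i; exact: (sP i).1.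
exists P, s, q; split=> // i; split; first exact: (sP i).1.
by split=> // x; exact: (sP i).2.
Qed.

Lemma chain_exists (T : Type) (S : T -> Prop) (r : T -> T -> Prop) x0 :
  S x0 -> (forall x, S x -> exists2 y, r x y & S y) ->
  exists f : nat -> T, [/\ f 0%N = x0, forall n, S (f n) & forall n, r (f n) (f n.+1)].
Proof.
move=> S0 stepS.
have [g gP] : exists g : {x | S x} -> {x | S x}, forall x, r (proj1_sig x) (proj1_sig (g x)).
  apply: (dependent_choice (P := fun (x y : {x | S x}) => r (proj1_sig x) (proj1_sig y))).
  by case=> x Sx; have [y xy Sy] := stepS x Sx; exists (exist S y Sy).
exists (fun n => proj1_sig (iter n g (exist S x0 S0))); split=> // n.
exact: proj2_sig.
Qed.

(** The coresolution is spliced with a projective resolution. All cocycles are separated monic and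
    [T] is vertexwise injective, so a map killing the boundaries factors through the cocycles and
    extends to the next term. *)
Lemma coresolved_gproj X : coresolved X -> gorenstein_projective X.
Proof.
move=> cX.
have [Zr [Zr0 cZr linkr]] := chain_exists cX coresolved_step.
have [Zl [Zl0 smZl linkl]] :=
  chain_exists (r := fun A B => linked B A) (coresolved_sepmono cX) linked_left.
(* [Negz m] is -(m+1), and both chains start at [X]; the shift keeps [X] from occurring twice. *)
pose Z n := match n with Posz m => Zr m | Negz m => Zl m.+1 end.
have smZ n : sepmono (Z n) by case: n => m //=; exact: coresolved_sepmono.
have linkZ n : linked (Z n) (Z (n + 1)).
  case: n => [m|[|m]].
  - by rewrite -[Posz m + 1]/(Posz (m + 1)) addn1; exact: linkr.
  - by rewrite /= Zr0 -Zl0; exact: linkl.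
  - have -> : Negz m.+1 + 1 = Negz m by rewrite !NegzE -addn1 PoszD opprD addrNK.
    exact: linkl.
have [P PP] := dependent_choice linkZ.
have [i iP] := dependent_choice PP.
have [q qP] := dependent_choice iP.
have pP n := (qP n).1; have ex n := (qP n).2.
have iI n x : injective (i n x) := (ex n x).1.
have qS n x : surjective_map (q n x) := (ex n x).2.1.
have ker_q n x y : q n x y = 0 <-> exists z, i n x z = y := (ex n x).2.2 y.
exists P, (fun n => rhom_comp (i (n + 1)) (q n)); split=> //.
- move=> n x y; split=> [e|[z <-]] /=; last by rewrite (exact_comp0 (ex _)) linear0.
  have /ker_q[z <-] := injective0 (@iI _ x) e.
  by have [w <-] := qS n x z; exists w.
- move=> T n f pT f0.
  have [|f' f'P] := rhom_factor_surj (p := q (n + 1)) (g := f) (@qS _).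
    move=> x y /ker_q[z <-]; have [w <-] := qS n x z; exact: f0.
  have [g gP] := extend_along_sepmono f' acQ (ex (n + 1 + 1)) (smZ _)
    (projective_rep_injective pT).
  by exists g => x y; rewrite /= gP f'P.
- have iz : rhom X (P 0) by rewrite -Zr0; exact: i 0.
  have [e eP] : exists e : rhom X (P 0), forall x, is_kernel (e x) (q 0 x).
    by rewrite -Zr0; exists (i 0) => x; split=> // y; exact: ker_q.
  exists e => x; split=> [|y]; first exact: (eP x).1.
  rewrite -(eP x).2 /=; split=> [e0|->]; last by rewrite linear0.
  exact: injective0 (@iI _ x) e0.
Qed.

(** The horseshoe lemma: the embedding of [A] in a projective extends to [B] because [C] is
    separated monic, so [B] embeds in the sum of two projectives, and the cokernel is again an
    extension of coresolved objects. *)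
Lemma coresolved_extension A B C (i : rhom A B) (q : rhom B C) :
  exact_seq i q -> coresolved A -> coresolved C -> coresolved B.
Proof.
move=> ex0 cA0 cC0.
exists (fun B => exists A C (i : rhom A B) (q : rhom B C),
  [/\ exact_seq i q, coresolved A & coresolved C]).
split; first by exists A, C, i, q.
move=> {i q ex0 cA0 cC0}{}B [{}A [{}C [i [q [ex cA cC]]]]].
have [A' [P [iA [qA [pP exA]]]] cA'] := coresolved_step cA.
have [C' [P' [iC [qC [pP' exC]]]] cC'] := coresolved_step cC.
have [e eP] := extend_along_sepmono iA acQ ex (coresolved_sepmono cC) (projective_rep_injective pP).
have j_hom : is_rhom B (rep_sum P P') (fun x => lin_pair (e x) (lin_comp (iC x) (q x))).
  by move=> x y a b; rewrite /= !rmorP.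
pose j := RHom j_hom.
have [B' [p pE]] := cokernel_rep j.
have jI x : injective (j x).
  apply: linear_injP => b /= [eb /(injective0 (exC x).1)/(ex x).2.2[a ab]].
  by move: eb; rewrite -ab eP => /(injective0 (exA x).1) ->; rewrite linear0.
exists B'; first by exists (rep_sum P P'), j, p; split=> //; exact: projective_sum.
have pj x b : p x (e x b, iC x (q x b)) = 0 by apply/(pE x).2; exists b.
have inl_hom : is_rhom P (rep_sum P P') (fun x => lin_inl).
  by move=> x y a b; rewrite /= /prod_map_fun /= linear0.
have snd_hom : is_rhom (rep_sum P P') P' (fun x => lin_snd) by [].
have [|al alP] := rhom_factor_surj (p := qA) (g := rhom_comp p (RHom inl_hom))
    (fun x => (exA x).2.1).
  move=> x y /(exA x).2.2[a <-] /=; rewrite -(pj x (i x a)) eP.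
  by rewrite (exact_comp0 ex) linear0.
have [|be beP] := rhom_factor_surj (p := p) (g := rhom_comp qC (RHom snd_hom))
    (fun x => (pE x).1).
  by move=> x y /(pE x).2[b <-] /=; rewrite (exact_comp0 exC).
exists A', C', al, be; split=> // x; split.
  apply: linear_injP => y; have [y' <-] := (exA x).2.1 y; rewrite alP /=.
  move=> /(pE x).2[b [<- /(injective0 (exC x).1)/(ex x).2.2[a <-]]].
  by rewrite eP (exact_comp0 exA).
split=> [c|b].
  have [c' <-] := (exC x).2.1 c; exists (p x (0, c')); exact: beP.
have [[y y'] <-] := (pE x).1 b; rewrite beP /=; split=> [|[a]].
  move=> /(exC x).2.2[c <-]; have [b' <-] := (ex x).2.1 c.
  (* Subtracting the image of [b'] under [j] clears the second component and leaves [y - e x b'] in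
     the first. *)
  exists (qA x (y - e x b')); rewrite alP /=.
  apply/eqP; rewrite -subr_eq0 -linearB; apply/eqP.
  have -> : (y - e x b', 0) - (y, iC x (q x b')) = - (e x b', iC x (q x b')) :> rep_sum P P' x.
    by rewrite [LHS]surjective_pairing [RHS]surjective_pairing /= sub0r addrC addKr.
  by rewrite linearN pj oppr0.
have [a' <-] := (exA x).2.1 a; rewrite alP /= => e1.
by have := beP x (a', 0); rewrite e1 beP /= linear0.
Qed.

End GorensteinProjectives.

(** * Representations of the reflected quiver *)

(** Coinduction along a construction that preserves cosyzygies; [Phi] is a relation so that the
    image may depend on choices. *)
Lemma coresolved_image (R R' : pzRingType) (Q Q' : quiver) (Phi : rep R Q -> rep R' Q' -> Prop) :
  (forall Z Z' W, coresolved Z -> coresolved Z' -> linked Z Z' -> Phi Z W ->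
     exists2 W', linked W W' & Phi Z' W') ->
  forall X W, coresolved X -> Phi X W -> coresolved W.
Proof.
move=> PhiS X W cX XW; exists (fun W => exists2 X, coresolved X & Phi X W); split.
  by exists X.
move=> {X W cX XW}W [X cX XW]; have [X' XX' cX'] := coresolved_step cX.
by have [W' WW' XW'] := PhiS _ _ _ cX cX' XX' XW; exists W' => //; exists X'.
Qed.

Section PickAt.
Variables (R : pzRingType) (I : eqType) (v : I) (A B : I -> lmodType R).
Variables (hv : {linear A v -> B v}) (h : forall i, {linear A i -> B i}).

Definition pick_at i : {linear A i -> B i} :=
  match v =P i with
  | ReflectT e => ecast j {linear A j -> B j} e hv
  | ReflectF _ => h i
  end.

Lemma pick_at_eq : pick_at v = hv.
Proof. by rewrite /pick_at; case: eqP => // e; rewrite eq_axiomK. Qed.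

Lemma pick_at_neq i : i != v -> pick_at i = h i.
Proof. by rewrite /pick_at eq_sym; case: eqP. Qed.
End PickAt.

(** * Arrows of Q(v) and representations split at v *)

Section ReflectedArrows.
Variables (Q : quiver) (v : Q0 Q).
Local Notation Qv := (reflect_quiver v).

(** The arrow types of Q(v) are stuck on [i == v] and [j == v]. With these booleans replaced by
    variables and equations, case analysis makes them reduce. *)
Definition start_arrow_at bi bj i j (ei : bi = true) (ej : bj = false) (a : Q1 j v) :
    reflect_Q1_at v bi bj i j :=
  match esym ei in _ = bi, esym ej in _ = bj return reflect_Q1_at v bi bj i j with
  | erefl, erefl => a
  end.

Definition away_arrow_at bi bj i j (ei : bi = false) (ej : bj = false) (a : Q1 i j) :
    reflect_Q1_at v bi bj i j :=
  match esym ei in _ = bi, esym ej in _ = bj return reflect_Q1_at v bi bj i j with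
  | erefl, erefl => a
  end.

Definition away_arrow i j (hi : i != v) (hj : j != v) (a : @Q1 Q i j) : @Q1 Qv i j :=
  @away_arrow_at (i == v) (j == v) i j (negbTE hi) (negbTE hj) a.

Hypothesis sink_v : sink v.

Lemma in_arrow_neq (b : in_arrow v) : tag b != v.
Proof.
apply/eqP; case: b => j a /= e; move: a; rewrite e => a; exact: sink_v a.
Qed.

Definition start_arrow (b : in_arrow v) : @Q1 Qv v (tag b) :=
  @start_arrow_at (v == v) (tag b == v) v (tag b) (eqxx v) (negbTE (in_arrow_neq b)) (tagged b).

Lemma reflect_arrow_ind (T : forall i j, @Q1 Qv i j -> Prop) :
  (forall b, T v (tag b) (start_arrow b)) ->
  (forall i j hi hj a, T i j (@away_arrow i j hi hj a)) ->
  forall i j a, T i j a.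
Proof.
move=> Tstart Taway i j a.
have decS bi bj (x : reflect_Q1_at v bi bj i j) : bi = true ->
    bj = false /\ exists y, forall ei ej, x = start_arrow_at i ei ej y.
  case: bi bj x => [] [] //= x _; split=> //; exists x => ei ej.
  by rewrite /start_arrow_at (eq_irrelevance ei erefl) (eq_irrelevance ej erefl).
have decA bi bj (x : reflect_Q1_at v bi bj i j) : bi = false ->
    bj = false /\ exists y, forall ei ej, x = away_arrow_at ei ej y.
  case: bi bj x => [] [] //= x _; split=> //; exists x => ei ej.
  by rewrite /away_arrow_at (eq_irrelevance ei erefl) (eq_irrelevance ej erefl).
case: (eqVneq i v) => [iv|hi].
  subst i; clear decA.
  have [jv [y yP]] := decS _ _ a (eqxx v).
  have := Tstart (existT (fun j => Q1 j v : Type) j y).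
  by rewrite /start_arrow /= -yP.
have [jv [y yP]] := decA _ _ a (negbTE hi).
have hj : j != v by apply/negbT.
by have := Taway i j hi hj y; rewrite /away_arrow -yP.
Qed.

Lemma no_reflect_path_to n (i : Q0 Q) : i != v -> @pathn Qv n i v -> False.
Proof.
case: n => [|n] hi; first by case=> _ /= /eqP iv; rewrite iv eqxx in hi.
by case=> l [_]; rewrite /= eqxx; case: (l == v).
Qed.

Section Reps.
Variable R : pzRingType.
Implicit Types (Y Z : rep R Qv) (X : rep R Q) (M : fgmod R).

(* The functor H; as in [is_ahom], [src_pres] and [snk_pres] below, only the part of Y away
   from v matters. *)
Definition start_sum Y : fgmod R := fg_dsum (fun b : in_arrow v => Y (tag b)).

Definition start_map Y : {linear Y v -> start_sum Y} :=
  Lin (dsum_glue (fun b : in_arrow v => rep_map Y (start_arrow b))).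

Definition start_sum_map Y Z (f : forall i, {linear Y i -> Z i}) :
    {linear start_sum Y -> start_sum Z} :=
  dsum_map (fun b : in_arrow v => f (tag b)).

Definition is_ahom Y Z (f : forall i, {linear Y i -> Z i}) := forall i j hi hj a x,
  f j (rep_map Y (@away_arrow i j hi hj a) x) = rep_map Z (away_arrow hi hj a) (f i x).

Lemma rhom_ahom Y Z (f : rhom Y Z) : is_ahom f.
Proof. by move=> i j hi hj a x; rewrite rmorP. Qed.

Lemma is_rhom_reflect Y Z (f : forall i, {linear Y i -> Z i}) : is_ahom f ->
  (forall b x, f (tag b) (rep_map Y (start_arrow b) x) = rep_map Z (start_arrow b) (f v x)) ->
  is_rhom Y Z f.
Proof. by move=> fa fs; apply: reflect_arrow_ind. Qed.

Lemma away_map_away X i j hi hj (a : Q1 i j) x :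
  rep_map (away v X) (away_arrow hi hj a) x = rep_map X a x.
Proof.
rewrite /= /away_arrow /away_map.
by move: (negbTE hi) (negbTE hj); case: (i == v) => // ei; case: (j == v) => // ej;
  rewrite (eq_irrelevance ei erefl) (eq_irrelevance ej erefl).
Qed.

Section Glue.
Variables (N : Q0 Q -> fgmod R) (M : fgmod R).
Definition glue_mod (i : Q0 Q) : fgmod R := if i == v then M else N i.
(** At [v] this map and [glue_out_at] take the default value zero; the condition [i != v] in the
    cancellation lemmas excludes that case. *)
Definition glue_in_at (b : bool) i : {linear N i -> (if b then M else N i)} :=
  if b return {linear N i -> (if b then M else N i)} then lin_zero _ _ else lin_id _.
Definition glue_out_at (b : bool) i : {linear (if b then M else N i) -> N i} :=
  if b return {linear (if b then M else N i) -> N i} then lin_zero _ _ else lin_id _.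
Definition glue_inv_at (b : bool) i : {linear M -> (if b then M else N i)} :=
  if b return {linear M -> (if b then M else N i)} then lin_id _ else lin_zero _ _.
Definition glue_outv_at (b : bool) i : {linear (if b then M else N i) -> M} :=
  if b return {linear (if b then M else N i) -> M} then lin_id _ else lin_zero _ _.
Definition glue_in i : {linear N i -> glue_mod i} := glue_in_at (i == v) i.
Definition glue_out i : {linear glue_mod i -> N i} := glue_out_at (i == v) i.
Definition glue_inv : {linear M -> glue_mod v} := glue_inv_at (v == v) v.
Definition glue_outv : {linear glue_mod v -> M} := glue_outv_at (v == v) v.

Lemma glue_inK i : i != v -> cancel (glue_in i) (glue_out i).
Proof. by rewrite /glue_in /glue_out /glue_mod => hi x; case: (i == v) hi. Qed.
Lemma glue_outK i : i != v -> cancel (glue_out i) (glue_in i).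
Proof. by rewrite /glue_in /glue_out /glue_mod => hi; case: (i == v) hi. Qed.
Lemma glue_invK : cancel glue_inv glue_outv.
Proof. by rewrite /glue_inv /glue_outv /glue_mod; move: (eqxx v); case: (v == v). Qed.
Lemma glue_outvK : cancel glue_outv glue_inv.
Proof. by rewrite /glue_inv /glue_outv /glue_mod; move: (eqxx v); case: (v == v). Qed.
End Glue.

(* Z is isomorphic to the representation with M at v, Y elsewhere, and w : M -> H Y. *)
Record src_pres Z Y M (w : {linear M -> start_sum Y}) := SrcPres {
  src_iv : {linear M -> Z v};
  src_ov : {linear Z v -> M};
  src_i : forall i, {linear Y i -> Z i};
  src_o : forall i, {linear Z i -> Y i};
  src_ivK : cancel src_iv src_ov;
  src_ovK : cancel src_ov src_iv;
  src_iK : forall i, i != v -> cancel (src_i i) (src_o i);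
  src_oK : forall i, i != v -> cancel (src_o i) (src_i i);
  src_start : forall b x, rep_map Z (start_arrow b) (src_iv x) = src_i (tag b) (w x b);
  src_away : forall i j hi hj a x, rep_map Z (@away_arrow i j hi hj a) (src_i i x) =
    src_i j (rep_map Y (away_arrow hi hj a) x)
}.

(* X is isomorphic to the representation with M at v, Y elsewhere, and u : H Y -> M. *)
Record snk_pres X Y M (u : {linear start_sum Y -> M}) := SnkPres {
  snk_iv : {linear M -> X v};
  snk_ov : {linear X v -> M};
  snk_i : forall i, {linear Y i -> X i};
  snk_o : forall i, {linear X i -> Y i};
  snk_ivK : cancel snk_iv snk_ov;
  snk_ovK : cancel snk_ov snk_iv;
  snk_iK : forall i, i != v -> cancel (snk_i i) (snk_o i);
  snk_oK : forall i, i != v -> cancel (snk_o i) (snk_i i);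
  snk_end : forall b x, rep_map X (tagged b) (snk_i (tag b) x) =
    snk_iv (u (dsum_in (M := fun b : in_arrow v => Y (tag b) : lmodType R) b x));
  snk_away : forall i j hi hj (a : Q1 i j) x, rep_map X a (snk_i i x) =
    snk_i j (rep_map Y (@away_arrow i j hi hj a) x)
}.

Definition src_pres_self Z : src_pres Z (start_map Z).
Proof.
exists (lin_id _) (lin_id _) (fun i => lin_id _) (fun i => lin_id _) => //.
by move=> b x; rewrite /= dsumE.
Defined.

Definition snk_pres_self X : @snk_pres X (away v X) (X v) (in_map X v).
Proof.
exists (lin_id _) (lin_id _) (fun i => lin_id _) (fun i => lin_id _) => //.
  by move=> b x; exact: (esym (@in_map_in R Q X v b x)).
by move=> i j hi hj a x; rewrite away_map_away.
Defined.

Definition src_map_at Y M (w : {linear M -> start_sum Y}) bi bj i j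
    (a : reflect_Q1_at v bi bj i j) (m : {linear Y i -> Y j}) :
    {linear (if bi then M else Y i) -> (if bj then M else Y j)} :=
  match bi, bj return reflect_Q1_at v bi bj i j ->
    {linear (if bi then M else Y i) -> (if bj then M else Y j)} with
  | true, false => fun b => lin_comp
     (dsum_proj (M := fun b : in_arrow v => Y (tag b) : lmodType R)
       (existT (fun j => Q1 j v : Type) j b)) w
  | false, false => fun _ => m
  | _, true => fun b => match b with end
  end a.

Definition src Y M (w : {linear M -> start_sum Y}) : rep R Qv :=
  @Rep R Qv (glue_mod Y M) (fun i j a => src_map_at w a (rep_map Y a)).

Definition src_presP Y M (w : {linear M -> start_sum Y}) : src_pres (src w) w.
Proof.
exists (glue_inv Y M) (glue_outv Y M) (glue_in Y M) (glue_out Y M).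
- exact: glue_invK.
- exact: glue_outvK.
- by move=> i; exact: glue_inK.
- by move=> i; exact: glue_outK.
- move=> b x; rewrite /= /start_arrow /glue_inv /glue_in; case: b (in_arrow_neq b) => j b /= hj.
  move: (eqxx v) (negbTE hj) (rep_map _ _); rewrite /src_map_at /glue_mod.
  case: (v == v) => // ei; case: (j == v) => // ej.
  by rewrite (eq_irrelevance ei erefl) (eq_irrelevance ej erefl).
- move=> i j hi hj a x; rewrite /= /glue_in.
  move: (rep_map Y _); rewrite /away_arrow.
  move: (negbTE hi) (negbTE hj); rewrite /src_map_at /glue_mod.
  by case: (i == v) => // ei; case: (j == v).
Defined.

(** The equation for [bj] is kept because it transports [a] to an arrow ending in [v]. No arrow
    leaves the sink, so that case takes the default zero. *)
Definition snk_map_at Y M (u : {linear start_sum Y -> M}) bi bj i j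
    (ej : (j == v) = bj) (a : Q1 i j) (m : reflect_Q1_at v bi bj i j -> {linear Y i -> Y j}) :
    {linear (if bi then M else Y i) -> (if bj then M else Y j)} :=
  match bi, bj return (j == v) = bj -> (reflect_Q1_at v bi bj i j -> {linear Y i -> Y j}) ->
    {linear (if bi then M else Y i) -> (if bj then M else Y j)} with
  | false, false => fun _ m => m a
  | false, true => fun e _ => lin_comp u
     (dsum_in (M := fun b : in_arrow v => Y (tag b) : lmodType R)
       (existT (fun j => Q1 j v : Type) i (ecast j (Q1 i j) (eqP e) a)))
  | true, _ => fun _ _ => lin_zero _ _
  end ej m.

Definition snk Y M (u : {linear start_sum Y -> M}) : rep R Q :=
  @Rep R Q (glue_mod Y M) (fun i j a =>
    @snk_map_at Y M u (i == v) (j == v) i j erefl a (fun a => rep_map Y (a : @Q1 Qv i j))).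

Definition snk_presP Y M (u : {linear start_sum Y -> M}) : snk_pres (snk u) u.
Proof.
exists (glue_inv Y M) (glue_outv Y M) (glue_in Y M) (glue_out Y M).
- exact: glue_invK.
- exact: glue_outvK.
- by move=> i; exact: glue_inK.
- by move=> i; exact: glue_outK.
- move=> [i b] /= x; rewrite /glue_inv /glue_in.
  have hi : i != v := in_arrow_neq (existT (fun j => Q1 j v : Type) i b).
  have H bi bj (e : (v == v) = bj) m : bi = false ->
      @snk_map_at Y M u bi bj i v e b m (glue_in_at Y M bi i x)
      = glue_inv_at Y M bj v (u (dsum_in (M := fun b : in_arrow v => Y (tag b) : lmodType R)
          (existT (fun j => Q1 j v : Type) i b) x)).
    case: bi m => // m _; case: bj e m => e m /=; first by rewrite eq_axiomK.
    by rewrite eqxx in e.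
  exact: H (negbTE hi).
- move=> i j hi hj a x; rewrite /= /glue_in /away_arrow.
  have H bi bj (e : (j == v) = bj) (m : reflect_Q1_at v bi bj i j -> {linear Y i -> Y j}) ei ej :
      @snk_map_at Y M u bi bj i j e a m (glue_in_at Y M bi i x)
      = glue_in_at Y M bj j (m (@away_arrow_at bi bj i j ei ej a) x).
    case: bi m ei => // m ei; case: bj e m ej => // e m ej.
    by rewrite (eq_irrelevance ei erefl) (eq_irrelevance ej erefl).
  exact: H.
Defined.

End Reps.
End ReflectedArrows.

(** * Morphisms and exact sequences through presentations *)

Section PresentedReps.
Variables (R : pzRingType) (Q : quiver) (v : Q0 Q) (sink_v : sink v).
Local Notation Qv := (reflect_quiver v).
Implicit Types (Y Z : rep R Qv) (X : rep R Q) (M : fgmod R).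

(** Together with its converse [src_dec], this identifies morphisms of presented representations
    with a map at [v] and a family away from [v] that commute with [w] and [w']. *)
Lemma src_hom Z Z' Y Y' M M' (w : {linear M -> start_sum Y}) (w' : {linear M' -> start_sum Y'})
    (p : src_pres sink_v Z w) (p' : src_pres sink_v Z' w')
    (fv : {linear M -> M'}) (f : forall i, {linear Y i -> Y' i}) :
  is_ahom f -> (forall b x, f (tag b) (w x b) = w' (fv x) b) ->
  exists h : rhom Z Z', (forall x, h v (src_iv p x) = src_iv p' (fv x)) /\
    (forall i, i != v -> forall x, h i (src_i p i x) = src_i p' i (f i x)).
Proof.
move=> fa fw.
pose h := pick_at (lin_comp (src_iv p') (lin_comp fv (src_ov p)))
  (fun i => lin_comp (src_i p' i) (lin_comp (f i) (src_o p i))).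
have hv x : h v (src_iv p x) = src_iv p' (fv x) by rewrite /h pick_at_eq /= src_ivK.
have hi i : i != v -> forall x, h i (src_i p i x) = src_i p' i (f i x).
  by move=> iv x; rewrite /h pick_at_neq //= src_iK.
suff h_hom : is_rhom Z Z' h by exists (RHom h_hom).
apply: (is_rhom_reflect (sink_v := sink_v)) => [i j iv jv a x|b x].
  by rewrite -(src_oK p iv x) src_away !hi // src_away fa.
rewrite -(src_ovK p x) src_start hv hi ?src_start ?fw //.
exact: in_arrow_neq.
Qed.

Lemma src_dec Z Z' Y Y' M M' (w : {linear M -> start_sum Y}) (w' : {linear M' -> start_sum Y'})
    (p : src_pres sink_v Z w) (p' : src_pres sink_v Z' w') (h : rhom Z Z') :
  exists (fv : {linear M -> M'}) (f : forall i, {linear Y i -> Y' i}),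
  [/\ is_ahom f, forall b x, f (tag b) (w x b) = w' (fv x) b,
    forall x, h v (src_iv p x) = src_iv p' (fv x) &
    forall i, i != v -> forall x, h i (src_i p i x) = src_i p' i (f i x)].
Proof.
exists (lin_comp (src_ov p') (lin_comp (h v) (src_iv p))),
  (fun i => lin_comp (src_o p' i) (lin_comp (h i) (src_i p i))).
split=> [i j iv jv a x|b x|x|i iv x] /=.
- by rewrite -src_away rmorP -[in LHS](src_oK p' iv (h i _)) src_away src_iK.
- rewrite -src_start rmorP -[in LHS](src_ovK p' (h v _)) src_start src_iK //.
  exact: in_arrow_neq.
- by rewrite src_ovK.
- by rewrite src_oK.
Qed.

Lemma src_ext Z Y M (w : {linear M -> start_sum Y}) (p : src_pres sink_v Z w)
    (B : Q0 Q -> lmodType R) (f g : forall i, {linear Z i -> B i}) :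
  (forall x, f v (src_iv p x) = g v (src_iv p x)) ->
  (forall i, i != v -> forall x, f i (src_i p i x) = g i (src_i p i x)) ->
  forall i x, f i x = g i x.
Proof.
move=> ev e i x; have [iv|iv] := eqVneq i v.
  by subst i; rewrite -(src_ovK p x) ev.
by rewrite -(src_oK p iv x) e.
Qed.

Lemma is_rhom_sink X X' (f : forall i, {linear X i -> X' i}) :
  (forall i j (a : Q1 i j), i != v -> j != v ->
    forall x, f j (rep_map X a x) = rep_map X' a (f i x)) ->
  (forall (b : in_arrow v) x, f v (rep_map X (tagged b) x) = rep_map X' (tagged b) (f (tag b) x)) ->
  is_rhom X X' f.
Proof.
move=> fa fe i j a x.
have iv : i != v by apply/eqP=> iv; move: (a); rewrite iv; exact: sink_v.
have [jv|jv] := eqVneq j v; last exact: fa.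
by subst j; exact: fe (existT (fun i => Q1 i v : Type) i a) x.
Qed.

Lemma snk_hom X X' Y Y' M M' (u : {linear start_sum Y -> M}) (u' : {linear start_sum Y' -> M'})
    (p : snk_pres X u) (p' : snk_pres X' u')
    (fv : {linear M -> M'}) (f : forall i, {linear Y i -> Y' i}) :
  is_ahom f -> (forall x, fv (u x) = u' (start_sum_map f x)) ->
  exists h : rhom X X', (forall x, h v (snk_iv p x) = snk_iv p' (fv x)) /\
    (forall i, i != v -> forall x, h i (snk_i p i x) = snk_i p' i (f i x)).
Proof.
move=> fa fu.
pose h := pick_at (lin_comp (snk_iv p') (lin_comp fv (snk_ov p)))
  (fun i => lin_comp (snk_i p' i) (lin_comp (f i) (snk_o p i))).
have hv x : h v (snk_iv p x) = snk_iv p' (fv x) by rewrite /h pick_at_eq /= snk_ivK.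
have hi i : i != v -> forall x, h i (snk_i p i x) = snk_i p' i (f i x).
  by move=> iv x; rewrite /h pick_at_neq //= snk_iK.
suff h_hom : is_rhom X X' h by exists (RHom h_hom).
apply: is_rhom_sink => [i j a iv jv x|b x].
  by rewrite -(snk_oK p iv x) (snk_away p iv jv) !hi // (snk_away p' iv jv) fa.
have bv := in_arrow_neq sink_v b.
rewrite -(snk_oK p bv x) snk_end hv hi // snk_end fu; congr (snk_iv p' (u' _)).
apply/dsumP=> b'; rewrite dsumE; have [<-|ne] := eqVneq b b'; first by rewrite !dsum_in_eq.
by rewrite !dsum_in_neq // linear0.
Qed.

Lemma snk_dec X X' Y Y' M M' (u : {linear start_sum Y -> M}) (u' : {linear start_sum Y' -> M'})
    (p : snk_pres X u) (p' : snk_pres X' u') (h : rhom X X') :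
  exists (fv : {linear M -> M'}) (f : forall i, {linear Y i -> Y' i}),
  [/\ is_ahom f, forall x, fv (u x) = u' (start_sum_map f x),
    forall x, h v (snk_iv p x) = snk_iv p' (fv x) &
    forall i, i != v -> forall x, h i (snk_i p i x) = snk_i p' i (f i x)].
Proof.
exists (lin_comp (snk_ov p') (lin_comp (h v) (snk_iv p))),
  (fun i => lin_comp (snk_o p' i) (lin_comp (h i) (snk_i p i))).
split=> [i j iv jv a x|x|x|i iv x] /=.
- by rewrite -snk_away rmorP -[in LHS](snk_oK p' iv (h i _)) (snk_away p' iv jv) snk_iK.
- move: x; apply: (dsum_ext (f := lin_comp (lin_comp (snk_ov p') (lin_comp (h v) (snk_iv p))) u)
    (g := lin_comp u' (start_sum_map (fun i => lin_comp (snk_o p' i) (lin_comp (h i) (snk_i p i)))))) => b x.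
  have bv := in_arrow_neq sink_v b.
  rewrite /= -snk_end rmorP -(snk_oK p' bv (h _ _)) snk_end snk_ivK; congr (u' _).
  apply/dsumP=> b'; rewrite [RHS]dsumE; have [<-|ne] := eqVneq b b'; first by rewrite !dsum_in_eq.
  by rewrite !dsum_in_neq // linear0.
- by rewrite snk_ovK.
- by rewrite snk_oK.
Qed.

Lemma snk_ext X Y M (u : {linear start_sum Y -> M}) (p : snk_pres X u)
    (B : Q0 Q -> lmodType R) (f g : forall i, {linear X i -> B i}) :
  (forall x, f v (snk_iv p x) = g v (snk_iv p x)) ->
  (forall i, i != v -> forall x, f i (snk_i p i x) = g i (snk_i p i x)) ->
  forall i x, f i x = g i x.
Proof.
move=> ev e i x; have [iv|iv] := eqVneq i v.
  by subst i; rewrite -(snk_ovK p x) ev.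
by rewrite -(snk_oK p iv x) e.
Qed.

Definition short_exact (A B C : lmodType R) (i : {linear A -> B}) (q : {linear B -> C}) :=
  injective i /\ is_cokernel i q.

Lemma short_exact_transport (A B C A' B' C' : lmodType R)
    (i : {linear A -> B}) (q : {linear B -> C}) (i' : {linear A' -> B'}) (q' : {linear B' -> C'})
    (a : {linear A -> A'}) (a' : A' -> A) (b : {linear B -> B'}) (b' : B' -> B)
    (c : {linear C -> C'}) (c' : C' -> C) :
  cancel a' a -> cancel b b' -> cancel b' b -> cancel c c' -> cancel c' c ->
  (forall x, i' (a x) = b (i x)) -> (forall x, q' (b x) = c (q x)) ->
  short_exact i q -> short_exact i' q'.
Proof.
move=> aK' bK bK' cK cK' ia qb [iI [qS kerq]]; split.
  apply: linear_injP => x; rewrite -(aK' x) ia => /(injective0 (can_inj bK)).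
  by move=> /(injective0 iI) ->; rewrite linear0.
split=> [y|y].
  by have [x xP] := qS (c' y); exists (b x); rewrite qb xP.
rewrite -(bK' y) qb; split=> [/(injective0 (can_inj cK))/kerq[x <-]|[x]].
  by exists (a x).
rewrite -(aK' x) ia => /(can_inj bK) <-; have -> : q (i (a' x)) = 0 by apply/kerq; exists (a' x).
exact: linear0.
Qed.

Lemma src_exact A B C Y1 Y2 Y3 M1 M2 M3 (w1 : {linear M1 -> start_sum Y1})
    (w2 : {linear M2 -> start_sum Y2}) (w3 : {linear M3 -> start_sum Y3})
    (p1 : src_pres sink_v A w1) (p2 : src_pres sink_v B w2) (p3 : src_pres sink_v C w3)
    (i : rhom A B) (q : rhom B C) (fv : {linear M1 -> M2}) (gv : {linear M2 -> M3})
    (f : forall i, {linear Y1 i -> Y2 i}) (g : forall i, {linear Y2 i -> Y3 i}) :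
  (forall x, i v (src_iv p1 x) = src_iv p2 (fv x)) ->
  (forall j, j != v -> forall x, i j (src_i p1 j x) = src_i p2 j (f j x)) ->
  (forall x, q v (src_iv p2 x) = src_iv p3 (gv x)) ->
  (forall j, j != v -> forall x, q j (src_i p2 j x) = src_i p3 j (g j x)) ->
  short_exact fv gv -> (forall j, j != v -> short_exact (f j) (g j)) -> exact_seq i q.
Proof.
move=> iv ii qv qi exv ex j; have [jv|jv] := eqVneq j v.
  subst j; apply: short_exact_transport iv qv exv; [exact: src_ovK | exact: src_ivK
    | exact: src_ovK | exact: src_ivK | exact: src_ovK].
by apply: short_exact_transport (ii j jv) (qi j jv) (ex j jv);
  [exact: src_oK | exact: src_iK | exact: src_oK | exact: src_iK | exact: src_oK].
Qed.

Lemma snk_exact A B C Y1 Y2 Y3 M1 M2 M3 (u1 : {linear start_sum Y1 -> M1})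
    (u2 : {linear start_sum Y2 -> M2}) (u3 : {linear start_sum Y3 -> M3})
    (p1 : snk_pres A u1) (p2 : snk_pres B u2) (p3 : snk_pres C u3)
    (i : rhom A B) (q : rhom B C) (fv : {linear M1 -> M2}) (gv : {linear M2 -> M3})
    (f : forall i, {linear Y1 i -> Y2 i}) (g : forall i, {linear Y2 i -> Y3 i}) :
  (forall x, i v (snk_iv p1 x) = snk_iv p2 (fv x)) ->
  (forall j, j != v -> forall x, i j (snk_i p1 j x) = snk_i p2 j (f j x)) ->
  (forall x, q v (snk_iv p2 x) = snk_iv p3 (gv x)) ->
  (forall j, j != v -> forall x, q j (snk_i p2 j x) = snk_i p3 j (g j x)) ->
  short_exact fv gv -> (forall j, j != v -> short_exact (f j) (g j)) -> exact_seq i q.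
Proof.
move=> iv ii qv qi exv ex j; have [jv|jv] := eqVneq j v.
  subst j; apply: short_exact_transport iv qv exv; [exact: snk_ovK | exact: snk_ivK
    | exact: snk_ovK | exact: snk_ivK | exact: snk_ovK].
by apply: short_exact_transport (ii j jv) (qi j jv) (ex j jv);
  [exact: snk_oK | exact: snk_iK | exact: snk_oK | exact: snk_iK | exact: snk_oK].
Qed.

End PresentedReps.

Lemma dsum_map_exact (R : pzRingType) (I : finType) (A B C : I -> lmodType R)
    (f : forall i, {linear A i -> B i}) (g : forall i, {linear B i -> C i}) :
  (forall i, short_exact (f i) (g i)) -> short_exact (dsum_map f) (dsum_map g).
Proof.
move=> ex; split.
  apply: linear_injP => x x0; apply/dsumP=> i; rewrite dsum_zeroE.
  apply: injective0 (ex i).1 _.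
  by move/dsumP/(_ i): x0; rewrite dsumE dsum_zeroE.
split=> [y|y].
  have [x xP] := dependent_choice (fun i => (ex i).2.1 (y i)).
  by exists (dsum_of x); apply/dsumP=> i; rewrite !dsumE xP.
split=> [/dsumP y0|[x <-]].
  have [|x xP] := @dependent_choice I A (fun i x => f i x = y i).
    move=> i; apply/(ex i).2.2.
    by have := y0 i; rewrite dsumE dsum_zeroE.
  by exists (dsum_of x); apply/dsumP=> i; rewrite !dsumE xP.
by apply/dsumP=> i; rewrite [RHS]dsum_zeroE !dsumE; apply/(ex i).2.2; exists (x i).
Qed.

(** * The left adjoint of H and the projectives P_v(C) *)

Section StartProjectives.
Variables (R : pzRingType) (Q : quiver) (v : Q0 Q) (acQ : acyclic Q) (sink_v : sink v).
Local Notation Qv := (reflect_quiver v).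
Implicit Types (Y Z : rep R Qv) (X : rep R Q) (M C : fgmod R).

Let acQv : acyclic Qv := reflect_quiver_acyclic acQ.

Definition PP C : rep R Qv := rep_dsum (fun b : in_arrow v => @Prep R Qv (tag b) C).

(** The unit of the adjunction between [PP] and H: [c] goes to the trivial paths at the targets of
    the arrows leaving [v]. *)
Definition eta_fun C (c : C) : start_sum (PP C) :=
  dsum_of (M := fun b : in_arrow v => PP C (tag b) : lmodType R) (fun b =>
    dsum_of (M := fun b' : in_arrow v => @Prep R Qv (tag b') C (tag b) : lmodType R) (fun b' =>
      dsum_of (M := fun _ => C : lmodType R) (fun p' : @bpath Qv (tag b') (tag b) =>
        if (b' == b) && trivial_path p' then c else 0))).
Fact eta_linear C : linear (@eta_fun C).
Proof.
move=> a x y; apply/dsumP=> b; rewrite !(dsumE, dsum_addE, dsum_scaleE).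
apply/dsumP=> b'; rewrite !(dsumE, dsum_addE, dsum_scaleE).
apply/dsumP=> p; rewrite !(dsumE, dsum_addE, dsum_scaleE).
by case: ifP => _; rewrite ?scaler0 ?addr0.
Qed.
Definition eta C := Lin (@eta_linear C).

Lemma etaE C (c : C) b : eta C c b =
  dsum_in (M := fun b' : in_arrow v => @Prep R Qv (tag b') C (tag b) : lmodType R) b (@Prep_unit R Qv (tag b) C c).
Proof.
rewrite /= /eta_fun dsumE; apply/dsumP=> b'; rewrite dsumE.
have [->|ne] := eqVneq b' b; first by rewrite dsum_in_fun_eq.
by rewrite dsum_in_fun_neq 1?eq_sym //; apply/dsumP=> p; rewrite dsumE.
Qed.

Lemma PP_at_v C (x : PP C v) : x = 0.
Proof.
apply/dsumP=> b; apply/dsumP=> p; exfalso.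
exact: no_reflect_path_to (in_arrow_neq sink_v b) (tagged p).
Qed.

(** [PP C] is generated by the image of [eta], along paths that start outside [v] and never reach
    [v]; hence naturality away from [v] suffices. *)
Lemma PP_ext C (B : rep R Qv) (f g : forall i, {linear PP C i -> B i}) :
  is_ahom f -> is_ahom g ->
  (forall c b, f (tag b) (eta C c b) = g (tag b) (eta C c b)) ->
  forall i x, f i x = g i x.
Proof.
move=> fa ga fg i x; move: x.
apply: (dsum_ext (f := f i) (g := g i)) => b.
have lift (h : forall i, {linear PP C i -> B i}) : is_ahom h ->
    forall i j (a : @Q1 Qv i j), i != v -> j != v /\ forall x,
      lin_comp (h j) (rep_dsum_in_fun (fun b : in_arrow v => @Prep R Qv (tag b) C) b j)
        (rep_map (@Prep R Qv (tag b) C) a x)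
      = rep_map B a (lin_comp (h i) (rep_dsum_in_fun (fun b : in_arrow v => @Prep R Qv (tag b) C) b i) x).
  move=> ha; apply: (reflect_arrow_ind (sink_v := sink_v)) => [b'|k l hk hl a _]; first by rewrite eqxx.
  split=> // x; rewrite /= -ha; congr (h l _).
  exact: (@rep_dsum_in_hom R Qv _ (fun b : in_arrow v => @Prep R Qv (tag b) C)).
apply: (Prep_ext acQv (in_arrow_neq sink_v b) (lift f fa) (lift g ga)) => c.
by have := fg c b; rewrite etaE.
Qed.

Definition adj_at C Z (om : {linear C -> start_sum Z}) i : {linear PP C i -> Z i} :=
  Lin (dsum_copair (fun b : in_arrow v => @Prep_lift R Qv (tag b) C Z
    (lin_comp (dsum_proj (M := fun b : in_arrow v => Z (tag b) : lmodType R) b) om) i)).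

Fact adj_hom C Z (om : {linear C -> start_sum Z}) : is_rhom (PP C) Z (adj_at om).
Proof.
move=> i j a x; rewrite /= linear_sum; apply: eq_bigr => b _.
rewrite dsumE; exact: (@Prep_lift_hom R Qv acQv (tag b) C Z
  (lin_comp (dsum_proj (M := fun b : in_arrow v => Z (tag b) : lmodType R) b) om) i j a (x b)).
Qed.
Definition adj C Z om := RHom (@adj_hom C Z om).

Lemma adj_eta C Z (om : {linear C -> start_sum Z}) c b : adj om (tag b) (eta C c b) = om c b.
Proof.
rewrite etaE /= (bigD1 b) //= dsum_in_fun_eq big1 ?addr0 => [|b' ne].
  exact: Prep_lift_unit.
by rewrite dsum_in_fun_neq 1?eq_sym //; exact: (linear0 (Prep_lift _ _)).
Qed.

Lemma adj_uniq C Z (om : {linear C -> start_sum Z}) (f : forall i, {linear PP C i -> Z i}) :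
  is_ahom f -> (forall c b, f (tag b) (eta C c b) = om c b) -> forall i x, f i x = adj om i x.
Proof.
move=> fa fe; apply: PP_ext => //; first exact: rhom_ahom.
by move=> c b; rewrite fe adj_eta.
Qed.

Definition PPmap_at C C' (k : {linear C -> C'}) i : {linear PP C i -> PP C' i} :=
  dsum_map (fun b : in_arrow v => dsum_map (fun _ : @bpath Qv (tag b) i => k)).
Fact PPmap_hom C C' (k : {linear C -> C'}) : is_rhom (PP C) (PP C') (PPmap_at k).
Proof.
move=> i j a x; apply/dsumP=> b; rewrite !dsumE; apply/dsumP=> q; rewrite !dsumE linear_sum.
by apply: eq_bigr => p _; rewrite !dsumE.
Qed.
Definition PPmap C C' (k : {linear C -> C'}) := RHom (PPmap_hom k).

Lemma PPmap_eta C C' (k : {linear C -> C'}) c b : PPmap k (tag b) (eta C c b) = eta C' (k c) b.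
Proof.
apply/dsumP=> b'; apply/dsumP=> p; rewrite !dsumE.
by case: ifP; rewrite ?linear0.
Qed.

Lemma PPmap_exact (A B C : fgmod R) (i : {linear A -> B}) (q : {linear B -> C}) :
  short_exact i q -> exact_seq (PPmap i) (PPmap q).
Proof. by move=> ex x; apply: dsum_map_exact => b; apply: dsum_map_exact. Qed.

Lemma PP_projective C : projective_module C -> projective_rep (PP C).
Proof. by move=> pC; apply: rep_dsum_projective => b; exact: Prep_projective. Qed.

(* P_v(C), with the summands of the nontrivial paths indexed by first arrow and remainder. *)
Definition WW C : rep R Qv := src (eta C).
Definition WW_pres C : src_pres sink_v (WW C) (eta C) := src_presP sink_v (eta C).

Lemma WW_lift C Z (s : {linear C -> Z v}) : exists h : rhom (WW C) Z,
  (forall x, h v (src_iv (WW_pres C) x) = s x) /\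
  (forall i, i != v -> forall x, h i (src_i (WW_pres C) i x)
     = adj (lin_comp (start_map sink_v Z) s) i x).
Proof.
apply: (src_hom (WW_pres C) (src_pres_self sink_v Z) (fv := s)
  (f := rmor (adj (lin_comp (start_map sink_v Z) s)))) => [|b x].
  exact: rhom_ahom.
by rewrite adj_eta.
Qed.

Lemma WW_ext C Z (f g : rhom (WW C) Z) :
  (forall x, f v (src_iv (WW_pres C) x) = g v (src_iv (WW_pres C) x)) -> forall i x, f i x = g i x.
Proof.
move=> e; apply: (src_ext (p := WW_pres C)) => // i hi x.
pose q := WW_pres C; pose s := src_pres_self sink_v Z.
have [fv [f0 [fa fc fvP fP]]] := src_dec q s f.
have [gv [g0 [ga gc gvP gP]]] := src_dec q s g.
rewrite fP // gP //; congr (src_i s i _); apply: PP_ext => // c b.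
rewrite fc gc; congr (start_map sink_v Z _ b).
by move: (e c); rewrite fvP gvP.
Qed.

Lemma WW_projective C : projective_module C -> projective_rep (WW C).
Proof.
move=> pC A B g f gS.
have [s sP] := pC _ _ (g v) (lin_comp (f v) (src_iv (WW_pres C))) (gS v).
have [h [hv _]] := WW_lift s; exists h.
by apply: (WW_ext (f := rhom_comp g h)) => x; rewrite /= hv sP.
Qed.

Lemma WW_linked (A B C : fgmod R) (i : {linear A -> B}) (q : {linear B -> C}) :
  projective_module B -> short_exact i q -> linked (WW A) (WW C).
Proof.
move=> pB ex.
have map M M' (k : {linear M -> M'}) : exists h : rhom (WW M) (WW M'),
    (forall x, h v (src_iv (WW_pres M) x) = src_iv (WW_pres M') (k x)) /\
    (forall i, i != v -> forall x, h i (src_i (WW_pres M) i x) = src_i (WW_pres M') i (PPmap k i x)).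
  by apply: (src_hom (WW_pres M) (WW_pres M') (fv := k) (f := rmor (PPmap k))) => [|b x]; [exact: rhom_ahom | exact: PPmap_eta].
have [i' [iv ii]] := map _ _ i; have [q' [qv qi]] := map _ _ q.
exists (WW B), i', q'; split; first exact: WW_projective.
by apply: (src_exact iv ii qv qi ex) => j _; exact: PPmap_exact.
Qed.

Lemma PP_linked (A B C : fgmod R) (i : {linear A -> B}) (q : {linear B -> C}) :
  projective_module B -> short_exact i q -> linked (PP A) (PP C).
Proof.
move=> pB ex; exists (PP B), (PPmap i), (PPmap q); split; first exact: PP_projective.
exact: PPmap_exact.
Qed.

Section ReflectPres.
Variables (X : rep R Q) (c : object_choice v X).

Definition reflect_fam : rep R Qv := rep_sum (away v X) (PP (oc_C c)).

Definition reflect_w : {linear oc_Omega c -> start_sum reflect_fam} :=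
  Lin (dsum_glue (M := fun b : in_arrow v => reflect_fam (tag b) : lmodType R)
    (fun b => Lin (@reflect_start_linear R Q v X c b))).

Lemma reflect_wE x b : reflect_w x b = (oc_k c x b, eta (oc_C c) (oc_sigma c x) b).
Proof. by rewrite dsumE /= /eta_fun dsumE. Qed.

(** The match inside [reflect_map] with its booleans as variables, so that cases can be split before
    the types are fixed. *)
Let reflect_map_at bi bj i j (a : reflect_Q1_at v bi bj i j)
    (m : {linear reflect_fam i -> reflect_fam j}) :
    {linear reflect_mod_at c bi i -> reflect_mod_at c bj j} :=
  match bi, bj return reflect_Q1_at v bi bj i j -> {linear reflect_fam i -> reflect_fam j} ->
    {linear reflect_mod_at c bi i -> reflect_mod_at c bj j} with
  | true, false => fun b _ => Lin (@reflect_start_linear R Q v X c (existT _ j b))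
  | false, false => fun _ m => m
  | _, true => fun b => match b with end
  end a m.

Lemma reflect_rep_start b x :
  rep_map (reflect_rep c) (start_arrow sink_v b) (glue_inv v reflect_fam (oc_Omega c) x) =
  glue_in v reflect_fam (oc_Omega c) (tag b) (reflect_w x b).
Proof.
rewrite [reflect_w x b]dsumE; case: b => j b.
have H bi bj (ei : bi = true) (ej : bj = false) i m :
    reflect_map_at (start_arrow_at i ei ej b) m (glue_inv_at reflect_fam (oc_Omega c) bi i x)
    = glue_in_at reflect_fam (oc_Omega c) bj j (reflect_start_fun (existT _ j b) x).
  case: bi ei => // ei; case: bj ej => // ej.
  by rewrite (eq_irrelevance ei erefl) (eq_irrelevance ej erefl).
exact: H.
Qed.

Lemma reflect_rep_away i j hi hj a x :
  rep_map (reflect_rep c) (@away_arrow Q v i j hi hj a) (glue_in v reflect_fam (oc_Omega c) i x) =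
  glue_in v reflect_fam (oc_Omega c) j (rep_map reflect_fam (away_arrow hi hj a) x).
Proof.
have H bi bj (ei : bi = false) (ej : bj = false) m :
    reflect_map_at (away_arrow_at v ei ej a) m (glue_in_at reflect_fam (oc_Omega c) bi i x)
    = glue_in_at reflect_fam (oc_Omega c) bj j (m x).
  by case: bi ei => // ei; case: bj ej.
exact: H.
Qed.

Definition reflect_pres : src_pres sink_v (reflect_rep c) reflect_w :=
  @SrcPres Q v sink_v R (reflect_rep c) reflect_fam (oc_Omega c) reflect_w
    (glue_inv v reflect_fam (oc_Omega c)) (glue_outv v reflect_fam (oc_Omega c))
    (glue_in v reflect_fam (oc_Omega c)) (glue_out v reflect_fam (oc_Omega c))
    (@glue_invK _ _ _ _ _) (@glue_outvK _ _ _ _ _) (@glue_inK _ _ _ _ _) (@glue_outK _ _ _ _ _)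
    reflect_rep_start reflect_rep_away.
End ReflectPres.

Section ReflectMor.
Variables (X X' : rep R Q) (c : object_choice v X) (c' : object_choice v X') (f : rhom X X').
Variable m : morphism_choice c c' f.

Lemma reflect_mor_v x :
  reflect_mor m v (src_iv (reflect_pres c) x) = src_iv (reflect_pres c') (mc_Omega m x).
Proof.
have H b i : b = true ->
    (match b return {linear reflect_mod_at c b i -> reflect_mod_at c' b i} with
     | true => mc_Omega m | false => Lin (@reflect_mor_off_linear R Q v X X' c c' f m i) end)
    (glue_inv_at (reflect_fam c) (oc_Omega c) b i x)
    = glue_inv_at (reflect_fam c') (oc_Omega c') b i (mc_Omega m x) by case: b.
exact: H (eqxx v).
Qed.

Lemma reflect_mor_off i (hi : i != v) x :
  reflect_mor m i (src_i (reflect_pres c) i x) = src_i (reflect_pres c') i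
    ((f i x.1 + adj (Z := away v X') (mc_omega m) i x.2, PPmap (mc_C m) i x.2) : reflect_fam c' i).
Proof.
have H b : b = false ->
    (match b return {linear reflect_mod_at c b i -> reflect_mod_at c' b i} with
     | true => mc_Omega m | false => Lin (@reflect_mor_off_linear R Q v X X' c c' f m i) end)
    (glue_in_at (reflect_fam c) (oc_Omega c) b i x)
    = glue_in_at (reflect_fam c') (oc_Omega c') b i
      ((f i x.1 + adj (Z := away v X') (mc_omega m) i x.2, PPmap (mc_C m) i x.2) : reflect_fam c' i).
  by case: b.
exact: H (negbTE hi).
Qed.
End ReflectMor.

End StartProjectives.

(** * Reflected objects *)

Section ReflectedProjectives.
Variables (R : pzRingType) (Q : quiver) (v : Q0 Q) (acQ : acyclic Q) (sink_v : sink v).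
Local Notation Qv := (reflect_quiver v).
Implicit Types (Y Z : rep R Qv) (X : rep R Q) (M C : fgmod R).

Definition zero_fg : fgmod R := fg_dsum (fun u : void => match u return fgmod R with end).
Lemma zero_fgP (x : zero_fg) : x = 0.
Proof. by apply/dsumP=> -[]. Qed.

Definition src0 Y : rep R Qv := src (lin_zero zero_fg (start_sum Y)).
Definition src0_pres Y : src_pres sink_v (src0 Y) _ := src_presP sink_v _.
Definition snk0 Y : rep R Q := snk (lin_zero (start_sum Y) zero_fg).
Definition snk0_pres Y : snk_pres (snk0 Y) _ := snk_presP sink_v _.
Definition rep_zero_v : rep R Qv := rep_zero R Qv.
Definition at_sink M : rep R Q := snk (lin_zero (start_sum rep_zero_v) M).
Definition at_sink_pres M : snk_pres (at_sink M) _ := snk_presP sink_v _.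

Lemma rep_zero_v_eq0 i (x : rep_zero_v i) : x = 0.
Proof. by apply/dsumP=> -[]. Qed.

(** Projectivity of the restriction of [Y] to the vertices other than [v], expressed without forming
    that quiver. *)
Definition away_projective Y := forall (A B : rep R Qv) (g : rhom A B)
  (f : forall i, {linear Y i -> B i}), is_ahom f -> (forall i, surjective_map (g i)) ->
  exists h : forall i, {linear Y i -> A i}, is_ahom h /\
    forall i, i != v -> forall x, g i (h i x) = f i x.

Lemma PP_ahom_rhom C Z (f : forall i, {linear PP v C i -> Z i}) : is_ahom f -> is_rhom (PP v C) Z f.
Proof.
move=> fa; apply: (is_rhom_reflect (sink_v := sink_v)) => // b x.
by rewrite (PP_at_v sink_v x) !linear0.
Qed.

Lemma PP_away_projective C : projective_module C -> away_projective (PP v C).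
Proof.
move=> pC A B g f fa gS.
have [h hP] := @PP_projective R Q v acQ C pC A B g (RHom (PP_ahom_rhom fa)) gS.
by exists h; split=> [|i _ x]; [exact: rhom_ahom | exact: hP].
Qed.

Lemma away_projective_sum Y Y' :
  away_projective Y -> away_projective Y' -> away_projective (rep_sum Y Y').
Proof.
move=> pY pY' A B g f fa gS.
have [|h [ha hP]] := pY A B g (fun i => lin_comp (f i) lin_inl) _ gS.
  move=> i j hi hj a x; rewrite /= -fa; congr (f j _).
  by rewrite /= /prod_map_fun /= linear0.
have [|h' [ha' hP']] := pY' A B g (fun i => lin_comp (f i) lin_inr) _ gS.
  move=> i j hi hj a x; rewrite /= -fa; congr (f j _).
  by rewrite /= /prod_map_fun /= linear0.
exists (fun i => lin_copair (h i) (h' i)); split=> [i j hi hj a x|i hi [x y]] /=.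
  by rewrite linearD ha ha'.
rewrite linearD hP // hP' //= -linearD; congr (f i _).
by rewrite [LHS]surjective_pairing /= addr0 add0r.
Qed.

(** Restriction away from [v] is left adjoint to [snk0], extension by zero at the sink, which
    preserves epimorphisms. *)
Lemma projective_away_projective (P : rep R Q) : projective_rep P -> away_projective (away v P).
Proof.
move=> pP A B g f fa gS.
have [||gs [gsv gsi]] := snk_hom sink_v (snk0_pres A) (snk0_pres B) (fv := lin_id _) (f := rmor g).
- exact: rhom_ahom.
- by [].
have gsS i : surjective_map (gs i).
  move=> y; have [iv|hi] := eqVneq i v.
    subst i; exists 0; rewrite linear0 -(snk_ovK (snk0_pres B) y).
    by rewrite (zero_fgP (snk_ov _ _)) linear0.
  have [x xP] := gS i (snk_o (snk0_pres B) i y).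
  by exists (snk_i (snk0_pres A) i x); rewrite gsi // xP snk_oK.
have [||f1 [f1v f1i]] := snk_hom sink_v (snk_pres_self v P) (snk0_pres B)
  (fv := lin_zero _ _) (f := f).
- exact: fa.
- by [].
have [h hP] := pP _ _ gs f1 gsS.
have [hv [h0 [h0a _ _ h0P]]] := snk_dec sink_v (snk_pres_self v P) (snk0_pres A) h.
exists h0; split=> // i hi x.
apply: (can_inj (snk_iK (snk0_pres B) hi)).
by rewrite -gsi // -h0P // hP -f1i.
Qed.

(** Extension by zero at the source [v] is left adjoint to restriction away from [v]. *)
Lemma src_trivial_projective Z Y M (w : {linear M -> start_sum Y}) (p : src_pres sink_v Z w) :
  (forall x : M, x = 0) -> away_projective Y -> projective_rep Z.
Proof.
move=> M0 pY A B g f gS.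
have [fv [f0 [f0a _ _ f0P]]] := src_dec p (src_pres_self sink_v B) f.
have [h0 [h0a h0P]] := pY A B g f0 f0a gS.
have [||h [hv hi]] := src_hom p (src_pres_self sink_v A) (fv := lin_zero _ _) (f := h0).
- exact: h0a.
- by move=> b x; rewrite (M0 x) !linear0 !dsum_zeroE linear0.
exists h; apply: (src_ext (p := p) (f := rmor (rhom_comp g h)) (g := rmor f)) => [x|i ij x].
  by rewrite (M0 x) !linear0.
by rewrite /= hi //= h0P // f0P.
Qed.

(** Since no arrow leaves the sink, [at_sink M] is P_v(M). *)
Lemma at_sink_projective M : projective_module M -> projective_rep (at_sink M).
Proof.
move=> pM A B g f gS.
have [fv [f0 [_ _ fvP _]]] := snk_dec sink_v (at_sink_pres M) (snk_pres_self v B) f.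
have [hv hvP] := pM _ _ (g v) fv (gS v).
have [||h [hP hi]] := snk_hom sink_v (at_sink_pres M) (snk_pres_self v A) (fv := hv)
  (f := fun i => lin_zero _ _).
- by move=> i j hi hj a x; rewrite /= linear0.
- move=> x; rewrite [LHS]linear0 [X in in_map A v X](_ : _ = 0) ?linear0 //.
exists h; apply: (snk_ext (p := at_sink_pres M) (f := rmor (rhom_comp g h)) (g := rmor f)) => [x|i hj x].
  by rewrite /= hP /= hvP fvP.
by rewrite (rep_zero_v_eq0 x) !linear0.
Qed.

(** The functor sending T to (T, H T, id) is left adjoint to the one that keeps [A] away from [v]
    and places the sum of the modules entering [v] at the source; the latter preserves
    epimorphisms. *)
Lemma snk_start_sum_projective (T : rep R Qv) : projective_rep T -> projective_rep (snk (lin_id (start_sum T))).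
Proof.
move=> pT A B g f gS.
pose p := snk_presP sink_v (lin_id (start_sum T)).
have [fv [f0 [f0a fc fvP fP]]] := snk_dec sink_v p (snk_pres_self v B) f.
pose pr X := src_presP sink_v (lin_id (start_sum (away v X))).
have [||k [kv ki]] := src_hom (pr A) (pr B) (fv := @start_sum_map Q v R (away v A) (away v B) g) (f := rmor g).
- by move=> i j hi hj a x; rewrite !away_map_away rmorP.
- by move=> b x; rewrite dsumE.
have kS i : surjective_map (k i).
  move=> y; have [iv|hi] := eqVneq i v; last first.
    have [x xP] := gS i (src_o (pr B) i y); exists (src_i (pr A) i x).
    by rewrite ki // xP src_oK.
  subst i.
  have [x xP] := dependent_choice (fun b : in_arrow v => gS (tag b) (src_ov (pr B) y b)).
  exists (src_iv (pr A) (dsum_of x)); rewrite kv -[RHS](src_ovK (pr B)); congr (src_iv _ _).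
  by apply/dsumP=> b; rewrite !dsumE xP.
have [||f1 [f1v f1i]] := src_hom (src_pres_self sink_v T) (pr B)
  (fv := lin_comp (start_sum_map f0) (start_map sink_v T)) (f := f0).
- exact: f0a.
- by move=> b x; rewrite [RHS]dsumE.
have [l lP] := pT _ _ k f1 kS.
have [lv [l0 [l0a lc lvP l0P]]] := src_dec (src_pres_self sink_v T) (pr A) l.
have gl i (hi : i != v) x : g i (l0 i x) = f0 i x.
  apply: (can_inj (src_iK (pr B) hi)).
  by rewrite -ki // -l0P // lP f1i.
have [||h [hv hi]] := snk_hom sink_v p (snk_pres_self v A)
  (fv := lin_comp (in_map A v) (start_sum_map l0)) (f := l0).
- exact: l0a.
- by [].
exists h; apply: (snk_ext (p := p) (f := rmor (rhom_comp g h)) (g := rmor f)) => [x|i ij x].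
  rewrite /= hv fvP [fv x]fc [LHS]/= -[LHS]in_map_mor; congr (in_map B v _).
  by apply/dsumP=> b; rewrite !dsumE; apply: gl; exact: in_arrow_neq.
by rewrite /= hi // fP //= gl.
Qed.

(** Taking the cokernel of [in_map] at the sink is left adjoint to the exact functor [at_sink]. *)
Lemma sink_cokernel_projective (P : rep R Q) C (pi : {linear P v -> C}) :
  projective_rep P -> is_cokernel (in_map P v) pi -> projective_module C.
Proof.
move=> pP [piS piP] M N g f gS.
have [||gs [gsv gsi]] := snk_hom sink_v (at_sink_pres M) (at_sink_pres N) (fv := g)
  (f := fun i => lin_id _).
- by [].
- by move=> x; rewrite /= linear0.
have gsS i : surjective_map (gs i).
  move=> y; have [iv|hi] := eqVneq i v.
    subst i; have [x xP] := gS (snk_ov (at_sink_pres N) y).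
    by exists (snk_iv (at_sink_pres M) x); rewrite gsv xP snk_ovK.
  by exists 0; rewrite linear0 -(snk_oK (at_sink_pres N) hi y) (rep_zero_v_eq0 (snk_o _ _ _)) linear0.
have [||f1 [f1v f1i]] := snk_hom sink_v (snk_pres_self v P) (at_sink_pres N)
  (fv := lin_comp f pi) (f := fun i => lin_zero _ _).
- by [].
- by move=> x; rewrite /= (_ : pi _ = 0) ?linear0 //; apply/piP; exists x.
have [h hP] := pP _ _ gs f1 gsS.
have [hv [h0 [_ hc hvP _]]] := snk_dec sink_v (snk_pres_self v P) (at_sink_pres M) h.
have [|k kP] := lin_factor_surj (p := pi) (g := hv) piS.
  by move=> x /piP[y <-]; exact: hc.
exists k => y; have [x <-] := piS y; rewrite kP.
apply: (can_inj (snk_ivK (at_sink_pres N))).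
by rewrite -gsv -hvP hP f1v.
Qed.

(** The cokernel at the sink is projective, so its projective cover is an isomorphism and Omega
    vanishes; what remains is an extension by zero at the source. *)
Lemma reflect_projective (P : rep R Q) (c : object_choice v P) :
  projective_rep P -> projective_rep (reflect_rep c).
Proof.
move=> pP; have pbar := sink_cokernel_projective pP (oc_piP c).
have [pC dS ess] := oc_deltaP c.
have [s sP] := projective_split pbar dS.
have sS : surjective_map s by apply: ess => y; exists y; rewrite /= sP.
have Om0 (x : oc_Omega c) : x = 0.
  apply: (injective0 (oc_sigmaP c).1).
  have : oc_delta c (oc_sigma c x) = 0 by apply/(oc_sigmaP c).2; exists x.
  have [y <-] := sS (oc_sigma c x); rewrite sP => ->; exact: linear0.
apply: (src_trivial_projective (reflect_pres sink_v c)) => //.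
apply: away_projective_sum; first exact: projective_away_projective.
exact: PP_away_projective.
Qed.

(** The snake lemma: injectivity of [in_map X' v] kills the connecting map, so the cokernels at the
    sink still form a short exact sequence. *)
Lemma cokernel_linked (X X' : rep R Q) C (pi : {linear X v -> C}) :
  sepmono X' -> linked X X' -> is_cokernel (in_map X v) pi ->
  exists (P C' : fgmod R) (pi' : {linear X' v -> C'}) (i : {linear C -> P}) (q : {linear P -> C'}),
    [/\ projective_module P, is_cokernel (in_map X' v) pi' & short_exact i q].
Proof.
move=> smX' [P [i [q [pP ex]]]] [piS piP].
have [CP [piP' [PS PP]]] := cokernel_exists (in_map P v).
have [C' [pi' [pS' pP']]] := cokernel_exists (in_map X' v).
have [|i' iP'] := lin_factor_surj (p := pi) (g := lin_comp piP' (i v)) piS.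
  by move=> x /piP[y <-] /=; apply/PP; exists (in_sum_mor i v y); rewrite in_map_mor.
have [|q' qP'] := lin_factor_surj (p := piP') (g := lin_comp pi' (q v)) PS.
  by move=> x /PP[y <-] /=; apply/pP'; exists (in_sum_mor q v y); rewrite in_map_mor.
have [mI [mS mk]] : short_exact (in_sum_mor i v) (in_sum_mor q v).
  by apply: dsum_map_exact => b; exact: ex.
have [qvS qvk] := (ex v).2.
exists CP, C', pi', i', q'; split=> //; first exact: (sink_cokernel_projective (pi := piP') pP).
split.
  apply: linear_injP => c; have [x <-] := piS c; rewrite iP' => /PP[y yP].
  have /mk[y' y'P] : in_sum_mor q v y = 0.
    apply: (injective0 (@smX' v)); rewrite in_map_mor yP; exact: exact_comp0.
  apply/piP; exists y'; apply: (ex v).1.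
  by rewrite -in_map_mor y'P yP.
split=> [c|c].
  have [x <-] := pS' c; have [y <-] := qvS x.
  by exists (piP' y); rewrite qP'.
have [p <-] := PS c; rewrite qP' /=; split=> [/pP'[y']|[c']].
  have [y <-] := mS y'; rewrite in_map_mor => e.
  have /qvk[x xP] : q v (p - in_map P v y) = 0 by rewrite linearB e subrr.
  exists (pi x); rewrite iP' /= xP linearB (_ : piP' (in_map P v y) = 0) ?subr0 //.
  by apply/PP; exists y.
have [x <-] := piS c'; rewrite iP' /= => e; apply/pP'.
have /PP[y yP] : piP' (p - i v x) = 0 by rewrite linearB e subrr.
exists (in_sum_mor q v y); rewrite in_map_mor yP linearB exact_comp0 ?subr0 //.
Qed.

Hypothesis injR : selfinjective R.

Lemma src0_coresolved X : coresolved X -> coresolved (src0 (away v X)).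
Proof.
move=> cX; apply: (coresolved_image (Phi := fun X Z => Z = src0 (away v X))) cX (erefl _).
move=> X1 X2 _ _ _ [P [i [q [pP ex]]]] ->; exists (src0 (away v X2)) => //.
have map (A B : rep R Q) (f : rhom A B) : exists h : rhom (src0 (away v A)) (src0 (away v B)),
    (forall x, h v (src_iv (src0_pres (away v A)) x) = src_iv (src0_pres (away v B)) (lin_id _ x)) /\
    (forall i, i != v -> forall x,
      h i (src_i (src0_pres (away v A)) i x) = src_i (src0_pres (away v B)) i (f i x)).
  apply: (src_hom (src0_pres (away v A)) (src0_pres (away v B)) (fv := lin_id _) (f := rmor f)) => [k j hk hj a x|b x]; first by rewrite !away_map_away rmorP.
  by rewrite !dsum_zeroE linear0.
have [i' [iv ii]] := map _ _ i; have [q' [qv qi]] := map _ _ q.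
exists (src0 (away v P)), i', q'; split.
  apply: (src_trivial_projective (src0_pres _)); first exact: zero_fgP.
  exact: projective_away_projective.
apply: (src_exact iv ii qv qi) => [|j _]; last exact: ex.
split; first by move=> x y; rewrite (zero_fgP x) (zero_fgP y).
split=> [y|y]; first by exists y.
by rewrite (zero_fgP y); split=> // _; exists 0.
Qed.

(** A coresolution of [X] coresolves its cokernel at the sink, and [F], in use [PP] or [WW], carries
    this to Q(v). *)
Lemma cokernel_coresolved (F : fgmod R -> rep R Qv) X C (pi : {linear X v -> C}) :
  (forall (A B C : fgmod R) (i : {linear A -> B}) (q : {linear B -> C}),
    projective_module B -> short_exact i q -> linked (F A) (F C)) ->
  coresolved X -> is_cokernel (in_map X v) pi -> coresolved (F C).
Proof.
move=> FP cX piP.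
apply: (coresolved_image (Phi := fun X Z => exists C (pi : {linear X v -> C}),
  is_cokernel (in_map X v) pi /\ Z = F C)) cX _; last by exists C, pi.
move=> X1 X2 _ _ cX2 X12 [C1 [pi1 [pi1P ->]]].
have [P [C2 [pi2 [i [q [pP pi2P ex]]]]]] :=
  cokernel_linked (coresolved_sepmono acQ cX2) X12 pi1P.
by exists (F C2); [exact: FP pP ex | exists C2, pi2].
Qed.

(** X(v) is built by two extensions. It contains [src0 (away v X)] with quotient [src w2], the
    representation given by Omega -> H PP(C); and [src w2] contains [WW v Om] with quotient
    [PP v (oc_bar c)]. *)
Lemma reflect_coresolved X (c : object_choice v X) : coresolved X -> coresolved (reflect_rep c).
Proof.
move=> cX; set C := oc_C c; set Om := oc_Omega c.
have [pC dS _] := oc_deltaP c.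
have exO : short_exact (oc_sigma c) (oc_delta c) by split; [exact: (oc_sigmaP c).1
  | split=> //; exact: (oc_sigmaP c).2].
have cPP : coresolved (PP v (oc_bar c)).
  by apply: (cokernel_coresolved _ cX (oc_piP c)) => A B D i q; exact: PP_linked.
(* The projective cover of [oc_bar c] makes [WW v Om] a syzygy of [WW v (oc_bar c)]. *)
have cWO : coresolved (WW v Om).
  apply: (coresolved_cons (WW_linked acQ sink_v pC exO)).
  by apply: (cokernel_coresolved _ cX (oc_piP c)) => A B D i q; exact: WW_linked.
pose w2 : {linear Om -> start_sum (PP v C)} := lin_comp (eta v C) (oc_sigma c).
pose p2 := src_presP sink_v w2.
have acQv := reflect_quiver_acyclic (v := v) acQ.
have c2 : coresolved (src w2).
  have [||i [iv ii]] := src_hom (WW_pres sink_v Om) p2 (fv := lin_id _)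
    (f := rmor (PPmap v (oc_sigma c))).
  - exact: rhom_ahom.
  - by move=> b x; exact: PPmap_eta.
  have [||q [qv qi]] := src_hom p2 (src_pres_self sink_v (PP v (oc_bar c))) (fv := lin_zero _ _)
    (f := rmor (PPmap v (oc_delta c))).
  - exact: rhom_ahom.
  - move=> b x; rewrite PPmap_eta (_ : oc_delta c (oc_sigma c x) = 0).
      by rewrite !linear0 !dsum_zeroE.
    by apply/(oc_sigmaP c).2; exists x.
  apply: (coresolved_extension injR acQv (i := i) (q := q)) => //.
  apply: (src_exact iv ii qv qi) => [|j _]; last exact: PPmap_exact.
  split=> //; split=> [y|y]; first by exists 0; rewrite (PP_at_v sink_v y).
  by split=> // _; exists y.
have [||i [iv ii]] := src_hom (src0_pres (away v X)) (reflect_pres sink_v c) (fv := lin_zero _ _)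
    (f := fun i => lin_inl).
- move=> i j hi hj a x; rewrite /= /prod_map_fun /=; congr (_, _).
  exact: esym (linear0 (rep_map (PP v C) (away_arrow hi hj a))).
- by move=> b x; rewrite !dsum_zeroE !linear0 dsum_zeroE.
have [||q [qv qi]] := src_hom (reflect_pres sink_v c) p2 (fv := lin_id _) (f := fun i => lin_snd).
- by [].
- by move=> b x; rewrite reflect_wE.
apply: (coresolved_extension injR acQv (i := i) (q := q)) => //.
  apply: (src_exact iv ii qv qi) => [|j _].
    split; first by move=> x y _; rewrite (zero_fgP x) (zero_fgP y).
    split=> [y|y]; first by exists y.
    by split=> [/= ->|[x <-]] //; exists 0.
  split; first by move=> x y [].
  split=> [y|[y y']]; first by exists (0, y).
  by split=> [/= ->|[x [_ <-]]] //; exists y.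
exact: src0_coresolved.
Qed.

End ReflectedProjectives.

(** * The reflection functor *)

Lemma lprod_subE (R : pzRingType) (U V : lmodType R) (a a' : U) (b b' : V) :
  (a, b) - (a', b') = (a - a', b - b') :> lprod U V.
Proof. by []. Qed.

Section RhomSub.
Variables (R : pzRingType) (Q : quiver) (X Y : rep R Q).
Fact rhom_sub_hom (f g : rhom X Y) : is_rhom X Y (fun i => lin_add (f i) (lin_opp (g i))).
Proof. by move=> i j a x; rewrite /= !rmorP linearB. Qed.
Definition rhom_sub f g := RHom (rhom_sub_hom f g).
End RhomSub.

Section ReflectionFunctor.
Variables (R : pzRingType) (Q : quiver) (v : Q0 Q) (acQ : acyclic Q) (sink_v : sink v).
Local Notation Qv := (reflect_quiver v).
Implicit Types (X Y : rep R Q) (C : fgmod R).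

Lemma object_choice_exists X : kernels_fg R ->
  (forall M : fgmod R, exists (C : fgmod R) (d : {linear C -> M}), projective_cover d) ->
  injective (in_map X v) -> inhabited (object_choice v X).
Proof.
move=> kerR covR inX.
have [B [pi piP]] := cokernel_exists (in_map X v).
have [C [d dP]] := covR B.
have [Om [s sP]] := kerR _ _ d.
have [pC _ _] := dP; have [t tP] := pC _ _ pi d piP.1.
have [|k kP] := lin_factor_inj (u := in_map X v) (g := lin_comp t s) inX.
  by move=> x; apply/piP.2; rewrite /= tP; apply/sP.2; exists x.
split; exact: (ObjectChoice piP dP sP tP kP).
Qed.

Lemma morphism_choice_exists X Y (cX : object_choice v X) (cY : object_choice v Y) (f : rhom X Y) :
  injective (in_map Y v) -> inhabited (morphism_choice cX cY f).
Proof.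
move=> inY; have [piS piP] := oc_piP cX; have [piS' piP'] := oc_piP cY.
have [|bar barP] := lin_factor_surj (p := oc_pi cX) (g := lin_comp (oc_pi cY) (f v)) piS.
  by move=> x /piP[y <-]; apply/piP'; exists (in_sum_mor f v y); rewrite in_map_mor.
have [pC _ _] := oc_deltaP cX; have [_ dS' _] := oc_deltaP cY.
have [C CP] := pC _ _ (oc_delta cY) (lin_comp bar (oc_delta cX)) dS'.
have [|Om OmP] := lin_factor_inj (u := oc_sigma cY) (g := lin_comp C (oc_sigma cX)) (oc_sigmaP cY).1.
  move=> x; apply/(oc_sigmaP cY).2; rewrite /= CP /= (_ : oc_delta cX _ = 0) ?linear0 //.
  by apply/(oc_sigmaP cX).2; exists x.
have [|om omP] := lin_factor_inj (u := in_map Y v)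
    (g := lin_add (lin_comp (oc_t cY) C) (lin_opp (lin_comp (f v) (oc_t cX)))) inY.
  move=> x; apply/piP'; rewrite /= linearB oc_tP CP /= -oc_tP [bar _]barP.
  exact: subrr.
split; exact: (MorphismChoice barP CP OmP omP).
Qed.

Lemma adjB C (Z : rep R Qv) (om om' om1 : {linear C -> start_sum Z}) i x :
  (forall c, om c - om' c = om1 c) -> adj acQ om i x - adj acQ om' i x = adj acQ om1 i x.
Proof.
move=> e; rewrite /= -sumrB; apply: eq_bigr => b _; rewrite /Prep_lift_fun -sumrB.
apply: eq_bigr => p _; rewrite /= -e -linearB; congr (rep_path Z p _).
by rewrite dsum_addE dsum_oppE.
Qed.

Lemma PPmapB (C C' : fgmod R) (k k' k1 : {linear C -> C'}) i x :
  (forall c, k c - k' c = k1 c) -> PPmap v k i x - PPmap v k' i x = PPmap v k1 i x.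
Proof.
move=> e; apply/dsumP=> b; rewrite dsum_addE dsum_oppE !dsumE.
by apply/dsumP=> p; rewrite dsum_addE dsum_oppE !dsumE e.
Qed.

Lemma away_hom X Y (f : rhom X Y) : @is_ahom Q v R (away v X) (away v Y) f.
Proof. by move=> i j hi hj a x; rewrite !away_map_away rmorP. Qed.

Section OneMorphism.
Variables (X Y : rep R Q) (cX : object_choice v X) (cY : object_choice v Y).
Hypothesis inY : injective (in_map Y v).
Variables (f : rhom X Y) (m : morphism_choice cX cY f).

Definition reflect_off i : {linear reflect_fam cX i -> reflect_fam cY i} :=
  lin_pair (lin_copair (f i) (adj acQ (Z := away v Y) (mc_omega m) i))
    (lin_comp (PPmap v (mc_C m) i) lin_snd).

Lemma reflect_off_pair i (x : X i) (y : PP v (oc_C cX) i) :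
  reflect_off i (x, y) =
  (f i x + adj acQ (Z := away v Y) (mc_omega m) i y, PPmap v (mc_C m) i y).
Proof. by []. Qed.

Lemma reflect_offE i (hi : i != v) x :
  reflect_mor m i (src_i (reflect_pres sink_v cX) i x) =
  src_i (reflect_pres sink_v cY) i (reflect_off i x).
Proof. exact: reflect_mor_off. Qed.

(** The compatibility that f(v) needs along the arrows leaving [v]; after applying u_Y it becomes
    the defining equation of omega. *)
Lemma mc_kP x : start_sum_map (Y := away v X) (Z := away v Y) f (oc_k cX x)
   + mc_omega m (oc_sigma cX x) = oc_k cY (mc_Omega m x).
Proof.
apply: inY; rewrite linearD mc_omegaP -mc_OmegaP [in RHS]oc_kP.
have -> : in_map Y v (start_sum_map (Y := away v X) (Z := away v Y) f (oc_k cX x)) =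
  f v (in_map X v (oc_k cX x)) := in_map_mor f _.
by rewrite oc_kP addrC subrK.
Qed.

Lemma reflect_off_ahom : is_ahom reflect_off.
Proof.
move=> i j hi hj a x; congr (_, _).
  by rewrite linearD -rmorP; congr (_ + _); exact: away_hom.
exact: (rmorP (PPmap v (mc_C m))).
Qed.

Lemma reflect_off_start b x :
  reflect_off (tag b) (reflect_w cX x b) = reflect_w cY (mc_Omega m x) b.
Proof.
rewrite !reflect_wE reflect_off_pair adj_eta PPmap_eta mc_OmegaP; congr (_, _).
by rewrite -mc_kP dsum_addE dsumE.
Qed.

Lemma reflect_mor_hom : is_rhom (reflect_rep cX) (reflect_rep cY) (reflect_mor m).
Proof.
have [h [hv hi]] := src_hom (reflect_pres sink_v cX) (reflect_pres sink_v cY)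
  reflect_off_ahom reflect_off_start.
have e : forall i x, reflect_mor m i x = h i x.
  apply: (src_ext (p := reflect_pres sink_v cX)) => [x|i iv x].
    by rewrite hv reflect_mor_v.
  by rewrite hi // reflect_offE.
by move=> i j a x; rewrite !e rmorP.
Qed.

Definition reflect_rhom : rhom (reflect_rep cX) (reflect_rep cY) := RHom reflect_mor_hom.
End OneMorphism.

Section Functoriality.
Variables (X Y : rep R Q) (cX : object_choice v X) (cY : object_choice v Y).
Hypothesis inY : injective (in_map Y v).

(* Two choices of C_f differ by sigma_Y s with s : C_X -> Omega_Y, and then the
   two versions of f(v) differ by a morphism through P_v(C_X). *)
Lemma reflect_choice_irrelevant (f f' : rhom X Y) (m : morphism_choice cX cY f)
    (m' : morphism_choice cX cY f') :
  (forall i x, f i x = f' i x) -> stably_equal (reflect_rhom inY m) (reflect_rhom inY m').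
Proof.
move=> ff'.
have [s sP] : exists s : {linear oc_C cX -> oc_Omega cY},
    forall c, oc_sigma cY (s c) = mc_C m c - mc_C m' c.
  apply: (lin_factor_inj (g := lin_add (mc_C m) (lin_opp (mc_C m'))) (oc_sigmaP cY).1) => c.
  apply/(oc_sigmaP cY).2; rewrite linearB !mc_CP.
  have [x <-] := (oc_piP cX).1 (oc_delta cX c).
  by rewrite !mc_barP ff' subrr.
have ksP c : mc_omega m c - mc_omega m' c = oc_k cY (s c).
  by apply: inY; rewrite linearB !mc_omegaP oc_kP sP [RHS]linearB ff' opprB addrA subrK.
have [||a [av ai]] := src_hom (reflect_pres sink_v cX) (WW_pres sink_v (oc_C cX))
  (fv := oc_sigma cX) (f := fun i => lin_snd).
- by [].
- by move=> b x; rewrite reflect_wE.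
have [||b [bv bi]] := src_hom (WW_pres sink_v (oc_C cX)) (reflect_pres sink_v cY)
  (fv := s) (f := fun i => lin_pair (adj acQ (Z := away v Y) (lin_comp (oc_k cY) s) i)
    (PPmap v (lin_comp (oc_sigma cY) s) i)).
- move=> i j hi hj c x; congr (_, _); exact: rmorP.
- move=> b x; rewrite reflect_wE; congr (_, _); last exact: PPmap_eta.
  exact: adj_eta.
exists (WW v (oc_C cX)), a, b; split; first by apply: WW_projective => //; have [] := oc_deltaP cX.
apply: (src_ext (p := reflect_pres sink_v cX)
    (f := fun i => lin_add (reflect_mor m i) (lin_opp (reflect_mor m' i)))
    (g := rmor (rhom_comp b a))) => [x|i hi x].
  have e : mc_Omega m x - mc_Omega m' x = s (oc_sigma cX x).
    by apply: (oc_sigmaP cY).1; rewrite linearB !mc_OmegaP sP.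
  by rewrite /= !reflect_mor_v av bv -e linearB.
have e : reflect_off m i x - reflect_off m' i x =
    (adj acQ (Z := away v Y) (lin_comp (oc_k cY) s) i x.2,
     PPmap v (lin_comp (oc_sigma cY) s) i x.2).
  case: x => x y; rewrite !reflect_off_pair lprod_subE; congr (_, _).
    rewrite ff' opprD addrACA subrr add0r.
    by apply: (adjB (Z := away v Y) (om1 := lin_comp (oc_k cY) s)) => c; exact: ksP.
  by apply: (PPmapB (k1 := lin_comp (oc_sigma cY) s)) => c; rewrite /= sP.
rewrite [RHS](_ : _ = src_i (reflect_pres sink_v cY) i (reflect_off m i x - reflect_off m' i x)).
  rewrite -[LHS]/(reflect_mor m i _ - reflect_mor m' i _) !reflect_offE // linearB.
  by [].
by rewrite e -bi // -ai.
Qed.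

(** Choices can be subtracted, so questions of stable equality reduce to one map being stably
    zero. *)
Lemma morphism_choice_sub (f g : rhom X Y) (mf : morphism_choice cX cY f) (mg : morphism_choice cX cY g) :
  exists m : morphism_choice cX cY (rhom_sub f g),
    forall i x, reflect_mor m i x = reflect_mor mf i x - reflect_mor mg i x.
Proof.
pose sub (U V : lmodType R) (p q : {linear U -> V}) := lin_add p (lin_opp q).
have barP x : sub _ _ (mc_bar mf) (mc_bar mg) (oc_pi cX x) = oc_pi cY (rhom_sub f g v x).
  by rewrite /= !mc_barP linearB.
have CP x : oc_delta cY (sub _ _ (mc_C mf) (mc_C mg) x)
    = sub _ _ (mc_bar mf) (mc_bar mg) (oc_delta cX x).
  by rewrite /= linearB !mc_CP.
have OmP x : oc_sigma cY (sub _ _ (mc_Omega mf) (mc_Omega mg) x)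
    = sub _ _ (mc_C mf) (mc_C mg) (oc_sigma cX x).
  by rewrite /= linearB !mc_OmegaP.
have omP x : in_map Y v (sub _ _ (mc_omega mf) (mc_omega mg) x)
    = oc_t cY (sub _ _ (mc_C mf) (mc_C mg) x) - rhom_sub f g v (oc_t cX x).
  have -> : oc_t cY (sub _ _ (mc_C mf) (mc_C mg) x) = oc_t cY (mc_C mf x) - oc_t cY (mc_C mg x).
    by rewrite -linearB.
  rewrite -[rhom_sub f g v _]/(f v (oc_t cX x) - g v (oc_t cX x)) linearB !mc_omegaP.
  by rewrite !opprB addrACA [in RHS]addrACA; congr (_ + _); rewrite addrC.
exists (MorphismChoice barP CP OmP omP).
apply: (src_ext (p := reflect_pres sink_v cX)
    (f := reflect_mor (MorphismChoice barP CP OmP omP))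
    (g := fun i => lin_add (reflect_mor mf i) (lin_opp (reflect_mor mg i)))) => [x|i hi x].
  by rewrite /= !reflect_mor_v [src_iv _ _]linearB.
rewrite -[RHS]/(reflect_mor mf i _ - reflect_mor mg i _) !reflect_offE // -[RHS]linearB; congr (src_i _ i _).
case: x => x y; rewrite !reflect_off_pair [RHS]lprod_subE; congr (_, _); apply/esym.
  rewrite -[rhom_sub f g i x]/(f i x - g i x) opprD addrACA; congr (_ + _).
  by apply: (adjB (Z := away v Y) (om1 := sub _ _ (mc_omega mf) (mc_omega mg))).
by apply: (PPmapB (k1 := sub _ _ (mc_C mf) (mc_C mg))).
Qed.

End Functoriality.

(** With omega of the composite set to omega_g C_f + g omega_f, choices compose strictly;
    functoriality then becomes a matter of independence of choices. *)
Lemma morphism_choice_comp X Y Z (cX : object_choice v X) (cY : object_choice v Y)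
    (cZ : object_choice v Z) (g : rhom Y Z) (f : rhom X Y)
    (mg : morphism_choice cY cZ g) (mf : morphism_choice cX cY f) :
  exists m : morphism_choice cX cZ (rhom_comp g f),
    forall i x, reflect_mor m i x = reflect_mor mg i (reflect_mor mf i x).
Proof.
pose bar := lin_comp (mc_bar mg) (mc_bar mf).
pose C := lin_comp (mc_C mg) (mc_C mf).
pose Om := lin_comp (mc_Omega mg) (mc_Omega mf).
pose om : {linear oc_C cX -> in_sum Z v} :=
  lin_add (lin_comp (mc_omega mg) (mc_C mf)) (lin_comp (in_sum_mor g v) (mc_omega mf)).
have barP x : bar (oc_pi cX x) = oc_pi cZ (rhom_comp g f v x) by rewrite /= !mc_barP.
have CP x : oc_delta cZ (C x) = bar (oc_delta cX x) by rewrite /= !mc_CP.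
have OmP x : oc_sigma cZ (Om x) = C (oc_sigma cX x) by rewrite /= !mc_OmegaP.
have omP x : in_map Z v (om x) = oc_t cZ (C x) - rhom_comp g f v (oc_t cX x).
  by rewrite linearD in_map_mor !mc_omegaP linearB addrA subrK.
exists (MorphismChoice barP CP OmP omP).
apply: (src_ext (p := reflect_pres sink_v cX)
    (f := reflect_mor (MorphismChoice barP CP OmP omP))
    (g := fun i => lin_comp (reflect_mor mg i) (reflect_mor mf i))) => [x|i hi x].
  by rewrite /= !reflect_mor_v.
rewrite -[RHS]/(reflect_mor mg i (reflect_mor mf i _)) !reflect_offE //; congr (src_i _ i _).
rewrite [RHS]surjective_pairing; congr (_, _).
  rewrite /= linearD -addrA; congr (_ + _); apply/esym.
  pose A := adj acQ (Z := away v Y) (mc_omega mf).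
  pose B := rhom_comp (adj acQ (Z := away v Z) (mc_omega mg)) (PPmap v (mc_C mf)).
  apply: (adj_uniq acQ sink_v (Z := away v Z) (om := om)
      (f := fun i => lin_add (lin_comp (g i) (A i)) (B i))) => [k j hk hj a y|c b].
    rewrite -[LHS]/(g j (A j _) + B j _) (rmorP A) (rmorP B) (away_hom g) -linearD.
    by [].
  rewrite -[LHS]/(g (tag b) (A (tag b) _) + adj acQ (Z := away v Z) (mc_omega mg) _ (PPmap v (mc_C mf) (tag b) _)).
  rewrite PPmap_eta !adj_eta /om dsum_addE addrC; congr (_ + _).
  by rewrite [RHS]dsumE.
by apply/dsumP=> b; apply/dsumP=> p; rewrite !dsumE.
Qed.

End ReflectionFunctor.

Lemma stably_equal_through (R : pzRingType) (Q : quiver) (X Y : rep R Q) (f g : rhom X Y) (P : rep R Q) (a : rhom X P) (b : rhom P Y) :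
  projective_rep P -> (forall i x, f i x - g i x = b i (a i x)) -> stably_equal f g.
Proof. by move=> pP e; exists P, a, b. Qed.

(** * The action on stable morphisms, fullness and faithfulness *)

Section StableFunctor.
Variables (R : pzRingType) (Q : quiver) (v : Q0 Q) (acQ : acyclic Q) (sink_v : sink v).
Local Notation Qv := (reflect_quiver v).
Implicit Types (X Y : rep R Q) (C : fgmod R).

Lemma morphism_choice_id X (c : object_choice v X) :
  exists m : morphism_choice c c (rhom_id X), forall i x, reflect_mor m i x = x.
Proof.
have omP x : in_map X v (lin_zero (oc_C c) (in_sum X v) x) = oc_t c (lin_id _ x) - rhom_id X v (oc_t c x).
  by rewrite linear0 subrr.
pose m : morphism_choice c c (rhom_id X) :=
  @MorphismChoice R Q v X X c c (rhom_id X) (lin_id _) (lin_id _) (lin_id _) _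
    (fun=> erefl) (fun=> erefl) (fun=> erefl) omP.
exists m.
apply: (src_ext (p := reflect_pres sink_v c) (f := reflect_mor m) (g := fun i => lin_id _)) => [x|i hi x].
  by rewrite reflect_mor_v.
rewrite (reflect_offE acQ sink_v) // -[RHS]/(src_i (reflect_pres sink_v c) i x); congr (src_i _ i _).
case: x => x y; rewrite reflect_off_pair; congr (_, _).
  rewrite -[RHS]addr0; congr (_ + _); rewrite -(subrr (adj acQ (Z := away v X) (mc_omega m) i y)).
  apply/esym; apply: (adjB acQ (Z := away v X) (om1 := mc_omega m)) => a.
  by rewrite subrr.
by apply/dsumP=> b; apply/dsumP=> p; rewrite !dsumE.
Qed.

Section StableMaps.
Variables (X Y : rep R Q) (cX : object_choice v X) (cY : object_choice v Y).
Hypotheses (inX : injective (in_map X v)) (inY : injective (in_map Y v)).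

(** If f - g factors through a projective [P], its reflection is stably equal to a composite through
    the reflection of [P], which is projective again. *)
Lemma reflect_stably_equal (f g : rhom X Y) (mf : morphism_choice cX cY f) (mg : morphism_choice cX cY g) :
  kernels_fg R ->
  (forall M : fgmod R, exists (C : fgmod R) (d : {linear C -> M}), projective_cover d) ->
  stably_equal f g ->
  stably_equal (reflect_rhom acQ sink_v inY mf) (reflect_rhom acQ sink_v inY mg).
Proof.
move=> kerR covR [P [a [b [pP e]]]].
have inP : injective (in_map P v) by exact: projective_sepmono.
have [cP] := object_choice_exists kerR covR inP.
have [ma] := morphism_choice_exists cX cP a inP.
have [mb] := morphism_choice_exists cP cY b inY.
have [m mP] := morphism_choice_comp acQ sink_v mb ma.
have [md mdP] := morphism_choice_sub acQ sink_v mf mg.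
have dm : stably_equal (reflect_rhom acQ sink_v inY md) (reflect_rhom acQ sink_v inY m).
  by apply: reflect_choice_irrelevant => i x; exact: e.
have m0 : stably_equal (reflect_rhom acQ sink_v inY m) (rhom_zero _ _).
  apply: (stably_equal_through (P := reflect_rep cP)
    (a := reflect_rhom acQ sink_v inP ma) (b := reflect_rhom acQ sink_v inY mb)) => [|i x].
    exact: reflect_projective.
  by rewrite -[LHS]/(reflect_mor m i x - 0) subr0 mP.
have [T [a' [b' [pT e']]]] := stably_equal_trans dm m0.
exists T, a', b'; split=> // i x; rewrite -e' -[RHS]/(reflect_mor md i x - 0) subr0.
by rewrite mdP.
Qed.

Lemma sink_decomp x : exists y c, x = in_map X v y + oc_t cX c.
Proof.
have [piS piP] := oc_piP cX; have [pC dS _] := oc_deltaP cX.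
have [c cP] := dS (oc_pi cX x).
have /piP[y yP] : oc_pi cX (x - oc_t cX c) = 0 by rewrite linearB oc_tP cP subrr.
by exists y, c; rewrite yP subrK.
Qed.

(* X_v is the pushout of k_X and sigma_X. *)
Lemma sink_pushout (N : lmodType R) (p : {linear in_sum X v -> N}) (r : {linear oc_C cX -> N}) :
  (forall o, p (oc_k cX o) = r (oc_sigma cX o)) ->
  exists h : {linear X v -> N}, (forall x, h (in_map X v x) = p x) /\ (forall c, h (oc_t cX c) = r c).
Proof.
move=> pr.
have [||h hP] := lin_factor_surj (p := lin_copair (in_map X v) (oc_t cX)) (g := lin_copair p r).
- by move=> x; have [y [c ->]] := sink_decomp x; exists (y, c).
- move=> [x c] e; have {}e : in_map X v x + oc_t cX c = 0 by exact: e.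
  have /(oc_sigmaP cX).2[o oP] : oc_delta cX c = 0.
    rewrite -oc_tP -[oc_t cX c](addKr (in_map X v x)) e addr0 linearN.
    by rewrite (_ : oc_pi cX _ = 0) ?oppr0 //; apply/(oc_piP cX).2; exists x.
  have x0 : x = - oc_k cX o.
    apply: inX; rewrite linearN oc_kP oP; apply/eqP; rewrite -addr_eq0; exact/eqP.
  by rewrite /= x0 -oP linearN pr addNr.
exists h; split=> [x|c].
  have : h (in_map X v x + oc_t cX 0) = p x + r 0 := hP (x, 0).
  by rewrite !linear0 !addr0.
have : h (in_map X v 0 + oc_t cX c) = p 0 + r c := hP (0, c).
by rewrite !linear0 !add0r.
Qed.

Hypothesis injR : selfinjective R.

(** The components of [g] at [v] and into [Y] supply Omega_f, f and omega_f. Only the component into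
    [PP v (oc_C cY)] may differ from that of f(v), and this summand is projective. *)
Lemma reflect_full (g : rhom (reflect_rep cX) (reflect_rep cY)) :
  exists (f : rhom X Y) (m : morphism_choice cX cY f),
    stably_equal (reflect_rhom acQ sink_v inY m) g.
Proof.
pose pX := reflect_pres sink_v cX; pose pY := reflect_pres sink_v cY.
have [gv [g0 [g0a gc gvP g0P]]] := src_dec pX pY g.
have [pCX dSX _] := oc_deltaP cX; have [pCY dSY _] := oc_deltaP cY.
(* C_Y is projective, hence injective, so the map at [v] extends along sigma_X; the extension
   becomes C_f. *)
have [C CP] := projective_injective injR pCY (lin_comp (oc_sigma cY) gv) (oc_sigmaP cX).1.
pose b i : {linear X i -> Y i} := lin_comp lin_fst (lin_comp (g0 i) lin_inl).
pose c0 i : {linear PP v (oc_C cX) i -> Y i} := lin_comp lin_fst (lin_comp (g0 i) lin_inr).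
have ba : @is_ahom Q v R (away v X) (away v Y) b.
  move=> i j hi hj a x; rewrite -[RHS]/(rep_map (reflect_fam cY) (away_arrow hi hj a) (g0 i (x, 0))).1.
  have e : rep_map (reflect_fam cX) (away_arrow hi hj a) (x, 0)
      = (rep_map (away v X) (away_arrow hi hj a) x, 0).
    by congr (_, _); exact: (linear0 (rep_map (PP v (oc_C cX)) (away_arrow hi hj a))).
  by rewrite -g0a e.
have ca : @is_ahom Q v R (PP v (oc_C cX)) (away v Y) c0.
  move=> i j hi hj a x; rewrite -[RHS]/(rep_map (reflect_fam cY) (away_arrow hi hj a) (g0 i (0, x))).1.
  have e : rep_map (reflect_fam cX) (away_arrow hi hj a) (0, x)
      = (0, rep_map (PP v (oc_C cX)) (away_arrow hi hj a) x).
    by congr (_, _); exact: (linear0 (rep_map (away v X) (away_arrow hi hj a))).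
  by rewrite -g0a e.
have g0E i x y : (g0 i (x, y)).1 = b i x + c0 i y.
  rewrite -[RHS]/((g0 i (x, 0) + g0 i (0, y)).1) -linearD; congr (g0 i _).1.
  by rewrite [RHS]surjective_pairing /= addr0 add0r.
pose om : {linear oc_C cX -> in_sum Y v} :=
  Lin (dsum_glue (M := fun b : in_arrow v => Y (tag b) : lmodType R) (fun d =>
    lin_comp (c0 (tag d)) (lin_comp
      (dsum_proj (M := fun b : in_arrow v => PP v (oc_C cX) (tag b) : lmodType R) d) (eta v (oc_C cX))))).
have omE c d : om c d = c0 (tag d) (eta v (oc_C cX) c d) by rewrite dsumE.
pose bs : {linear in_sum X v -> in_sum Y v} := dsum_map (fun d : in_arrow v => b (tag d)).
have kP o : bs (oc_k cX o) + om (oc_sigma cX o) = oc_k cY (gv o).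
  apply/dsumP=> d; rewrite dsum_addE omE dsumE -g0E.
  by have := gc d o; rewrite !reflect_wE => ->.
(* The value on C_X is dictated by the equation that defines omega_f. *)
have [|fv [fvi fvt]] := sink_pushout (p := lin_comp (in_map Y v) bs)
    (r := lin_add (lin_comp (oc_t cY) C) (lin_opp (lin_comp (in_map Y v) om))).
  move=> o; rewrite -[RHS]/(oc_t cY (C (oc_sigma cX o)) - in_map Y v (om (oc_sigma cX o))) CP.
  by rewrite -[oc_t cY _]oc_kP -kP linearD addrK.
have [||f [fvP fP]] := snk_hom sink_v (snk_pres_self v X) (snk_pres_self v Y) (fv := fv) (f := b).
- exact: ba.
- exact: fvi.
have fvE x : f v x = fv x := fvP x.
have [|bar barP] := lin_factor_surj (p := oc_pi cX) (g := lin_comp (oc_pi cY) (f v)) (oc_piP cX).1.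
  move=> x /(oc_piP cX).2[y <-]; apply/(oc_piP cY).2.
  by exists (bs y); rewrite fvE fvi.
have barC c : oc_delta cY (C c) = bar (oc_delta cX c).
  rewrite -[oc_delta cX c]oc_tP barP -[RHS]/(oc_pi cY (f v (oc_t cX c))) fvE fvt.
  rewrite -[X in oc_pi cY X]/(oc_t cY (C c) - in_map Y v (om c)) linearB oc_tP.
  by rewrite (_ : oc_pi cY (in_map Y v _) = 0) ?subr0 //; apply/(oc_piP cY).2; exists (om c).
have omP c : in_map Y v (om c) = oc_t cY (C c) - f v (oc_t cX c).
  rewrite fvE fvt -[X in _ - X]/(oc_t cY (C c) - in_map Y v (om c)).
  by rewrite opprB addrC subrK.
pose m : morphism_choice cX cY f := MorphismChoice barP barC (fun x => esym (CP x)) omP.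
exists f, m.
have c0E i y : c0 i y = adj acQ (Z := away v Y) om i y.
  by apply: (adj_uniq acQ sink_v (Z := away v Y) (f := c0)) => // c d; rewrite omE.
pose a0 i : {linear reflect_fam cX i -> PP v (oc_C cY) i} :=
  lin_add (lin_comp (PPmap v C i) lin_snd) (lin_opp (lin_comp lin_snd (g0 i))).
have [||a [av aP]] := src_hom pX (src_pres_self sink_v (PP v (oc_C cY))) (fv := lin_zero _ _) (f := a0).
- move=> i j hi hj d x.
  rewrite -[RHS]/(rep_map (PP v (oc_C cY)) (away_arrow hi hj d) (PPmap v C i x.2 - (g0 i x).2)).
  rewrite linearB -(rmorP (PPmap v C)).
  rewrite -[rep_map _ _ (g0 i x).2]/(rep_map (reflect_fam cY) (away_arrow hi hj d) (g0 i x)).2.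
  by rewrite -g0a.
- move=> d x; rewrite linear0 dsum_zeroE.
  rewrite -[LHS]/(PPmap v C (tag d) (reflect_w cX x d).2 - (g0 (tag d) (reflect_w cX x d)).2).
  by rewrite gc !reflect_wE PPmap_eta CP subrr.
have [||b1 [b1v b1P]] := src_hom (src_pres_self sink_v (PP v (oc_C cY))) pY (fv := lin_zero _ _)
  (f := fun i => lin_inr).
- move=> i j hi hj d x.
  rewrite -[RHS]/(rep_map (away v Y) (away_arrow hi hj d) 0, rep_map (PP v (oc_C cY)) (away_arrow hi hj d) x).
  by rewrite linear0.
- by move=> d x; rewrite (PP_at_v sink_v x) !linear0 !dsum_zeroE linear0.
apply: (stably_equal_through (a := a) (b := b1)); first exact: PP_projective.
apply: (src_ext (p := pX) (f := rmor (rhom_sub (reflect_rhom acQ sink_v inY m) g))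
    (g := rmor (rhom_comp b1 a))) => [x|i hi x].
  rewrite -[LHS]/(reflect_mor m v (src_iv pX x) - g v (src_iv pX x)) reflect_mor_v gvP subrr.
  by rewrite -[RHS]/(b1 v (a v (src_iv pX x))) (_ : a v _ = 0) ?linear0.
rewrite -[LHS]/(reflect_mor m i (src_i pX i x) - g i (src_i pX i x)) (reflect_offE acQ sink_v) // g0P //.
rewrite -[RHS]/(b1 i (a i (src_i pX i x))) aP // [RHS]b1P // -linearB; congr (src_i pY i _).
case: x => x y; rewrite reflect_off_pair [g0 i _]surjective_pairing g0E c0E.
rewrite (fP i hi x : f i x = b i x) lprod_subE subrr.
by [].
Qed.

(** The given factorisation is corrected so that it vanishes on Omega_X, and then descends to the
    pushout X_v. The part of [d v] that does not pass through H T passes through the cokernel at the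
    sink, whence the summand [at_sink]. *)
Lemma reflect_faithful (d : rhom X Y) (m : morphism_choice cX cY d)
    (T : rep R Qv) (a : rhom (reflect_rep cX) T) (b : rhom T (reflect_rep cY)) :
  projective_rep T -> (forall i x, reflect_mor m i x = b i (a i x)) ->
  exists (P : rep R Q) (al : rhom X P) (be : rhom P Y),
    projective_rep P /\ forall i x, d i x = be i (al i x).
Proof.
move=> pT ab.
pose pX := reflect_pres sink_v cX; pose pY := reflect_pres sink_v cY.
pose pT0 := src_pres_self sink_v T.
have [av [a0 [a0a ac avP a0P]]] := src_dec pX pT0 a.
have [bv [b0 [b0a bc bvP b0P]]] := src_dec pT0 pY b.
have acQv := reflect_quiver_acyclic (v := v) acQ.
have [pCX dSX _] := oc_deltaP cX; have [pCY dSY _] := oc_deltaP cY.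
(* The module of [T] at [v] is injective, so [av] extends from Omega_X to C_X. *)
have [A AP] := projective_injective injR (projective_rep_at acQv pT) av (oc_sigmaP cX).1.
pose sA : {linear oc_C cX -> start_sum T} := lin_comp (start_map sink_v T) A.
(* Subtracting the map adjoint to [A] makes the part of [a] away from [v] vanish on the image of
   Omega_X. *)
pose a1 i : {linear reflect_fam cX i -> T i} :=
  lin_add (a0 i) (lin_opp (lin_comp (adj acQ sA i) lin_snd)).
have a1a : is_ahom a1.
  move=> i j hi hj c x.
  rewrite -[LHS]/(a0 j _ - adj acQ sA j (rep_map (PP v (oc_C cX)) (away_arrow hi hj c) x.2)).
  by rewrite a0a (rmorP (adj acQ sA)) -linearB.
have a1w o e : a1 (tag e) (reflect_w cX o e) = 0.
  rewrite -[LHS]/(a0 (tag e) (reflect_w cX o e) - adj acQ sA (tag e) (reflect_w cX o e).2).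
  rewrite ac reflect_wE adj_eta -[sA _]/(start_map sink_v T (A (oc_sigma cX o))) AP.
  exact: subrr.
have omE o : mc_Omega m o = bv (av o).
  apply: (can_inj (src_ivK pY)); rewrite -bvP -[src_iv pT0 (av o)]avP -ab.
  by rewrite -reflect_mor_v.
(* The same correction turns the choice for [d] into one that is zero on Omega_X: [C'] kills
   sigma_X, and [om'] satisfies the equation of omega with [C'] for C_f. *)
pose s : {linear oc_C cX -> oc_Omega cY} := lin_comp bv A.
pose C' : {linear oc_C cX -> oc_C cY} := lin_add (mc_C m) (lin_opp (lin_comp (oc_sigma cY) s)).
pose om' : {linear oc_C cX -> in_sum Y v} := lin_add (mc_omega m) (lin_opp (lin_comp (oc_k cY) s)).
have C'0 o : C' (oc_sigma cX o) = 0.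
  rewrite -[LHS]/(mc_C m (oc_sigma cX o) - oc_sigma cY (bv (A (oc_sigma cX o)))).
  by rewrite -mc_OmegaP AP omE subrr.
have om'P c : in_map Y v (om' c) = oc_t cY (C' c) - d v (oc_t cX c).
  rewrite linearB mc_omegaP -[lin_comp _ _ c]/(oc_k cY (s c)) oc_kP.
  rewrite -[C' c]/(mc_C m c - oc_sigma cY (s c)) linearB.
  by rewrite addrAC.
have b0adj i x : b0 i (adj acQ sA i x) =
    (adj acQ (Z := away v Y) (lin_comp (oc_k cY) s) i x, PPmap v (lin_comp (oc_sigma cY) s) i x).
  apply: (PP_ext acQ sink_v (B := reflect_fam cY)
    (f := fun i => lin_comp (b0 i) (adj acQ sA i))
    (g := fun i => lin_pair (adj acQ (Z := away v Y) (lin_comp (oc_k cY) s) i)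
                            (PPmap v (lin_comp (oc_sigma cY) s) i))).
  - move=> k j hk hj c y; rewrite -[LHS]/(b0 j (adj acQ sA j _)) (rmorP (adj acQ sA)).
    exact: b0a.
  - by move=> k j hk hj c y; congr (_, _); exact: rmorP.
  - move=> c e; rewrite -[LHS]/(b0 (tag e) (adj acQ sA (tag e) _)) adj_eta [LHS]bc reflect_wE.
    by rewrite -[RHS]/(adj acQ _ (tag e) _, PPmap v _ (tag e) _) adj_eta PPmap_eta.
have b0a1 i (hi : i != v) x y : b0 i (a1 i (x, y)) =
    (d i x + adj acQ (Z := away v Y) om' i y, PPmap v C' i y).
  rewrite -[a1 i _]/(a0 i (x, y) - adj acQ sA i y) linearB b0adj.
  have -> : b0 i (a0 i (x, y)) = reflect_off acQ m i (x, y).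
    apply: (can_inj (src_iK pY hi)); rewrite -b0P // -[src_i pT0 i _]a0P // -ab.
    by rewrite -(reflect_offE acQ sink_v).
  rewrite reflect_off_pair lprod_subE; congr (_, _); last exact: PPmapB.
  by rewrite -addrA; congr (_ + _); exact: adjB.
pose ax i : {linear X i -> T i} := lin_comp (a1 i) lin_inl.
have axa : @is_ahom Q v R (away v X) T ax.
  move=> i j hi hj c x; rewrite -[RHS]a1a -[LHS]/(a1 j (_, 0)); congr (a1 j (_, _)).
  exact/esym/(linear0 (rep_map (PP v (oc_C cX)) (away_arrow hi hj c))).
pose ac1 : {linear oc_C cX -> start_sum T} :=
  Lin (dsum_glue (M := fun b : in_arrow v => T (tag b) : lmodType R) (fun e =>
    lin_comp (a1 (tag e)) (lin_comp lin_inr (lin_comp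
      (dsum_proj (M := fun b : in_arrow v => PP v (oc_C cX) (tag b) : lmodType R) e) (eta v (oc_C cX)))))).
have ac1E c e : ac1 c e = a1 (tag e) (0, eta v (oc_C cX) c e) by rewrite dsumE.
pose axs : {linear in_sum X v -> start_sum T} := dsum_map (fun e : in_arrow v => ax (tag e)).
(* The pushout condition is [a1w], the vanishing of [a1] on Omega_X; hence the sign on [ac1]. *)
have [|h [hi ht]] := sink_pushout (p := axs) (r := lin_opp ac1).
  move=> o; apply/dsumP=> e; rewrite dsumE -[lin_opp ac1 _]/(- ac1 (oc_sigma cX o)) dsum_oppE ac1E.
  apply/eqP; rewrite -addr_eq0 -[ax _ _]/(a1 (tag e) (oc_k cX o e, 0)) -linearD; apply/eqP.
  rewrite -(a1w o e) reflect_wE; congr (a1 _ _).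
  by rewrite [LHS]surjective_pairing /= addr0 add0r.
pose S := snk (lin_id (start_sum T)); pose pS := snk_presP sink_v (lin_id (start_sum T)).
have [||al1 [al1v al1P]] := snk_hom sink_v (snk_pres_self v X) pS (fv := h) (f := ax).
- exact: axa.
- exact: hi.
pose by_ i : {linear T i -> Y i} := lin_comp lin_fst (b0 i).
have bya : @is_ahom Q v R T (away v Y) by_.
  by move=> i j hj hj' c x; rewrite -[LHS]/((b0 j _).1) b0a.
pose bys : {linear start_sum T -> in_sum Y v} := dsum_map (fun e : in_arrow v => by_ (tag e)).
have [||be1 [be1v be1P]] := snk_hom sink_v pS (snk_pres_self v Y)
  (fv := lin_comp (in_map Y v) bys) (f := by_).
- exact: bya.
- by [].
have byax i (hi' : i != v) x : by_ i (ax i x) = d i x.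
  rewrite -[LHS]/((b0 i (a1 i (x, 0))).1) b0a1 // -[LHS]/(d i x + adj acQ (Z := away v Y) om' i 0) linear0.
  exact: addr0.
have bysax x : bys (axs x) = in_sum_mor d v x.
  by apply/dsumP=> e; rewrite !dsumE; apply: byax; exact: in_arrow_neq.
have bysac c : bys (ac1 c) = om' c.
  apply/dsumP=> e; rewrite dsumE ac1E -[LHS]/((b0 (tag e) (a1 (tag e) (0, _))).1).
  rewrite b0a1 ?in_arrow_neq // -[LHS]/(d (tag e) 0 + adj acQ (Z := away v Y) om' (tag e) _) adj_eta linear0.
  exact: add0r.
have [|Cb CbP] := lin_factor_surj (p := oc_delta cX) (g := C') dSX.
  by move=> c /(oc_sigmaP cX).2[o <-]; exact: C'0.
have pi0 x : oc_pi cX (in_map X v x) = 0 by apply/(oc_piP cX).2; exists x.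
(* X_v is generated by the incoming sum and by C_X; on the latter the equation is [om'P]. *)
have dv x : d v x = in_map Y v (bys (h x)) + oc_t cY (Cb (oc_pi cX x)).
  have [y [c ->]] := sink_decomp x.
  rewrite !linearD pi0 oc_tP !linear0 add0r hi ht CbP bysax -[lin_opp ac1 c]/(- ac1 c).
  rewrite linearN bysac linearN om'P in_map_mor opprB -addrA subrK.
  by [].
have [||al2 [al2v al2P]] := snk_hom sink_v (snk_pres_self v X) (at_sink_pres sink_v (oc_C cY))
  (fv := lin_comp Cb (oc_pi cX)) (f := fun i => lin_zero _ _).
- by [].
- by move=> x; rewrite -[LHS]/(Cb (oc_pi cX (in_map X v x))) pi0 linear0.
have [||be2 [be2v be2P]] := snk_hom sink_v (at_sink_pres sink_v (oc_C cY)) (snk_pres_self v Y)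
  (fv := oc_t cY) (f := fun i => lin_zero _ _).
- by move=> i j hj hj' c x; rewrite -[LHS]/0 linear0.
- move=> x; rewrite linear0 [X in in_map Y v X](_ : _ = 0) ?linear0 //.
have al_hom : is_rhom X (rep_sum S (at_sink v (oc_C cY))) (fun i => lin_pair (al1 i) (al2 i)).
  by move=> i j c x; congr (_, _); exact: rmorP.
have be_hom : is_rhom (rep_sum S (at_sink v (oc_C cY))) Y (fun i => lin_copair (be1 i) (be2 i)).
  by move=> i j c x; rewrite /= linearD !rmorP.
exists (rep_sum S (at_sink v (oc_C cY))), (RHom al_hom), (RHom be_hom); split.
  by apply: projective_sum; [exact: snk_start_sum_projective | exact: at_sink_projective].
move=> i x; rewrite -[RHS]/(be1 i (al1 i x) + be2 i (al2 i x)).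
have [iv|iv] := eqVneq i v.
  subst i; have -> : al1 v x = snk_iv pS (h x) := al1v x.
  have -> : al2 v x = snk_iv (at_sink_pres sink_v (oc_C cY)) (Cb (oc_pi cX x)) := al2v x.
  by rewrite be1v be2v dv.
have -> : al1 i x = snk_i pS i (ax i x) := al1P i iv x.
have -> : al2 i x = 0 by rewrite -[x]/(snk_i (snk_pres_self v X) i x) al2P // linear0.
by rewrite be1P // linear0 addr0 -[RHS]/(by_ i (ax i x)) byax.
Qed.
End StableMaps.

End StableFunctor.

(** * Density *)

Section Density.
Variables (R : pzRingType) (Q : quiver) (v : Q0 Q) (acQ : acyclic Q) (sink_v : sink v).
Local Notation Qv := (reflect_quiver v).
Implicit Types (X : rep R Q) (C : fgmod R).

(* Both (Y_v, J) and (Om, C) present the pushout XV of HY: in both cases the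
   cokernel of u is J / Y_v = C / Om. Comparing J with C over it relates Y to the
   reflection Z, which is glued from Om and Y + PP C. *)
Section Comparison.
Variables (Y Z : rep R Qv) (J C Om B XV : fgmod R).
Variables (sg : {linear Y v -> J}) (sC : {linear Om -> C}).
Variables (u : {linear start_sum Y -> XV}) (pi : {linear XV -> B}).
Variables (iJ : {linear J -> XV}) (t : {linear C -> XV}) (k : {linear Om -> start_sum Y}).
Variable w : {linear Om -> start_sum (rep_sum Y (PP v C))}.
Variable p : src_pres sink_v Z w.
Variable r : forall i, {linear Y i -> PP v J i}.
Hypotheses (pJ : projective_module J) (pC : projective_module C).
Hypotheses (uI : injective u) (sgI : injective sg) (sCI : injective sC).
Hypothesis ker_pi : forall x, pi x = 0 <-> exists y, u y = x.
Hypotheses (dJS : surjective_map (lin_comp pi iJ)) (dCS : surjective_map (lin_comp pi t)).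
Hypothesis ker_dJ : forall x, pi (iJ x) = 0 <-> exists y, sg y = x.
Hypothesis ker_dC : forall x, pi (t x) = 0 <-> exists y, sC y = x.
Hypothesis uw : forall y, u (start_map sink_v Y y) = iJ (sg y).
Hypothesis uk : forall o, u (k o) = t (sC o).
Hypothesis wE : forall o b, w o b = (k o b, eta v C (sC o) b).
Hypotheses (r_ahom : is_ahom r)
  (rw : forall y b, r (tag b) (start_map sink_v Y y b) = eta v J (sg y) b).

Lemma comparison_equiv : exists (phi : rhom Y Z) (psi : rhom Z Y),
  stably_equal (rhom_comp psi phi) (rhom_id Y) /\ stably_equal (rhom_comp phi psi) (rhom_id Z).
Proof.
pose wY := start_map sink_v Y; pose pY := src_pres_self sink_v Y.
(* Over [B] the projectives [J] and [C] lift to each other, as in Schanuel's lemma. *)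
have [ka kaP] := pJ (g := lin_comp pi t) (lin_comp pi iJ) dCS.
have [la laP] := pC (g := lin_comp pi iJ) (lin_comp pi t) dJS.
have {}kaP x : pi (t (ka x)) = pi (iJ x) := kaP x.
have {}laP x : pi (iJ (la x)) = pi (t x) := laP x.
have [|ka0 ka0P] := lin_factor_inj (g := lin_comp ka sg) sCI.
  by move=> x; apply/ker_dC; rewrite kaP; apply/ker_dJ; exists x.
have [|la0 la0P] := lin_factor_inj (g := lin_comp la sC) sgI.
  by move=> x; apply/ker_dJ; rewrite laP; apply/ker_dC; exists x.
have {}ka0P x : sC (ka0 x) = ka (sg x) := ka0P x.
have {}la0P x : sg (la0 x) = la (sC x) := la0P x.
(* The lifts commute with the maps to [XV] only modulo the image of [u]; [ok] and [ol] record the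
   defect and play the part of omega. *)
have [|ok okP] := lin_factor_inj (g := lin_add (lin_comp t ka) (lin_opp iJ)) uI.
  by move=> x; apply/ker_pi; rewrite linearB kaP subrr.
have [|ol olP] := lin_factor_inj (g := lin_add (lin_comp iJ la) (lin_opp t)) uI.
  by move=> x; apply/ker_pi; rewrite linearB laP subrr.
have {}okP x : u (ok x) = t (ka x) - iJ x := okP x.
have {}olP x : u (ol x) = iJ (la x) - t x := olP x.
have F1 y : k (ka0 y) = wY y + ok (sg y).
  by apply: uI; rewrite uk linearD uw okP ka0P addrC subrK.
have F2 o : k o + ol (sC o) = wY (la0 o).
  by apply: uI; rewrite linearD uk olP uw la0P addrC subrK.
(* The composites of the lifts differ from the identities by maps into [Y v] and [Om], which let the
   errors below pass through P_v(J) and P_v(C). *)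
have [|s sP] := lin_factor_inj (g := lin_add (lin_id J) (lin_opp (lin_comp la ka))) sgI.
  by move=> x; apply/ker_dJ; rewrite !linearB laP kaP subrr.
have [|s' s'P] := lin_factor_inj (g := lin_add (lin_id C) (lin_opp (lin_comp ka la))) sCI.
  by move=> x; apply/ker_dC; rewrite !linearB kaP laP subrr.
have {}sP x : sg (s x) = x - la (ka x) := sP x.
have {}s'P x : sC (s' x) = x - ka (la x) := s'P x.
have G1 x : ok x + ol (ka x) = - wY (s x).
  apply: uI; rewrite linearD okP olP linearN uw sP linearB opprB.
  by rewrite addrC addrA subrK.
have G2 x : ol x + k (s' x) = - ok (la x).
  apply: uI; rewrite linearD olP uk s'P linearN okP linearB opprB.
  by rewrite addrA subrK.
have [||psi [psiv psiP]] := src_hom p pY (fv := la0) (f := fun i => lin_copair (lin_id (Y i)) (adj acQ ol i)).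
- move=> i j hi hj a x; rewrite -[RHS]/(rep_map Y _ (x.1 + adj acQ ol i x.2)) linearD -(rmorP (adj acQ ol)).
  by [].
- move=> b o; rewrite wE -[LHS]/(k o b + adj acQ ol (tag b) _) adj_eta -dsum_addE F2.
  by [].
have [||phi [phiv phiP]] := src_hom pY p (fv := ka0)
  (f := fun i => lin_pair (lin_add (lin_id (Y i)) (lin_comp (adj acQ ok i) (r i)))
                          (lin_comp (PPmap v ka i) (r i))).
- move=> i j hi hj a x; rewrite -[RHS]/(rep_map Y _ (x + adj acQ ok i (r i x)),
    rep_map (PP v C) (away_arrow hi hj a) (PPmap v ka i (r i x))).
  rewrite linearD -(rmorP (adj acQ ok)) -(rmorP (PPmap v ka)) -r_ahom.
  by [].
- move=> b y; rewrite wE F1 ka0P dsum_addE -PPmap_eta -(adj_eta acQ ok) -rw.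
  by [].
have [||A [Av AP]] := src_hom pY (WW_pres sink_v J) (fv := sg) (f := r).
- exact: r_ahom.
- by move=> b y; rewrite -rw.
have [D [Dv DP]] := WW_lift acQ sink_v s.
have [||A1 [A1v A1P]] := src_hom p (WW_pres sink_v C) (fv := sC) (f := fun i => lin_snd).
- by [].
- by move=> b o; rewrite wE.
have [||D1 [D1v D1P]] := src_hom (WW_pres sink_v C) p (fv := s')
  (f := fun i => lin_pair (adj acQ (lin_comp k s') i) (PPmap v (lin_comp sC s') i)).
- by move=> i j hi hj a x; congr (_, _); exact: rmorP.
- move=> b c; rewrite wE -[LHS]/(adj acQ _ (tag b) _, PPmap v _ (tag b) _) adj_eta PPmap_eta.
  by [].
(* On [Z] a second error remains: [r] after [psi] need not agree with the map induced by [la]. The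
   difference vanishes on [Om], so it passes through [PP v J]. *)
have [||A2 [A2v A2P]] := src_hom p (src_pres_self sink_v (PP v J)) (fv := lin_zero _ _)
  (f := fun i => lin_add (lin_comp (PPmap v la i) lin_snd)
     (lin_opp (lin_comp (r i) (lin_copair (lin_id (Y i)) (adj acQ ol i))))).
- move=> i j hi hj a x.
  rewrite -[RHS]/(rep_map (PP v J) (away_arrow hi hj a) (PPmap v la i x.2 - r i (x.1 + adj acQ ol i x.2))).
  rewrite linearB -(rmorP (PPmap v la)) -r_ahom linearD -(rmorP (adj acQ ol)).
  by [].
- move=> b o; rewrite linear0 dsum_zeroE wE.
  rewrite -[LHS]/(PPmap v la (tag b) (eta v C (sC o) b) - r (tag b) (k o b + adj acQ ol (tag b) (eta v C (sC o) b))).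
  by rewrite adj_eta PPmap_eta -dsum_addE F2 rw la0P subrr.
have [||D2 [D2v D2P]] := src_hom (src_pres_self sink_v (PP v J)) p (fv := lin_zero _ _)
  (f := fun i => lin_pair (adj acQ ok i) (PPmap v ka i)).
- by move=> i j hi hj a x; congr (_, _); exact: rmorP.
- by move=> b x; rewrite (PP_at_v sink_v x) !linear0 !dsum_zeroE linear0.
exists phi, psi; split; apply: stably_equal_sym.
  apply: (stably_equal_through (a := A) (b := D)); first exact: WW_projective.
  apply: (src_ext (p := pY) (f := rmor (rhom_sub (rhom_id Y) (rhom_comp psi phi)))
    (g := rmor (rhom_comp D A))) => [y|i hi y].
    rewrite -[LHS]/(y - psi v (phi v y)) -[RHS]/(D v (A v y)).
    rewrite [phi v y]phiv [A v y]Av psiv Dv -[RHS]/(s (sg y)).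
    by apply: sgI; rewrite linearB sP la0P ka0P.
  rewrite -[LHS]/(y - psi i (phi i y)) -[RHS]/(D i (A i y)).
  rewrite [phi i y](phiP i hi y) [A i y](AP i hi y) psiP // DP //.
  rewrite -[src_i pY i _]/(y + adj acQ ok i (r i y) + adj acQ ol i (PPmap v ka i (r i y))).
  rewrite opprD opprD addrA addrA subrr add0r.
  pose f j := lin_add (lin_opp (adj acQ ok j)) (lin_opp (lin_comp (adj acQ ol j) (PPmap v ka j))).
  apply: (adj_uniq acQ sink_v (f := f)) => [j l hj hl a x|c b].
    rewrite -[LHS]/(- adj acQ ok l _ - adj acQ ol l (PPmap v ka l _)).
    rewrite -[f j x]/(- adj acQ ok j x - adj acQ ol j (PPmap v ka j x)).
    by rewrite linearB linearN !rmorP.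
  rewrite -[LHS]/(- adj acQ ok (tag b) _ - adj acQ ol (tag b) (PPmap v ka (tag b) _)).
  by rewrite PPmap_eta !adj_eta -opprD -dsum_addE G1 dsum_oppE opprK.
have e1 : stably_equal (rhom_sub (rhom_id Z) (rhom_comp phi psi)) (rhom_comp D1 A1).
  apply: (stably_equal_through (a := A2) (b := D2)); first exact: PP_projective.
  apply: (src_ext (p := p)
    (f := rmor (rhom_sub (rhom_sub (rhom_id Z) (rhom_comp phi psi)) (rhom_comp D1 A1)))
    (g := rmor (rhom_comp D2 A2))) => [o|i hi [x y]].
    rewrite -[LHS]/(src_iv p o - phi v (psi v (src_iv p o)) - D1 v (A1 v (src_iv p o))).
    rewrite psiv [phi v _]phiv A1v D1v -!linearB.
    rewrite (_ : o - _ - _ = 0); last first.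
      by apply: sCI; rewrite !linearB ka0P la0P s'P subrr linear0.
    by rewrite linear0 -[RHS]/(D2 v (A2 v (src_iv p o))) (_ : A2 v _ = 0) ?linear0.
  rewrite -[LHS]/(src_i p i (x, y) - phi i (psi i (src_i p i (x, y))) - D1 i (A1 i (src_i p i (x, y)))).
  rewrite -[RHS]/(D2 i (A2 i (src_i p i (x, y)))).
  rewrite psiP // [phi i _]phiP // A1P // D1P // A2P // [RHS]D2P // -!linearB; congr (src_i p i _).
  pose z := x + adj acQ ol i y.
  rewrite -[lin_copair _ _ _]/z -[lin_snd _]/y.
  rewrite -[lin_add _ _ _]/(PPmap v la i y - r i z).
  rewrite -[X in _ - X - _]/(z + adj acQ ok i (r i z), PPmap v ka i (r i z)).
  rewrite -[X in _ - X]/(adj acQ (lin_comp k s') i y, PPmap v (lin_comp sC s') i y).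
  rewrite -[RHS]/(adj acQ ok i (PPmap v la i y - r i z), PPmap v ka i (PPmap v la i y - r i z)).
  rewrite (lprod_subE x _ y) lprod_subE; congr (_, _); rewrite linearB.
    have e : adj acQ ol i y + adj acQ (lin_comp k s') i y + adj acQ ok i (PPmap v la i y) = 0.
      pose f j := lin_add (lin_add (adj acQ ol j) (adj acQ (lin_comp k s') j))
        (lin_comp (adj acQ ok j) (PPmap v la j)).
      apply: (PP_ext acQ sink_v (f := f) (g := fun j => lin_zero (PP v C j) (Y j))).
      - move=> j l hj hl a c.
        rewrite -[LHS]/(adj acQ ol l _ + adj acQ (lin_comp k s') l _ + adj acQ ok l (PPmap v la l _)).
        by rewrite !rmorP -!linearD.
      - by move=> j l hj hl a c; rewrite -[RHS]/(rep_map Y _ 0) linear0.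
      - move=> c b.
        rewrite -[LHS]/(adj acQ ol (tag b) _ + adj acQ (lin_comp k s') (tag b) _
          + adj acQ ok (tag b) (PPmap v la (tag b) _)).
        by rewrite PPmap_eta !adj_eta -!dsum_addE G2 addNr dsum_zeroE.
    have -> : adj acQ ok i (PPmap v la i y) = - (adj acQ ol i y + adj acQ (lin_comp k s') i y).
      by apply/eqP; rewrite -addr_eq0 addrC e.
    rewrite /z !opprD !addrA subrr add0r [RHS]addrAC; congr (_ - _); exact: addrAC.
  have -> : PPmap v (lin_comp sC s') i y = y - PPmap v ka i (PPmap v la i y).
    apply/dsumP=> b; rewrite dsum_addE dsum_oppE !dsumE; apply/dsumP=> q.
    rewrite dsum_addE dsum_oppE !dsumE; exact: s'P.
  by rewrite opprB [LHS]addrC addrA subrK.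
have [T [a' [b' [pT e']]]] : stably_equal (rhom_sub (rhom_id Z) (rhom_comp phi psi)) (rhom_zero Z Z).
  apply: (stably_equal_trans e1); apply: (stably_equal_through (a := A1) (b := D1)).
    exact: WW_projective.
  by move=> i x; rewrite -[LHS]/(D1 i (A1 i x) - 0) subr0.
exists T, a', b'; split=> // i x.
by rewrite -e' -[RHS]/(x - phi i (psi i x) - 0) subr0.
Qed.

End Comparison.
End Density.

(** * Construction of a preimage for every object *)

Section EssentialSurjectivity.
Variables (R : pzRingType) (Q : quiver) (v : Q0 Q) (acQ : acyclic Q) (sink_v : sink v).
Local Notation Qv := (reflect_quiver v).
Implicit Types (X : rep R Q) (Y : rep R Qv) (C M : fgmod R).

Let acQv : acyclic Qv := reflect_quiver_acyclic acQ.

Lemma start_sum_exact (A B C : rep R Qv) (i : rhom A B) (q : rhom B C) :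
  exact_seq i q -> short_exact (start_sum_map i) (start_sum_map q).
Proof. by move=> ex; apply: dsum_map_exact => b; exact: ex. Qed.

Lemma snk_start_sum_coresolved Y : coresolved Y -> coresolved (snk (lin_id (start_sum Y))).
Proof.
move=> cY; apply: (coresolved_image (Phi := fun Y X => X = snk (lin_id (start_sum Y)))) cY (erefl _).
move=> Y1 Y2 _ _ _ [P [i [q [pP ex]]]] ->; exists (snk (lin_id (start_sum Y2))) => //.
pose p (A : rep R Qv) := snk_presP sink_v (lin_id (start_sum A)).
have map (A B : rep R Qv) (f : rhom A B) :
    exists h : rhom (snk (lin_id (start_sum A))) (snk (lin_id (start_sum B))),
    (forall x, h v (snk_iv (p A) x) = snk_iv (p B) (start_sum_map f x)) /\
    (forall i, i != v -> forall x, h i (snk_i (p A) i x) = snk_i (p B) i (f i x)).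
  by apply: (snk_hom sink_v (p A) (p B) (fv := start_sum_map f) (f := rmor f)) => //; exact: rhom_ahom.
have [i' [iv ii]] := map _ _ i; have [q' [qv qi]] := map _ _ q.
exists (snk (lin_id (start_sum P))), i', q'; split; first exact: snk_start_sum_projective.
by apply: (snk_exact iv ii qv qi (start_sum_exact ex)) => j _; exact: ex.
Qed.

Lemma at_sink_coresolved Y : coresolved Y -> coresolved (at_sink v (Y v)).
Proof.
move=> cY; apply: (coresolved_image (Phi := fun Y X => X = at_sink v (Y v))) cY (erefl _).
move=> Y1 Y2 _ _ _ [P [i [q [pP ex]]]] ->; exists (at_sink v (Y2 v)) => //.
pose p (M : fgmod R) := at_sink_pres sink_v M.
have map (A B : fgmod R) (f : {linear A -> B}) : exists h : rhom (at_sink v A) (at_sink v B),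
    (forall x, h v (snk_iv (p A) x) = snk_iv (p B) (f x)) /\
    (forall i, i != v -> forall x, h i (snk_i (p A) i x) = snk_i (p B) i (lin_id _ x)).
  apply: (snk_hom sink_v (p A) (p B) (fv := f) (f := fun i => lin_id _)) => // x.
  exact: linear0.
have [i' [iv ii]] := map _ _ (i v); have [q' [qv qi]] := map _ _ (q v).
exists (at_sink v (P v)), i', q'; split.
  by apply: (at_sink_projective sink_v); exact: (projective_rep_at acQv pP).
apply: (snk_exact iv ii qv qi (ex v)) => j _; split=> //; split=> [y|y]; first by exists y.
by rewrite (rep_zero_v_eq0 y); split=> // _; exists 0.
Qed.

(* Lift P -> P_v, onto the representation with P_v at v and 0 elsewhere, along its
   projective cover P_v(P_v). *)
Lemma start_retraction (P : rep R Qv) : projective_rep P ->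
  exists h : forall i, {linear P i -> PP v (P v) i},
    is_ahom h /\ forall y b, h (tag b) (start_map sink_v P y b) = eta v (P v) y b.
Proof.
move=> pP; set J := P v.
pose S := src (lin_zero J (start_sum (rep_zero_v R v))); pose pS := src_presP sink_v (lin_zero J (start_sum (rep_zero_v R v))).
have [||g [gv gP]] := src_hom (WW_pres sink_v J) pS (fv := lin_id _) (f := fun i => lin_zero _ _).
- by [].
- by move=> b x; rewrite dsum_zeroE.
have gS i : surjective_map (g i).
  move=> y; have [iv|hi] := eqVneq i v.
    subst i; exists (src_iv (WW_pres sink_v J) (src_ov pS y)).
    by rewrite gv -[RHS](src_ovK pS).
  by exists 0; rewrite linear0 -(src_oK pS hi y) (rep_zero_v_eq0 (src_o _ _ _)) linear0.
have [||f [fv fP]] := src_hom (src_pres_self sink_v P) pS (fv := lin_id _) (f := fun i => lin_zero _ _).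
- by [].
- by move=> b x; rewrite dsum_zeroE.
have [l lP] := pP _ _ g f gS.
have [lv [h [ha hc lvP _]]] := src_dec (src_pres_self sink_v P) (WW_pres sink_v J) l.
exists h; split=> // y b; rewrite hc; congr (eta v J _ b).
apply: (can_inj (src_ivK pS)).
by rewrite -[LHS]gv -lvP lP -[LHS]/(f v (src_iv (src_pres_self sink_v P) y)) fv.
Qed.

Hypothesis injR : selfinjective R.

Lemma reflect_dense Y : coresolved Y ->
  exists2 X, coresolved X & forall c : object_choice v X,
    exists (phi : rhom Y (reflect_rep c)) (psi : rhom (reflect_rep c) Y),
      stably_equal (rhom_comp psi phi) (rhom_id Y) /\
      stably_equal (rhom_comp phi psi) (rhom_id (reflect_rep c)).
Proof.
move=> cY; have [Y1 [P [i [q [pP ex]]]] cY1] := coresolved_step cY.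
pose J := P v; pose sg : {linear Y v -> J} := i v.
have sgI : injective sg := (ex v).1.
have [qS qK] := (ex v).2.
have pJ : projective_module J := projective_rep_at acQv pP.
pose D := fg_prod (start_sum Y) J.
(* The sign makes the cokernel of [j] the pushout of [start_map sink_v Y] and [sg]. *)
pose j : {linear Y v -> D} := lin_pair (start_map sink_v Y) (lin_opp sg).
have [XV [q0 [q0S q0K]]] := cokernel_exists j.
pose u : {linear start_sum Y -> XV} := lin_comp q0 lin_inl.
pose iJ : {linear J -> XV} := lin_comp q0 lin_inr.
have q0E a b : q0 (a, b) = u a + iJ b.
  rewrite -[RHS]/(q0 (a, 0) + q0 (0, b)) -linearD; congr (q0 _).
  by rewrite [RHS]surjective_pairing /= addr0 add0r.
have ker0 a b : u a = iJ b -> exists2 y, start_map sink_v Y y = a & sg y = b.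
  move=> e; have /q0K[y yP] : q0 (a, - b) = 0 by rewrite q0E linearN e subrr.
  move: yP => [ya yb]; exists y => //.
  by apply: oppr_inj.
have uw y : u (start_map sink_v Y y) = iJ (sg y).
  apply/eqP; rewrite -subr_eq0 -linearN -q0E; apply/eqP/q0K; exists y.
  by [].
have uI : injective u.
  apply: linear_injP => x x0; have [|y <- y0] := ker0 x 0; first by rewrite x0 linear0.
  by rewrite (injective0 sgI y0) linear0.
pose X := snk u; pose pX := snk_presP sink_v u.
(* The cokernel of [u] is that of [sg], namely [Y1 v]; so [X] is an extension of [at_sink v (Y1 v)]
   by (Y, H Y, id). *)
have cX : coresolved X.
  have [||a [av aP]] := snk_hom sink_v (snk_presP sink_v (lin_id (start_sum Y))) pX
    (fv := u) (f := fun i => lin_id (Y i)).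
  - by [].
  - by move=> x; congr (u _); apply/dsumP=> b; rewrite dsumE.
  have [|rho rhoP] := lin_factor_surj (p := q0) (g := lin_comp (q v) lin_snd) q0S.
    move=> _ /q0K[y <-]; rewrite -[LHS]/(q v (- sg y)) linearN.
    by rewrite (exact_comp0 ex) oppr0.
  have rhou x : rho (u x) = 0 by rewrite [rho _]rhoP -[LHS]/(q v 0) linear0.
  have [||b [bv bP]] := snk_hom sink_v pX (at_sink_pres sink_v (Y1 v))
    (fv := rho) (f := fun i => lin_zero _ _).
  - by [].
  - by move=> x; rewrite rhou.
  apply: (coresolved_extension injR acQ (i := a) (q := b)) => //.
  - apply: (snk_exact av aP bv bP) => [|l _].
      split=> //; split=> [y|y].
        have [c <-] := qS y; exists (iJ c); exact: rhoP.
      split=> [|[x <-]]; last exact: rhou.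
      have [[x c] <-] := q0S y; rewrite rhoP -[LHS]/(q v c) => /qK[z zP].
      by exists (x + start_map sink_v Y z); rewrite linearD uw [sg z]zP q0E.
    split=> //; split=> [y|y]; first by exists 0; rewrite (rep_zero_v_eq0 y).
    by split=> // _; exists y.
  - exact: snk_start_sum_coresolved.
  - exact: at_sink_coresolved.
exists X => // c.
have [h [ha hw]] := start_retraction pP.
pose io : {linear start_sum Y -> in_sum X v} := dsum_map (fun b : in_arrow v => snk_i pX (tag b)).
pose oi : {linear in_sum X v -> start_sum Y} := dsum_map (fun b : in_arrow v => snk_o pX (tag b)).
have oiK z : io (oi z) = z.
  by apply/dsumP=> b; rewrite !dsumE snk_oK // in_arrow_neq.
have ioK z : oi (io z) = z.
  by apply/dsumP=> b; rewrite !dsumE snk_iK // in_arrow_neq.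
have inE y : in_map X v (io y) = snk_iv pX (u y).
  move: y; apply: (dsum_ext (f := lin_comp (in_map X v) io) (g := lin_comp (snk_iv pX) u)) => b y.
  rewrite -[RHS]/(snk_iv pX (u (dsum_in b y))) -snk_end -in_map_in; congr (in_map X v _).
  apply/dsumP=> b'; rewrite dsumE; have [<-|ne] := eqVneq b b'; first by rewrite !dsum_in_eq.
  by rewrite !dsum_in_neq // linear0.
pose pr := reflect_pres sink_v c.
pose k : {linear oc_Omega c -> start_sum Y} := lin_comp oi (oc_k c).
pose w : {linear oc_Omega c -> start_sum (rep_sum Y (PP v (oc_C c)))} :=
  Lin (dsum_glue (M := fun b : in_arrow v => rep_sum Y (PP v (oc_C c)) (tag b) : lmodType R) (fun b =>
    lin_pair (lin_comp (dsum_proj (M := fun b : in_arrow v => Y (tag b) : lmodType R) b) k)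
     (lin_comp (dsum_proj (M := fun b : in_arrow v => PP v (oc_C c) (tag b) : lmodType R) b)
       (lin_comp (eta v (oc_C c)) (oc_sigma c))))).
have wE o b : w o b = (k o b, eta v (oc_C c) (oc_sigma c o) b) by rewrite dsumE.
(* Away from [v] the representation [X] is a copy of [Y], so the reflection can be presented over
   [Y] plus [PP v (oc_C c)], the form that the comparison needs. *)
have p : src_pres sink_v (reflect_rep c) w.
  apply: (@SrcPres _ _ _ _ _ _ _ w (src_iv pr) (src_ov pr)
    (fun i => lin_comp (src_i pr i) (lin_pair (lin_comp (snk_i pX i) lin_fst) lin_snd))
    (fun i => lin_comp (lin_pair (lin_comp (snk_o pX i) lin_fst) lin_snd) (src_o pr i))).
  - exact: src_ivK.
  - exact: src_ovK.
  - move=> l hl [x y]; rewrite -[LHS]/(let z := src_o pr l (src_i pr l (snk_i pX l x, y)) in (snk_o pX l z.1, z.2)).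
    by rewrite src_iK // -[LHS]/(snk_o pX l (snk_i pX l x), y) snk_iK.
  - move=> l hl z; rewrite -[LHS]/(src_i pr l (snk_i pX l (snk_o pX l (src_o pr l z).1), (src_o pr l z).2)).
    by rewrite snk_oK // -surjective_pairing src_oK.
  - move=> b x; rewrite src_start wE reflect_wE.
    rewrite -[RHS]/(src_i pr (tag b) (snk_i pX (tag b) (k x b), _)); congr (src_i pr _ (_, _)).
    by rewrite dsumE snk_oK // in_arrow_neq.
  - move=> l l' hl hl' a [x y].
    rewrite -[RHS]/(src_i pr l' (snk_i pX l' (rep_map Y (away_arrow hl hl' a) x), rep_map (PP v (oc_C c)) (away_arrow hl hl' a) y)).
    rewrite src_away -(snk_away pX hl hl') -(away_map_away hl hl').
    by [].
have piu x : oc_pi c (snk_iv pX (u x)) = 0.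
  by rewrite -inE; apply/(oc_piP c).2; exists (io x).
have tE x : snk_iv pX (snk_ov pX (oc_t c x)) = oc_t c x by rewrite snk_ovK.
(* The family from [Y] to [PP v J] is the one given by [start_retraction] on [P], after the
   embedding of [Y] in [P]. *)
apply: (@comparison_equiv R Q v acQ sink_v Y (reflect_rep c) J (oc_C c) (oc_Omega c) (oc_bar c) XV
  sg (oc_sigma c) u (lin_comp (oc_pi c) (snk_iv pX)) iJ (lin_comp (snk_ov pX) (oc_t c)) k w p
  (fun l => lin_comp (h l) (i l))) => //.
- by have [] := oc_deltaP c.
- exact: (oc_sigmaP c).1.
- move=> x; split=> [/(oc_piP c).2[z zP]|[y <-]]; last exact: piu.
  by exists (oi z); apply: (can_inj (snk_ivK pX)); rewrite -inE oiK.
- move=> b; have [x <-] := (oc_piP c).1 b.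
  have [[y z] yz] := q0S (snk_ov pX x); exists z.
  by rewrite -(snk_ovK pX x) -yz q0E !linearD piu add0r.
- move=> b; have [_ dS _] := oc_deltaP c; have [x <-] := dS b; exists x.
  by rewrite -[LHS]/(oc_pi c (snk_iv pX (snk_ov pX (oc_t c x)))) tE oc_tP.
- move=> x; split=> [/(oc_piP c).2[z zP]|[y <-]]; last by rewrite -uw; exact: piu.
  have [|y _ yP] := ker0 (oi z) x; last by exists y.
  by apply: (can_inj (snk_ivK pX)); rewrite -inE oiK.
- move=> x; rewrite -[X in X = 0 <-> _]/(oc_pi c (snk_iv pX (snk_ov pX (oc_t c x)))) tE oc_tP.
  exact: (oc_sigmaP c).2.
- move=> o; apply: (can_inj (snk_ivK pX)).
  rewrite -[RHS]/(snk_iv pX (snk_ov pX (oc_t c (oc_sigma c o)))) tE.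
  by rewrite -inE [io _]oiK oc_kP.
- move=> l l' hl hl' a x; rewrite -[LHS]/(h l' (i l' _)) rmorP ha.
  by [].
- move=> y b; rewrite -hw -[LHS]/(h (tag b) (i (tag b) _)); congr (h _ _).
  by rewrite !dsumE rmorP.
Qed.

End EssentialSurjectivity.

(** * The equivalence *)

Section Equivalences.
Variables (C D : category) (F : functor C D).

(** The inverse is chosen on objects by density and on morphisms by fullness; its functor laws are
    checked after applying [F] and reflected by faithfulness. *)
Lemma equivalence_of_full_faithful_dense :
  (forall (X Y : C) (g : Mor (F X) (F Y)), exists f : Mor X Y, heq (fhom F f) g) ->
  (forall (X Y : C) (f g : Mor X Y), heq (fhom F f) (fhom F g) -> heq f g) ->
  (forall Y : D, exists (X : C) (e : Mor (F X) Y) (e' : Mor Y (F X)),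
    heq (hcomp e' e) (idm (F X)) /\ heq (hcomp e e') (idm Y)) ->
  is_equivalence F.
Proof.
move=> full faithful dense; have [Fheq Fid Fcomp] := fhomP F.
have [G0 GP] := dependent_choice dense.
have [e eP] := dependent_choice GP.
have [e' e'P] := dependent_choice eP.
have e'e Y : heq (hcomp (e' Y) (e Y)) (idm _) := (e'P Y).1.
have ee' Y : heq (hcomp (e Y) (e' Y)) (idm _) := (e'P Y).2.
have [lift liftP] := dependent_choice (fun X => dependent_choice (fun Y => dependent_choice (full X Y))).
have cancel_l A Y (g : Mor A (F (G0 Y))) : heq (hcomp (e' Y) (hcomp (e Y) g)) g.
  apply: heq_trans (Defs.compA _ _ _) _; apply: heq_trans (comp_heq (e'e Y) (heq_refl _)) _.
  exact: comp_idl.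
have cancel_r A Y (g : Mor A Y) : heq (hcomp (e Y) (hcomp (e' Y) g)) g.
  apply: heq_trans (Defs.compA _ _ _) _; apply: heq_trans (comp_heq (ee' Y) (heq_refl _)) _.
  exact: comp_idl.
pose Gm Y Y' (g : Mor Y Y') : Mor (G0 Y) (G0 Y') := lift _ _ (hcomp (e' Y') (hcomp g (e Y))).
have GmP Y Y' (g : Mor Y Y') : heq (fhom F (Gm Y Y' g)) (hcomp (e' Y') (hcomp g (e Y))).
  exact: liftP.
have Gnat Y Y' (g : Mor Y Y') : heq (hcomp (e Y') (fhom F (Gm Y Y' g))) (hcomp g (e Y)).
  apply: heq_trans (comp_heq (heq_refl _) (GmP _ _ g)) _; exact: cancel_r.
have Glaws : functor_laws Gm.
  split=> [Y Y' f g fg|Y|Y Y' Y'' g f]; apply: faithful.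
  - apply: heq_trans (GmP _ _ f) _; apply: heq_sym; apply: heq_trans (GmP _ _ g) _.
    by apply/heq_sym/comp_heq; [exact: heq_refl | apply: comp_heq => //; exact: heq_refl].
  - apply: heq_trans (GmP _ _ _) _; apply: heq_trans (comp_heq (heq_refl _) (comp_idl _)) _.
    by apply: heq_trans (e'e Y) _; apply: heq_sym.
  - apply: heq_trans (GmP _ _ _) _; apply: heq_sym; apply: heq_trans (Fcomp _ _ _ _ _) _.
    apply: heq_trans (comp_heq (GmP _ _ g) (heq_refl _)) _.
    apply: heq_trans (heq_sym (Defs.compA _ _ _)) _; apply: comp_heq; first exact: heq_refl.
    apply: heq_trans (heq_sym (Defs.compA _ _ _)) _.
    apply: heq_trans (comp_heq (heq_refl _) (Gnat _ _ f)) _; exact: Defs.compA.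
exists (Functor Glaws); split.
  exists (fun X => lift _ _ (e (F X))), (fun X => lift _ _ (e' (F X))).
  have l1 X : heq (fhom F (lift _ _ (e (F X)) : Mor (G0 (F X)) X)) (e (F X)) by exact: liftP.
  have l2 X : heq (fhom F (lift _ _ (e' (F X)) : Mor X (G0 (F X)))) (e' (F X)) by exact: liftP.
  split=> [X|X|X Y f]; apply: faithful.
  - apply: heq_trans (Fcomp _ _ _ _ _) _; apply: heq_trans (comp_heq (l2 X) (l1 X)) _.
    by apply: heq_trans (e'e _) _; apply: heq_sym.
  - apply: heq_trans (Fcomp _ _ _ _ _) _; apply: heq_trans (comp_heq (l1 X) (l2 X)) _.
    by apply: heq_trans (ee' _) _; apply: heq_sym.
  - apply: heq_trans (Fcomp _ _ _ _ _) _; apply: heq_trans (comp_heq (l1 Y) (heq_refl _)) _.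
    apply: heq_trans (Gnat _ _ (fhom F f)) _; apply: heq_sym.
    by apply: heq_trans (Fcomp _ _ _ _ _) _; apply: comp_heq; first exact: heq_refl.
by exists e, e'; split.
Qed.
End Equivalences.

Theorem theorem1p1 (k : fieldType) (L : falgType k) (hL : selfinjective L)
    (Q : quiver) (hQ : acyclic Q) (v : Q0 Q) (hv : sink v) :
  (* the choices entering the construction of F(v) can be made *)
  (forall X : stable_gproj L Q, inhabited (object_choice v X)) /\
  (forall (X Y : stable_gproj L Q) (cX : object_choice v X) (cY : object_choice v Y)
    (f : Mor X Y), inhabited (morphism_choice cX cY f)) /\
  (* and any choices define a functor F(v), which is an equivalence *)
  forall (c : forall X : stable_gproj L Q, object_choice v X)
    (m : forall (X Y : stable_gproj L Q) (f : Mor X Y), morphism_choice (c X) (c Y) f),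
  exists (obj_gp : forall X : stable_gproj L Q, gorenstein_projective (reflect_rep (c X)))
    (mor_hom : forall (X Y : stable_gproj L Q) (f : Mor X Y), is_rhom (reflect_rep (c X)) (reflect_rep (c Y)) (reflect_mor (m X Y f)))
    (laws : @functor_laws (stable_gproj L Q) (stable_gproj L (reflect_quiver v))
      (fun X => GProj (obj_gp X)) (fun X Y f => RHom (mor_hom X Y f))),
  is_equivalence (Functor laws).
Proof.
have kerL : kernels_fg L := @fg_kernel k L.
have covL := @projective_cover_exists k L.
have acQv := reflect_quiver_acyclic (v := v) hQ.
have cor (X : gproj L Q) : coresolved X := gproj_coresolved kerL (gp_repP X).
have inX (X : gproj L Q) : injective (in_map X v) := coresolved_sepmono hQ (cor X) (i := v).
split=> [X|]; first exact: object_choice_exists kerL covL (inX X).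
split=> [X Y cX cY f|c m]; first exact: morphism_choice_exists (inX Y).
have obj_gp X : gorenstein_projective (reflect_rep (c X)).
  by apply: (coresolved_gproj hL kerL acQv); exact: (reflect_coresolved hQ hv hL (c X) (cor X)).
pose mor_hom (X Y : stable_gproj L Q) (f : Mor X Y) := reflect_mor_hom hQ hv (inX Y) (m X Y f).
pose F (X Y : stable_gproj L Q) (f : Mor X Y) := reflect_rhom hQ hv (inX Y) (m X Y f).
exists obj_gp, mor_hom.
(* Another choice for the same map gives a stably equal morphism. Identities and composites can
   therefore be computed with choices for which the functor law holds strictly. *)
have irr (X Y : gproj L Q) (f f' : rhom X Y) (n : morphism_choice (c X) (c Y) f')
    (e : forall i x, f i x = f' i x) :
    stably_equal (F X Y f) (reflect_rhom hQ hv (inX Y) n).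
  exact: reflect_choice_irrelevant.
have laws : @functor_laws (stable_gproj L Q) (stable_gproj L (reflect_quiver v))
    (fun X => GProj (obj_gp X)) (fun X Y f => RHom (mor_hom X Y f)).
  split=> [X Y f g fg|X|X Y Z g f].
  - exact: (reflect_stably_equal hQ hv (inX Y) (m X Y f) (m X Y g) kerL covL fg).
  - have [n nP] := morphism_choice_id hQ hv (c X).
    apply: stably_equal_trans (irr X X _ _ n (fun _ _ => erefl)) _.
    exact: stably_equal_ext.
  - have [n nP] := morphism_choice_comp hQ hv (m Y Z g) (m X Y f).
    apply: stably_equal_trans (irr X Z _ _ n (fun _ _ => erefl)) _.
    exact: stably_equal_ext.
exists laws; apply: equivalence_of_full_faithful_dense => [X Y g|X Y f g fg|Y].
- have [f [n fP]] := reflect_full hQ hv (inX X) (inX Y) hL g.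
  exists f; exact: stably_equal_trans (irr X Y _ _ n (fun _ _ => erefl)) fP.
- have [T [a [b [pT ab]]]] := fg.
  have [n nP] := morphism_choice_sub hQ hv (m X Y f) (m X Y g).
  have [|P [al [be [pP abP]]]] := reflect_faithful hQ hv (inX X) hL (m := n) (a := a) (b := b) pT.
    by move=> i x; rewrite nP; exact: ab.
  by exists P, al, be.
- have [X cX XP] := reflect_dense hQ hv hL (gproj_coresolved kerL (gp_repP Y)).
  pose X' := GProj (coresolved_gproj hL kerL hQ cX).
  have [phi [psi [e1 e2]]] := XP (c X').
  by exists X', psi, phi.
Qed.
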